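(* Let $(X_i)_{i\in\mathbb Z}$, $X_i=X_0\circ T^i$, be a stationary sequence of centered random variables in $L^3$ (not necessarily adapted to $(\mathcal F_i)$), and let $\sigma_n^2=n^{-1}\mathbb E(S_n^2)$. Assume that $$\sum_{n\ge 1}\frac1n\Big\Vert\sum_{k\ge n}\mathbb E(X_k|\mathcal F_0)\Big\Vert_3<\infty\quad\text{and}\quad\sum_{n\ge 1}\frac1n\Big\Vert\sum_{k\ge n}\big(X_{-k}-\mathbb E(X_{-k}|\mathcal F_0)\big)\Big\Vert_3<\infty ,$$ and in addition that $$\sum_{n\ge 1}n^{-1/2}\big\Vert n^{-1}\mathbb E(S_n^2|\mathcal F_0)-\sigma_n^2\big\Vert_{3/2}<\infty .$$ Then the series $\sum_{k\in\mathbb Z}\mathrm{Cov}(X_0,X_k)$ converges to some nonnegative $\sigma^2$, and, as $n\to\infty$, 1. $\zeta_1(P_{n^{-1/2}S_n},G_{\sigma^2})=O(n^{-1/2}\log n)$; 2. $\zeta_r(P_{n^{-1/2}S_n},G_{\sigma^2})=O(n^{-1/2})$ for $r\in\,]1,2]$; 3. $\zeta_r(P_{n^{-1/2}S_n},G_{\sigma_n^2})=O(n^{-1/2})$ for $r\in\,]2,3]$.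
   Context: Setting: $(\Omega,\mathcal A,\mathbb P)$ is a probability space, $T:\Omega\to\Omega$ is a bijective bimeasurable transformation preserving $\mathbb P$, $\mathcal F_0\subseteq\mathcal A$ is a $\sigma$-algebra with $\mathcal F_0\subseteq T^{-1}(\mathcal F_0)$, and $\mathcal F_i=T^{-i}(\mathcal F_0)$. $X_i=X_0\circ T^i$ and $S_n=X_1+\cdots+X_n$. $\|\cdot\|_q$ is the $L^q(\mathbb P)$ norm; the infinite sums over $k$ inside $\|\cdot\|_3$ are understood as series converging in $L^3$. $P_Z$ is the law of a random variable $Z$; $G_v$ is the normal law $N(0,v)$. Zolotarev distance: for real $r>0$ let $l\ge 0$ be the integer with $l<r\le l+1$. $\Lambda_r$ is the class of real functions $f$ on $\mathbb R$ that are $l$-times continuously differentiable with $|f^{(l)}(x)-f^{(l)}(y)|\le|x-y|^{r-l}$ for all $x,y\in\mathbb R$. For probability measures $\mu,\nu$ on $\mathbb R$, $\zeta_r(\mu,\nu)=\sup\{\int f\,d\mu-\int f\,d\nu: f\in\Lambda_r\}$. *)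

(* Defs.v *)
From HB Require Import structures.
From mathcomp Require Import all_boot all_order all_algebra.
From mathcomp Require Import all_classical all_reals all_analysis measurable_realfun.

Set Implicit Arguments.
Unset Strict Implicit.
Unset Printing Implicit Defensive.

Import Order.TTheory GRing.Theory Num.Theory.
Import numFieldNormedType.Exports.

Local Open Scope classical_set_scope.
Local Open Scope ring_scope.

(* Meant for mutually inverse [f] and [g]: the [i]-th power of [f]. *)
Definition iterz (T : Type) (f g : T -> T) (i : int) : T -> T :=
  match i with Posz n => iter n f | Negz n => iter n.+1 g end.

(* A series over the integers converges when its two one-sided halves do. *)
Definition is_sum_int (R : realType) (u : int -> R) (s : R) : Prop :=
  exists a b : R,
    [/\ (\sum_(0 <= k < n) u k%:Z) @[n --> \oo] --> a,
        (\sum_(1 <= k < n) u (- k%:Z)) @[n --> \oo] --> b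
      & s = a + b].

Definition ereal_bigO (R : realType) (u : nat -> \bar R) (v : nat -> R) : Prop :=
  exists C : R, \forall n \near \oo, (`|u n| <= (C * v n)%:E)%E.

Section conditional_expectation.
Context (d : measure_display) (T : measurableType d) (R : realType).
Variables (P : probability T R) (F : set (set T)).

Definition is_condexp (X Y : T -> R) : Prop :=
  [/\ forall B, measurable B -> F (Y @^-1` B),
      P.-integrable setT (EFin \o Y)
    & forall A, F A ->
        (\int[P]_(w in A) (Y w)%:E = \int[P]_(w in A) (X w)%:E)%E].

(* A version of the conditional expectation of [X] given [F]; by [condexpP] it
   exists as soon as [X] is integrable. *)
Definition condexp (X : T -> R) : T -> R := xget (cst 0) (is_condexp X).

Section existence.
Hypotheses (sF : sigma_algebra setT F) (FT : F `<=` measurable).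
Variable X : T -> R.
Hypothesis iX : P.-integrable setT (EFin \o X).

Let FE : <<s F >> = F.
Proof. exact: sigma_algebra_id. Qed.

Let TF : measurableType F.-sigma := g_sigma_algebraType F.

Let measF (A : set TF) : measurable A -> measurable (A : set T).
Proof. by move=> mA; apply: FT; rewrite -FE. Qed.

Let idF : T -> TF := id.

Let midF : measurable_fun setT idF.
Proof. by move=> _ B; rewrite setTI => mB; exact: measF. Qed.

Let phi : {mfun T >-> TF} := mfun_Sub (mem_set midF).

Let idom : induced_charge iX `<< P.
Proof.
apply/null_content_dominatesP => A mA A0.
apply: null_set_integral => //.
apply: measurable_funTS; exact: measurable_int iX.
Qed.

(* [induced_charge iX] restricted to [F]. *)
Let nu (A : set TF) : \bar R := induced_charge iX (A : set T).

Let nu0 : nu set0 = 0%E.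
Proof. exact: charge0. Qed.

Let nufin (A : set TF) : measurable A -> nu A \is a fin_num.
Proof. by move=> /measF mA; exact: fin_num_measure. Qed.

Let nusa : semi_sigma_additive nu.
Proof.
move=> A mA tA mbA; apply: charge_semi_sigma_additive => //.
- by move=> n; exact: measF.
- exact: measF.
Qed.

Lemma condexpP : is_condexp X (condexp X).
Proof.
rewrite /condexp; apply: xgetPex.
pose nuF : {charge set TF -> \bar R} :=
  HB.pack nu (isCharge.Build _ _ _ nu nu0 nufin nusa).
have dom : nuF `<< distribution P phi.
  apply/null_content_dominatesP => A mA A0.
  by move/null_content_dominatesP : idom; apply => //; exact: measF.
pose g : TF -> \bar R := Radon_Nikodym nuF (distribution P phi).
have gfin x : g x \is a fin_num by exact: Radon_Nikodym_fin_num.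
have ig : (distribution P phi).-integrable setT g by exact: Radon_Nikodym_integrable.
case/integrableP : (ig) => mg _.
have gE : g = EFin \o (fine \o g).
  by apply/funext => x /=; rewrite fineK.
have mfg : measurable_fun [set: TF] (fine \o g).
  by apply/measurable_EFinP; rewrite -gE.
have igT : P.-integrable setT (g : T -> \bar R).
  apply/integrableP; split.
    by apply: (measurableT_comp mg midF).
  case/integrableP : ig => _; rewrite ge0_integral_distribution//.
  exact: measurableT_comp.
exists (fine \o g); split.
- move=> B mB; have : (<<s F >>) (setT `&` (fine \o g) @^-1` B) by exact: mfg.
  by rewrite setTI FE.
- by rewrite -gE.
- move=> A FA.
  have mA : measurable (A : set TF) by exact: sub_sigma_algebra.
  transitivity (nuF A); last by [].
  rewrite (Radon_Nikodym_integral dom mA).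
  rewrite /distribution integral_pushforward//.
  + by apply: eq_integral => x _ /=; rewrite fineK.
  + by apply: (integrableS measurableT (FT FA)) => //; exact: igT.
Qed.

End existence.
End conditional_expectation.

Section Lp_series.
Context (d : measure_display) (T : measurableType d) (R : realType).
Variables (P : probability T R) (p : \bar R).

(* [Y] is the sum in L^p of the series of the [Z k], [k >= n]. *)
Definition is_Lp_tail_sum (Z : nat -> T -> R) (n : nat) (Y : T -> R) : Prop :=
  Y \in Lfun P p /\
  'N[P]_p[(fun w => (\sum_(n <= k < N) Z k w - Y w)%:E)]%E @[N --> \oo] --> 0%E.

Definition tail_norm_summable (Z : nat -> T -> R) : Prop :=
  exists2 Y : nat -> T -> R,
    forall n, (0 < n)%N -> is_Lp_tail_sum Z n (Y n)
  & (\sum_(1 <= n <oo) (n%:R^-1)%:E * 'N[P]_p[EFin \o Y n] < +oo)%E.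

End Lp_series.

Section partial_sums.
Context (d : measure_display) (T : measurableType d) (R : realType).
Variables (P : probability T R) (X : int -> {mfun T >-> R}).

Definition psum (n : nat) : {mfun T >-> R} := \sum_(1 <= k < n.+1) X k%:Z.

Definition mean_var (n : nat) : R :=
  n%:R^-1 * fine ('E_P[(fun w => psum n w ^+ 2)%R])%E.

Definition psum_law (n : nat) : probability (R : measurableType _) R :=
  distribution P (n%:R `^ (- 2^-1) *: psum n).

End partial_sums.

Section normal_law.
Context (R : realType).

(* [normal_prob] is a probability on [measurableTypeR R], random variables
   take their values in [R]: two copies of the reals with the same measurable
   sets but distinct displays. *)
Definition Rid : measurableTypeR R -> R := idfun.

HB.instance Definition _ :=
  @isMeasurableFun.Build _ _ _ _ Rid (@measurable_id _ _ setT).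

(* The law N(0, v). The case v = 0 is separate because [normal_prob 0 0] is not
   the Dirac mass at 0. *)
Definition normal0 (v : R) : probability (R : measurableType _) R :=
  if 0 < v
  then distribution (normal_prob 0 (Num.sqrt v)) Rid : probability _ R
  else dirac (0 : R) : probability _ R.

End normal_law.

Section zolotarev.
Context (R : realType).

Definition C_class (l : nat) (f : R -> R) : Prop :=
  (forall k, (k < l)%N -> forall x, derivable (derive1n k f) x 1) /\
  continuous (derive1n l f).

Definition zolotarev_class (r : R) : set (R -> R) :=
  [set f | exists l : nat, [/\ l%:R < r <= l.+1%:R, C_class l f
     & forall x y, `|derive1n l f x - derive1n l f y| <= `|x - y| `^ (r - l%:R)]].

Definition zolotarev (r : R) (mu nu : probability (R : measurableType _) R)
    : \bar R :=
  ereal_sup [set (\int[mu]_x (f x)%:E - \int[nu]_x (f x)%:E)%E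
            | f in zolotarev_class r].

End zolotarev.

(* Main.v *)
(** Summing the tails of the two series in L^3 gives [X_0 o T = D + W - W o T]
with [D] a martingale difference, so that [S_n = M_n + W - W o T^n] and the
coboundary costs only O(n^(-1/2)).  For [M_n] one uses Lindeberg's method with
the Gaussian smoothings [g_j = f * N(0, j s^2)], whose second derivatives are
Lipschitz with constant O(j^((r-3)/2)).  The second order terms
[E (g_j''(M_(k-1)) (D_k^2 - s^2))] are not small individually: they are added
over dyadic blocks of indices, on which [g_j''(M_(k-1))] hardly varies, and the
sum over a block of length 2^l is controlled by
[|| E (M_(2^l)^2 | F_0) - 2^l s^2 ||].  The condition on [E (S_n^2 | F_0)], once
transferred to [M_n] and averaged over [n], makes these norms summable against
2^(-l/2), so the total error for [f] in the class of order [r] is of order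
[sum_(j <= n) j^((r-3)/2)], to be divided by [n^(r/2)]. *)

From HB Require Import structures.
Require Import Defs.
From mathcomp Require Import all_boot all_order all_algebra.
From mathcomp Require Import all_classical all_reals all_analysis measurable_realfun.
From mathcomp Require Import ring lra zify.

Set Implicit Arguments.
Unset Strict Implicit.
Unset Printing Implicit Defensive.

Import Order.TTheory GRing.Theory Num.Theory.
Import numFieldNormedType.Exports.

Local Open Scope classical_set_scope.
Local Open Scope ring_scope.

(** * Expectations and the norm of L^3 *)

(** Only blocks of length 2^l enter the dyadic argument, while the hypotheses bound weighted sums
    over all n of norms that need not be monotone in n. So a bound for a block is an average over
    its cut points, and the cost of passing from S_n to M_n is an average over lags m. That cost is
    the main obstacle: E (Z M_n (W - W o T^n)) is only O(sqrt n) by Hoelder, which is not summable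
    against 2^(-l/2). Cutting W at lag m gives O(sqrt m) plus sqrt n times the tails at m; for n =
    2^l and m <= 2^(l/2) the first part is geometric in l and the second is summable by the first
    two hypotheses. As W need not be adapted, it is made measurable for F_m by adding a shifted
    tail. L^(3/2) norms of conditional expectations appear in dual form, tested against Z in L^3.
    Taylor polynomials at 0 are not bounded over the class and are removed first: centring kills the
    linear part, and for r > 2 the quadratic part forces the variance sigma_n^2. The summed errors
    are O(n^((r-1)/2)) for r > 1 and O(log n) for r = 1. If s = 0 smoothing does nothing, but M_n is
    then 0 almost surely. *)

HB.lock Definition Ex (d : measure_display) (T : measurableType d)
  (R : realType) (P : probability T R) (f : T -> R) : R := \int[P]_x f x.

HB.lock Definition N3 (d : measure_display) (T : measurableType d)
    (R : realType) (P : probability T R) (f : T -> R) : R :=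
  Ex P (fun x => `|f x| ^+ 3) `^ 3^-1.

Section Expectation.
Context (d : measure_display) (T : measurableType d) (R : realType).
Variable P : probability T R.
Implicit Types (f g h : T -> R).

Local Notation Ex := (Ex P).
Local Notation N3 := (N3 P).

Definition ig f := P.-integrable setT (EFin \o f).

Lemma ig_meas f : ig f -> measurable_fun setT f.
Proof. by move=> /measurable_int/measurable_EFinP. Qed.

Lemma igD f g : ig f -> ig g -> ig (fun x => f x + g x).
Proof. by move=> fi gi; exact: (integrableD _ fi gi). Qed.

Lemma igB f g : ig f -> ig g -> ig (fun x => f x - g x).
Proof. by move=> fi gi; exact: (integrableB _ fi gi). Qed.

Lemma igZ c f : ig f -> ig (fun x => c * f x).
Proof. by move=> fi; exact: (integrableZl _ c fi). Qed.

Lemma igZr c f : ig f -> ig (fun x => f x * c).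
Proof. by move=> /(igZ c); congr ig; apply/funext => x; rewrite mulrC. Qed.

Lemma igN f : ig f -> ig (fun x => - f x).
Proof. by move=> /(igZ (-1)); congr ig; apply/funext => x; rewrite mulN1r. Qed.

Lemma ig_cst c : ig (fun=> c).
Proof. exact: finite_measure_integrable_cst. Qed.

Lemma ig_le f g : measurable_fun setT f -> (forall x, `|f x| <= g x) ->
  ig g -> ig f.
Proof.
move=> mf fg; apply: le_integrable => //; first exact/measurable_EFinP.
by move=> x _; rewrite /= lee_fin (le_trans (fg x))// ler_norm.
Qed.

Lemma ig_abs f : ig f -> ig (fun x => `|f x|).
Proof. exact: integrable_norm. Qed.

Lemma ig_sum (I : Type) (s : seq I) (Q : pred I) (F : I -> T -> R) :
  (forall i, Q i -> ig (F i)) -> ig (fun x => \sum_(i <- s | Q i) F i x).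
Proof.
move=> Fi; elim: s => [|i s IH].
  by under eq_fun do rewrite big_nil; exact: ig_cst.
under eq_fun do rewrite big_cons.
by case: (boolP (Q i)) => // Qi; apply: igD => //; exact: Fi.
Qed.

Lemma eq_Ex f g : f =1 g -> Ex f = Ex g.
Proof. by move=> /funext ->. Qed.

Lemma Ex_cst c : Ex (fun=> c) = c.
Proof.
rewrite Ex.unlock (Rintegral_cst P measurableT c).
by rewrite [X in fine X](_ : _ = 1%E) ?mulr1//; exact: probability_setT.
Qed.

Lemma ExD f g : ig f -> ig g -> Ex (fun x => f x + g x) = Ex f + Ex g.
Proof. by rewrite Ex.unlock; exact: RintegralD. Qed.

Lemma ExB f g : ig f -> ig g -> Ex (fun x => f x - g x) = Ex f - Ex g.
Proof. by rewrite Ex.unlock; exact: RintegralB. Qed.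

Lemma ExZ c f : ig f -> Ex (fun x => c * f x) = c * Ex f.
Proof. by rewrite Ex.unlock; exact: RintegralZl. Qed.

Lemma ExZr c f : ig f -> Ex (fun x => f x * c) = Ex f * c.
Proof. by rewrite Ex.unlock; exact: RintegralZr. Qed.

Lemma ExN f : ig f -> Ex (fun x => - f x) = - Ex f.
Proof.
move=> fi; rewrite -mulN1r -ExZ//; apply: eq_Ex => x; by rewrite mulN1r.
Qed.

Lemma Ex_sum (I : Type) (s : seq I) (Q : pred I) (F : I -> T -> R) :
  (forall i, Q i -> ig (F i)) ->
  Ex (fun x => \sum_(i <- s | Q i) F i x) = \sum_(i <- s | Q i) Ex (F i).
Proof.
move=> Fi; elim: s => [|i s IH].
  by rewrite big_nil (eq_Ex (g := fun=> 0)) ?Ex_cst// => x; rewrite big_nil.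
rewrite big_cons; case: ifPn => Qi; last first.
  by rewrite -IH; apply: eq_Ex => x; rewrite big_cons (negbTE Qi).
rewrite -IH -ExD; [|exact: Fi|exact: ig_sum].
by apply: eq_Ex => x; rewrite big_cons Qi.
Qed.

Lemma Ex_ge0 f : (forall x, 0 <= f x) -> 0 <= Ex f.
Proof. by move=> f0; rewrite Ex.unlock; apply: Rintegral_ge0. Qed.

Lemma le_Ex f g : ig f -> ig g -> (forall x, f x <= g x) -> Ex f <= Ex g.
Proof. by move=> fi gi fg; rewrite Ex.unlock; apply: le_Rintegral. Qed.

Lemma ler_abs_Ex f : ig f -> `|Ex f| <= Ex (fun x => `|f x|).
Proof. by rewrite Ex.unlock; exact: le_normr_Rintegral. Qed.

Lemma Ex_abs_le f g : ig f -> ig g -> (forall x, `|f x| <= g x) ->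
  `|Ex f| <= Ex g.
Proof.
move=> fi gi fg; apply: le_trans (ler_abs_Ex fi) _.
by apply: le_Ex => //; exact: ig_abs.
Qed.

Lemma ge0_ExE f : ig f -> (\int[P]_x (f x)%:E = (Ex f)%:E)%E.
Proof. by move=> fi; rewrite Ex.unlock /Rintegral fineK//; exact: integrable_fin_num. Qed.

Lemma ae_Ex f g : measurable_fun setT f -> measurable_fun setT g ->
  {ae P, forall x, f x = g x} -> Ex f = Ex g.
Proof.
move=> mf mg fg; rewrite Ex.unlock /Rintegral; congr fine.
apply: ae_eq_integral => //; try exact/measurable_EFinP.
by apply: filterS fg => x fgx _; rewrite fgx.
Qed.

Lemma ae_ig f g : measurable_fun setT f -> measurable_fun setT g ->
  {ae P, forall x, f x = g x} -> ig f -> ig g.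
Proof.
move=> mf mg fg /integrableP[_ fi]; apply/integrableP; split.
  exact/measurable_EFinP.
suff <- : (\int[P]_x `|(EFin \o f) x| = \int[P]_x `|(EFin \o g) x|)%E by [].
apply: ae_eq_integral => //.
- by apply/measurableT_comp => //; exact/measurable_EFinP.
- by apply/measurableT_comp => //; exact/measurable_EFinP.
by apply: filterS fg => x fgx _; rewrite /= fgx.
Qed.

Definition L3 f := measurable_fun setT f /\ ig (fun x => `|f x| ^+ 3).

Lemma N3_ge0 f : 0 <= N3 f.
Proof. by rewrite N3.unlock; exact: powR_ge0. Qed.

Lemma N3X f : N3 f ^+ 3 = Ex (fun x => `|f x| ^+ 3).
Proof.
rewrite N3.unlock -powR_mulrn ?powR_ge0// -powRrM mulVf// powRr1//.
by apply: Ex_ge0 => x; rewrite exprn_ge0.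
Qed.

Lemma eq_N3 f g : (forall x, `|f x| = `|g x|) -> N3 f = N3 g.
Proof. by move=> fg; rewrite N3.unlock; congr (_ `^ _); apply: eq_Ex => x; rewrite fg. Qed.

Lemma LnormE f : L3 f -> ('N[P]_3%:E [EFin \o f] = (N3 f)%:E)%E.
Proof.
move=> [mf fi]; rewrite unlock /Lnorm /=.
have -> : (\int[P]_x (`|f x|%:E `^ 3) = \int[P]_x (`|f x| ^+ 3)%:E)%E.
  by apply: eq_integral => x _; rewrite poweR_EFin powR_mulrn.
by rewrite ge0_ExE// poweR_EFin N3.unlock.
Qed.

Lemma L3P f : L3 f <-> f \in Lfun P 3%:E.
Proof.
rewrite inE; split => [Lf|/andP[/[!inE] mf]].
  apply/andP; split; rewrite !inE; first exact: Lf.1.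
  by rewrite /= /finite_norm LnormE// ltry.
rewrite /= /finite_norm => Nf; split => //.
apply/integrableP; split.
  by apply/measurable_EFinP/measurable_funX/measurableT_comp.
move: Nf; rewrite unlock /Lnorm => /lty_poweRy.
have -> : (\int[P]_x (`|(EFin \o f) x| `^ 3) =
          \int[P]_x (`|(EFin \o (fun x => `|f x| ^+ 3)%R) x|))%E.
  apply: eq_integral => x _ /=.
  by rewrite powR_mulrn// (ger0_norm (exprn_ge0 _ _)).
by apply; rewrite invr_neq0.
Qed.

Lemma L3_meas f : L3 f -> measurable_fun setT f.
Proof. by case. Qed.

Lemma L3_le f g : measurable_fun setT f -> (forall x, `|f x| <= `|g x|) ->
  L3 g -> L3 f /\ N3 f <= N3 g.
Proof.
move=> mf fg [mg gi].
have fi : ig (fun x => `|f x| ^+ 3).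
  apply: ig_le gi => [|x]; first exact/measurable_funX/measurableT_comp.
  by rewrite normrX normr_id lerXn2r ?nnegrE.
split=> //; rewrite N3.unlock; apply: ge0_ler_powR.
- by rewrite invr_ge0.
- by rewrite nnegrE Ex_ge0// => x; rewrite exprn_ge0.
- by rewrite nnegrE Ex_ge0// => x; rewrite exprn_ge0.
- by apply: le_Ex => // x; rewrite lerXn2r ?nnegrE.
Qed.

Lemma L3N f : L3 f -> L3 (fun x => - f x).
Proof.
move=> Lf; apply: (proj1 (L3_le (g := f) _ _ Lf)) => [|x].
  by apply: measurableT_comp => //; exact: L3_meas.
by rewrite normrN.
Qed.

Lemma N3N f : N3 (fun x => - f x) = N3 f.
Proof. by apply: eq_N3 => x; rewrite normrN. Qed.

Lemma L3_abs f : L3 f -> L3 (fun x => `|f x|).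
Proof.
move=> Lf; apply: (proj1 (L3_le (g := f) _ _ Lf)) => [|x].
  exact/measurableT_comp/L3_meas.
by rewrite normr_id.
Qed.

Lemma N3_abs f : N3 (fun x => `|f x|) = N3 f.
Proof. by apply: eq_N3 => x; rewrite normr_id. Qed.

Lemma L3D f g : L3 f -> L3 g -> L3 (fun x => f x + g x).
Proof.
have h : (1 <= 3%:E :> \bar R)%E by rewrite lee_fin ler1n.
by move=> /L3P Lf /L3P Lg; apply/L3P; exact: (proj2 (Lfun_addr_closed P h)).
Qed.

Lemma N3D f g : L3 f -> L3 g -> N3 (fun x => f x + g x) <= N3 f + N3 g.
Proof.
move=> Lf Lg; rewrite -lee_fin EFinD -!LnormE//; last exact: L3D.
by apply: minkowski; [exact: L3_meas|exact: L3_meas|rewrite ler1n].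
Qed.

Lemma L3B f g : L3 f -> L3 g -> L3 (fun x => f x - g x).
Proof. by move=> Lf Lg; apply: L3D => //; exact: L3N. Qed.

Lemma N3B f g : L3 f -> L3 g -> N3 (fun x => f x - g x) <= N3 f + N3 g.
Proof.
by move=> Lf Lg; rewrite -(N3N g); apply: N3D => //; exact: L3N.
Qed.

Lemma L3Z c f : L3 f -> L3 (fun x => c * f x).
Proof.
move=> [mf fi]; split; first exact: measurable_funM.
have /funext -> : (fun x => `|c * f x| ^+ 3) =1 (fun x => `|c| ^+ 3 * `|f x| ^+ 3).
  by move=> x; rewrite normrM exprMn.
exact: igZ.
Qed.

Lemma N3Z c f : L3 f -> N3 (fun x => c * f x) = `|c| * N3 f.
Proof.
move=> [mf fi].
have h k : 0 <= N3 k by exact: N3_ge0.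
apply: (@pexpIrn _ 3) => //; rewrite ?nnegrE ?mulr_ge0// exprMn !N3X.
rewrite (eq_Ex (g := (fun x => `|c| ^+ 3 * `|f x| ^+ 3))); last first.
  by move=> x; rewrite normrM exprMn.
by rewrite ExZ.
Qed.

Lemma L3_cst c : L3 (fun=> c).
Proof. by split=> //; exact: ig_cst. Qed.

Lemma N3_cst c : N3 (fun=> c) = `|c|.
Proof.
apply: (@pexpIrn _ 3) => //; rewrite ?nnegrE ?N3_ge0// N3X.
by rewrite Ex_cst.
Qed.

Lemma L3_sum (I : Type) (s : seq I) (Q : pred I) (F : I -> T -> R) :
  (forall i, Q i -> L3 (F i)) -> L3 (fun x => \sum_(i <- s | Q i) F i x).
Proof.
move=> Fi; elim: s => [|i s IH].
  by under eq_fun do rewrite big_nil; exact: L3_cst.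
under eq_fun do rewrite big_cons.
by case: (boolP (Q i)) => // Qi; apply: L3D => //; exact: Fi.
Qed.

Lemma amgm3 (a b c : R) : 0 <= a -> 0 <= b -> 0 <= c ->
  3 * (a * b * c) <= a ^+ 3 + b ^+ 3 + c ^+ 3.
Proof.
move=> a0 b0 c0; rewrite -subr_ge0.
have -> : a ^+ 3 + b ^+ 3 + c ^+ 3 - 3 * (a * b * c) =
  (a + b + c) * ((a - b) ^+ 2 + (b - c) ^+ 2 + (a - c) ^+ 2) / 2.
  by field.
by rewrite !mulr_ge0// !addr_ge0// sqr_ge0.
Qed.

Lemma ig3 f g h : L3 f -> L3 g -> L3 h -> ig (fun x => f x * g x * h x).
Proof.
move=> [mf fi] [mg gi] [mh hi].
apply: (ig_le (g := fun x => `|f x| ^+ 3 + `|g x| ^+ 3 + `|h x| ^+ 3)).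
- by do 2 apply: measurable_funM => //.
- move=> x; rewrite !normrM.
  apply: le_trans (amgm3 (normr_ge0 _) (normr_ge0 _) (normr_ge0 _)).
  by rewrite ler_peMl ?ler1n// !mulr_ge0.
- by apply: igD => //; apply: igD.
Qed.

Lemma ig2 f g : L3 f -> L3 g -> ig (fun x => f x * g x).
Proof.
move=> Lf Lg; have := ig3 Lf Lg (L3_cst 1); congr ig.
by apply/funext => x; rewrite mulr1.
Qed.

Lemma ig1 f : L3 f -> ig f.
Proof.
move=> Lf; have := ig2 Lf (L3_cst 1); congr ig.
by apply/funext => x; rewrite mulr1.
Qed.

Lemma ig_sqr f : L3 f -> ig (fun x => f x ^+ 2).
Proof. by move=> Lf; apply: ig2. Qed.

(* Rescaling each factor to norm 1 + e and letting e tend to 0 makes the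
   arithmetic-geometric inequality sharp. *)
Lemma holder3 f g h : L3 f -> L3 g -> L3 h ->
  Ex (fun x => `|f x * g x * h x|) <= N3 f * N3 g * N3 h.
Proof.
move=> Lf Lg Lh.
have key e : 0 < e -> Ex (fun x => `|f x * g x * h x|) <=
    (N3 f + e) * (N3 g + e) * (N3 h + e).
  move=> e0.
  have pos k : 0 < N3 k + e by rewrite ltr_wpDl// N3_ge0.
  set a := N3 f + e; set b := N3 g + e; set c := N3 h + e.
  have a0 : 0 < a by exact: pos. have b0 : 0 < b by exact: pos.
  have c0 : 0 < c by exact: pos.
  have le1 k : N3 k ^+ 3 / (N3 k + e) ^+ 3 <= 1.
    rewrite ler_pdivrMr ?exprn_gt0// mul1r lerXn2r ?nnegrE ?N3_ge0//.
      exact: ltW.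
    by rewrite lerDl ltW.
  have -> : Ex (fun x => `|f x * g x * h x|) =
     a * b * c * Ex (fun x => `|f x / a| * `|g x / b| * `|h x / c|).
    rewrite -ExZ; last first.
      have := ig_abs (ig3 (L3Z a^-1 Lf) (L3Z b^-1 Lg) (L3Z c^-1 Lh)).
      congr ig; apply/funext => x.
      by rewrite !normrM !(mulrC `|_^-1|).
    apply: eq_Ex => x; rewrite !normrM.
    rewrite (gtr0_norm (_ : 0 < a^-1)) ?invr_gt0//.
    rewrite (gtr0_norm (_ : 0 < b^-1)) ?invr_gt0//.
    rewrite (gtr0_norm (_ : 0 < c^-1)) ?invr_gt0//.
    by field; rewrite !gt_eqF.
  apply: ler_piMr; first by rewrite ltW// !mulr_gt0.
  apply: (@le_trans _ _ (Ex (fun x => 3^-1 * ((`|f x| ^+ 3 / a ^+ 3 +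
      `|g x| ^+ 3 / b ^+ 3) + `|h x| ^+ 3 / c ^+ 3)))).
    apply: le_Ex.
    - have := ig_abs (ig3 (L3Z a^-1 Lf) (L3Z b^-1 Lg) (L3Z c^-1 Lh)).
      congr ig; apply/funext => x.
      by rewrite !normrM !(mulrC `|_^-1|).
    - apply: igZ; apply: igD; [apply: igD|]; apply: igZr;
        [exact: Lf.2|exact: Lg.2|exact: Lh.2].
    - move=> x; rewrite ler_pdivlMl//.
      apply: le_trans (amgm3 _ _ _) _ => //.
      rewrite !normrM !exprMn.
      rewrite (gtr0_norm (_ : 0 < a^-1)) ?invr_gt0//.
      rewrite (gtr0_norm (_ : 0 < b^-1)) ?invr_gt0//.
      by rewrite (gtr0_norm (_ : 0 < c^-1)) ?invr_gt0// !exprVn.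
  have [? ?] := Lf; have [? ?] := Lg; have [? ?] := Lh.
  have iab : ig (fun x => `|f x| ^+ 3 / a ^+ 3 + `|g x| ^+ 3 / b ^+ 3).
    by apply: igD; apply: igZr.
  have ic : ig (fun x => `|h x| ^+ 3 / c ^+ 3) by exact: igZr.
  rewrite ExZ; last exact: igD.
  rewrite ExD// ExD; [|exact: igZr|exact: igZr].
  rewrite !ExZr// -!N3X.
  have := le1 f; have := le1 g; have := le1 h; rewrite -/a -/b -/c.
  set u := _ / _; set v := _ / _; set w := _ / _ => *; lra.
rewrite leNgt; apply/negP => lt.
pose p (e : R) := (N3 f + e) * (N3 g + e) * (N3 h + e).
have cp : p e @[e --> (0 : R)] --> p 0.
  by apply: cvgM; [apply: cvgM|]; apply: cvgD; by [exact: cvg_cst|exact: cvg_id].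
have p0 : p 0 < Ex (fun x => `|f x * g x * h x|) by rewrite /p !addr0.
have : \forall e \near 0^'+, p e < Ex (fun x => `|f x * g x * h x|).
  apply: (cvgr_lt (p 0)) => //.
  exact: cvg_at_right_filter.
have : \forall e \near 0^'+, (0 : R) < e by exact: nbhs_right_gt.
move=> H1 H2.
have [e [e0 /lt_geF]] := filter_ex (filterI H1 H2).
by rewrite key.
Qed.

Lemma Ex3_le f g h : L3 f -> L3 g -> L3 h ->
  `|Ex (fun x => f x * g x * h x)| <= N3 f * N3 g * N3 h.
Proof.
move=> Lf Lg Lh; apply: le_trans (holder3 Lf Lg Lh).
by apply: ler_abs_Ex; exact: ig3.
Qed.

Lemma Ex2_le f g : L3 f -> L3 g -> `|Ex (fun x => f x * g x)| <= N3 f * N3 g.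
Proof.
move=> Lf Lg; have := Ex3_le Lf Lg (L3_cst 1).
rewrite N3_cst normr1 mulr1; congr (`|_| <= _).
by apply: eq_Ex => x; rewrite mulr1.
Qed.

Lemma Ex_abs_N3 f : L3 f -> Ex (fun x => `|f x|) <= N3 f.
Proof.
move=> Lf; have := holder3 Lf (L3_cst 1) (L3_cst 1).
rewrite N3_cst normr1 !mulr1; congr (_ <= _).
by apply: eq_Ex => x; rewrite !mulr1.
Qed.

Lemma Ex1_le f : L3 f -> `|Ex f| <= N3 f.
Proof.
by move=> Lf; apply: le_trans (Ex_abs_N3 Lf); apply/ler_abs_Ex/ig1.
Qed.

End Expectation.

Arguments eq_Ex {d T R P f g} _.
Arguments eq_N3 {d T R P f g} _.

(** * Conditional expectations *)

Section DominatedConvergence.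
Context (d : measure_display) (T : measurableType d) (R : realType).
Variable P : probability T R.

Lemma Ex_dominated (f_ : nat -> T -> R) (f g : T -> R) :
  (forall n, measurable_fun setT (f_ n)) -> measurable_fun setT f ->
  (forall x, f_ n x @[n --> \oo] --> f x) -> ig P g ->
  (forall n x, `|f_ n x| <= g x) ->
  ig P f /\ Ex P (f_ n) @[n --> \oo] --> Ex P f.
Proof.
move=> mf_ mf ff gi fg.
have [] := @dominated_convergence _ _ _ P setT measurableT
  (fun n => EFin \o f_ n) (EFin \o f) (EFin \o g).
- by move=> n; exact/measurable_EFinP.
- exact/measurable_EFinP.
- by apply: aeW => x _; apply: cvg_EFin; [exact: nearW|exact: ff].
- exact: gi.
- by apply: aeW => x n _; rewrite /= lee_fin.
- move=> fi _ cf; split=> //.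
  by rewrite Ex.unlock /Rintegral; apply: fine_cvg;
    rewrite fineK//; exact: integrable_fin_num.
Qed.

End DominatedConvergence.

Section SubSigmaAlgebra.
Context (d : measure_display) (T : measurableType d) (R : realType).
Variable P : probability T R.
Variable G : set (set T).
Hypothesis sG : sigma_algebra setT G.
Hypothesis GT : G `<=` measurable.
Import HBNNSimple.
Implicit Types (Y Z V : T -> R).

Local Notation Ex := (Ex P).
Local Notation ig := (ig P).

Definition Gm Z := forall B, measurable B -> G (Z @^-1` B).

(* [E (Y | G) = 0], stated without choosing a conditional expectation. *)
Definition orth Y := ig Y /\ forall A, G A -> Ex (fun x => Y x * \1_A x) = 0.

Let TG : measurableType G.-sigma := g_sigma_algebraType G.

Let GE : <<s G >> = G.
Proof. exact: sigma_algebra_id. Qed.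

Lemma GmP Z : Gm Z <-> measurable_fun [set: TG] (Z : TG -> R).
Proof.
split=> [Gz _ B mB|mZ B mB].
  by rewrite setTI; have := Gz _ mB; rewrite -[in X in X -> _]GE.
by have := mZ measurableT _ mB; rewrite setTI /measurable/= GE.
Qed.

Lemma Gm_meas Z : Gm Z -> measurable_fun setT Z.
Proof. by move=> Gz _ B mB; rewrite setTI; apply/GT/Gz. Qed.

Lemma Gm_comp (phi : R -> R) Z : measurable_fun setT phi -> Gm Z ->
  Gm (fun x => phi (Z x)).
Proof. by move=> mp /GmP mZ; apply/GmP; exact: measurableT_comp mp mZ. Qed.

Lemma GmD Y Z : Gm Y -> Gm Z -> Gm (fun x => Y x + Z x).
Proof. by move=> /GmP ? /GmP ?; apply/GmP; exact: measurable_funD. Qed.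

Lemma GmB Y Z : Gm Y -> Gm Z -> Gm (fun x => Y x - Z x).
Proof. by move=> /GmP ? /GmP ?; apply/GmP; exact: measurable_funB. Qed.

Lemma GmM Y Z : Gm Y -> Gm Z -> Gm (fun x => Y x * Z x).
Proof. by move=> /GmP ? /GmP ?; apply/GmP; exact: measurable_funM. Qed.

Lemma Gm_cst c : Gm (fun=> c).
Proof. by apply/GmP; exact: measurable_cst. Qed.

Lemma Gm_indic (A : set T) : G A -> Gm \1_A.
Proof.
by move=> GA; apply/GmP/measurable_indic; rewrite /measurable/= GE.
Qed.

Lemma Gm_sum (I : Type) (s : seq I) (F : I -> T -> R) :
  (forall i, Gm (F i)) -> Gm (fun x => \sum_(i <- s) F i x).
Proof.
move=> GF; elim: s => [|i s IH].
  by under eq_fun do rewrite big_nil; exact: Gm_cst.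
by under eq_fun do rewrite big_cons; exact: GmD.
Qed.

Lemma ig_indic Y A : measurable A -> ig Y -> ig (fun x => Y x * \1_A x).
Proof.
move=> mA Yi; apply: (ig_le (g := fun x => `|Y x|)) (ig_abs Yi).
  by apply: measurable_funM; [exact: ig_meas Yi|exact: measurable_indic].
move=> x; rewrite normrM indicE; case: (_ \in _); rewrite ?normr1 ?mulr1//.
by rewrite normr0 mulr0.
Qed.

(** The defining identity extends by linearity from indicators of [G] to the simple functions below
    [Z]; these converge pointwise to [Z], and [|Y * Z|] dominates the products. *)
Let orthM_ge0 Y Z : orth Y -> Gm Z -> (forall x, 0 <= Z x) ->
  ig (fun x => Y x * Z x) -> Ex (fun x => Y x * Z x) = 0.
Proof.
move=> [Yi Y0] GZ Z0 YZi.
have mY := ig_meas Yi.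
have mZ : measurable_fun [set: TG] (EFin \o (Z : TG -> R)).
  by apply/measurable_EFinP/GmP.
pose g (n : nat) (x : T) : R := nnsfun_approx measurableT mZ n x.
have gcvg (x : T) : g n x @[n --> \oo] --> Z x.
  have Z0' (t : TG) : [set: TG] t -> (0 <= (EFin \o (Z : TG -> R)) t)%E.
    by move=> _; rewrite lee_fin.
  have := @cvg_nnsfun_approx _ _ _ _ measurableT _ mZ Z0' x I.
  by move=> /fine_cvg.
have gle n (x : T) : g n x <= Z x.
  have nd : nondecreasing_seq (g ^~ x).
    by move=> m k mk; have /lefP := nd_nnsfun_approx measurableT mZ mk; apply.
  have := nondecreasing_cvgn_le nd (cvgP _ (gcvg x)) n.
  by rewrite (cvg_lim _ (gcvg x)).
have gG n : Gm (g n).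
  by apply/GmP; exact: (measurable_funP (nnsfun_approx measurableT mZ n)).
have Yg0 n : Ex (fun x => Y x * g n x) = 0.
  have gE (x : T) : g n x = \sum_(y <- finmap.enum_fset (fset_set (range (g n))))
      y * \1_(g n @^-1` [set y]) x.
    by rewrite [LHS](fimfunE (nnsfun_approx measurableT mZ n)) fsbig_finite.
  rewrite (eq_Ex (g := fun x => \sum_(y <- finmap.enum_fset (fset_set (range (g n))))
     y * (Y x * \1_(g n @^-1` [set y]) x))); last first.
    move=> x; rewrite gE mulr_sumr; apply: eq_bigr => y _; by rewrite mulrCA.
  have Gy y : G (g n @^-1` [set y]) by exact: gG.
  rewrite Ex_sum => [|y _]; last by apply: igZ; apply: ig_indic => //; exact: GT.
  rewrite big1// => y _; rewrite ExZ ?Y0 ?mulr0//.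
  by apply: ig_indic => //; exact: GT.
have dom n x : `|Y x * g n x| <= `|Y x * Z x|.
  by rewrite !normrM ler_wpM2l// !ger0_norm.
have [_] := Ex_dominated (fun n => measurable_funM mY (Gm_meas (gG n)))
  (ig_meas YZi) (fun x => cvgM (cvg_cst _) (gcvg x)) (ig_abs YZi) dom.
rewrite (_ : (fun n => _) = cst 0); last by apply/funext => n; exact: Yg0.
by move=> /(cvg_lim (@Rhausdorff R)) <-; exact: (lim_cst (@Rhausdorff R)).
Qed.

Lemma orthM Y Z : orth Y -> Gm Z -> ig (fun x => Y x * Z x) ->
  Ex (fun x => Y x * Z x) = 0.
Proof.
move=> oY GZ YZi.
pose Zp x := Num.max (Z x) 0; pose Zn x := Num.max (- Z x) 0.
have GZp : Gm Zp.
  by apply: (Gm_comp (phi := fun z => Num.max z 0)) GZ; exact: measurable_maxr.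
have GZn : Gm Zn.
  apply: (Gm_comp (phi := fun z => Num.max (- z) 0)) GZ.
  by apply: measurable_maxr => //; exact: measurableT_comp.
have mY := ig_meas oY.1.
have Zpi : ig (fun x => Y x * Zp x).
  apply: ig_le (ig_abs YZi); first exact/measurable_funM/Gm_meas.
  move=> x; rewrite !normrM ler_wpM2l// /Zp.
  by case: (leP (Z x) 0) => _; rewrite ?normr0.
have Zni : ig (fun x => Y x * Zn x).
  apply: ig_le (ig_abs YZi); first exact/measurable_funM/Gm_meas.
  move=> x; rewrite !normrM ler_wpM2l// /Zn.
  by case: (leP (- Z x) 0) => _; rewrite ?normr0// normrN.
rewrite (eq_Ex (g := fun x => Y x * Zp x - Y x * Zn x)); last first.
  move=> x; rewrite -mulrBr; congr (_ * _); rewrite /Zp /Zn.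
  by case: (leP (Z x) 0); case: (leP (- Z x) 0) => *; lra.
rewrite ExB// !orthM_ge0 ?subr0// => x; by rewrite le_max lexx orbT.
Qed.

Lemma orth0 : orth (fun=> 0).
Proof.
split=> [|A GA]; first exact: ig_cst.
by rewrite (eq_Ex (g := fun=> 0)) ?Ex_cst// => x; rewrite mul0r.
Qed.

Lemma orthD Y Z : orth Y -> orth Z -> orth (fun x => Y x + Z x).
Proof.
move=> [Yi Y0] [Zi Z0]; split=> [|A GA]; first exact: igD.
have mA := GT GA.
rewrite (eq_Ex (g := fun x => Y x * \1_A x + Z x * \1_A x)).
  by rewrite ExD ?Y0 ?Z0 ?addr0//; exact: ig_indic.
by move=> x; rewrite mulrDl.
Qed.

Lemma orthN Y : orth Y -> orth (fun x => - Y x).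
Proof.
move=> [Yi Y0]; split=> [|A GA]; first exact: igN.
have mA := GT GA.
rewrite (eq_Ex (g := fun x => - (Y x * \1_A x))).
  by rewrite ExN ?Y0 ?oppr0//; exact: ig_indic.
by move=> x; rewrite mulNr.
Qed.

Lemma orthB Y Z : orth Y -> orth Z -> orth (fun x => Y x - Z x).
Proof. by move=> oY oZ; apply: orthD => //; exact: orthN. Qed.

Lemma orth_sum (I : Type) (s : seq I) (F : I -> T -> R) :
  (forall i, orth (F i)) -> orth (fun x => \sum_(i <- s) F i x).
Proof.
move=> oF; elim: s => [|i s IH].
  by under eq_fun do rewrite big_nil; exact: orth0.
by under eq_fun do rewrite big_cons; exact: orthD.
Qed.

Lemma Ex_indic_le Y A : measurable A -> ig Y ->
  `|Ex (fun x => Y x * \1_A x)| <= Ex (fun x => `|Y x|).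
Proof.
move=> mA Yi; apply: Ex_abs_le; [exact: ig_indic|exact: ig_abs|move=> x].
rewrite normrM indicE; case: (_ \in _); rewrite ?normr1 ?mulr1//.
by rewrite normr0 mulr0.
Qed.

Lemma orth_lim (V_ : nat -> T -> R) V : (forall n, orth (V_ n)) -> ig V ->
  (forall e, 0 < e -> exists n, Ex (fun x => `|V_ n x - V x|) <= e) -> orth V.
Proof.
move=> oV Vi lV; split=> // A GA.
have mA := GT GA.
apply/eqP; rewrite -normr_eq0 eq_le normr_ge0 andbT.
apply/ler_addgt0Pl => e e0; rewrite addr0.
have [n Hn] := lV _ e0.
have [Vni Vn0] := oV n.
have -> : Ex (fun x => V x * \1_A x) = - Ex (fun x => (V_ n x - V x) * \1_A x).
  rewrite (eq_Ex (f := fun x => (V_ n x - V x) * \1_A x)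
    (g := fun x => V_ n x * \1_A x - V x * \1_A x)); last first.
    by move=> x; rewrite mulrBl.
  by rewrite ExB; [rewrite Vn0// sub0r opprK|exact: ig_indic|exact: ig_indic].
rewrite normrN; apply: le_trans Hn.
by apply: Ex_indic_le => //; exact: igB.
Qed.

Lemma Ex_setE (A : set T) Y : measurable A ->
  (\int[P]_(w in A) (Y w)%:E)%E = (\int[P]_w (Y w * \1_A w)%:E)%E.
Proof.
move=> mA; rewrite integral_mkcond; apply: eq_integral => w _.
rewrite patchE indicE; case: ifPn => _; rewrite ?mulr1//.
by rewrite mulr0.
Qed.

Lemma condexp_spec Y : ig Y ->
  [/\ Gm (condexp P G Y), ig (condexp P G Y) &
      orth (fun w => Y w - condexp P G Y w)].
Proof.
move=> Yi; have [h1 h2 h3] := condexpP sG GT Yi.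
have h2' : ig (condexp P G Y) by exact: h2.
split=> //; split=> [|A GA]; first exact: igB.
have mA := GT GA.
rewrite (eq_Ex (g := fun x => Y x * \1_A x - condexp P G Y x * \1_A x)).
  have YA : ig (fun x => Y x * \1_A x) by exact: ig_indic.
  have CA : ig (fun x => condexp P G Y x * \1_A x) by exact: ig_indic.
  rewrite ExB//; apply/eqP; rewrite subr_eq0; apply/eqP.
  by apply/EFin_inj; rewrite -!ge0_ExE// -!Ex_setE// h3.
by move=> x; rewrite mulrBl.
Qed.

Lemma Ex_abs_eq0 Y : ig Y -> Ex (fun x => `|Y x|) = 0 ->
  {ae P, forall x, Y x = 0}.
Proof.
move=> Yi Y0.
have H : (\int[P]_x `|(EFin \o Y) x| = 0)%E.
  by have := ge0_ExE (ig_abs Yi); rewrite Y0.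
have [+ _] := ae_eq_integral_abs P measurableT (measurable_int _ Yi).
by move=> /(_ H); apply: filterS => x /(_ I)[].
Qed.

(* The limit and its conditional expectation are both L1-limits of the
   sequence, by L1-contraction. *)
Lemma Gm_lim (V_ : nat -> T -> R) V :
  (forall n, Gm (V_ n)) -> (forall n, ig (V_ n)) -> ig V ->
  (forall e, 0 < e -> exists n, Ex (fun x => `|V_ n x - V x|) <= e) ->
  exists V', [/\ Gm V', ig V' & {ae P, forall x, V x = V' x}].
Proof.
move=> GV iV_ iV lV.
have [GW iW oW] := condexp_spec iV.
set W := condexp P G V in GW iW oW.
exists W; split => //.
have key n : Ex (fun x => `|V_ n x - W x|) <= Ex (fun x => `|V_ n x - V x|).
  (* [s] is the sign of [V_ n - W], which is [G]-measurable. Hence E |V_n - W| = E ((V_n - W) s) = E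
     ((V_n - V) s), since [V - W] is orthogonal to [G]. *)
  pose s x := 2 * \1_((fun x => V_ n x - W x) @^-1` `[0, +oo[) x - 1 : R.
  have Gs : Gm s.
    apply: GmB; last exact: Gm_cst.
    apply: GmM; first exact: Gm_cst.
    by apply: Gm_indic; apply: GmB.
  have s1 x : `|s x| <= 1.
    rewrite /s indicE; case: (_ \in _); rewrite ?mulr1 ?mulr0 ler_norml; lra.
  have is_ Y : ig Y -> ig (fun x => Y x * s x).
    move=> iY; apply: ig_le (ig_abs iY).
      by apply: measurable_funM; [exact: ig_meas iY|exact: Gm_meas].
    by move=> x; rewrite normrM ler_piMr.
  rewrite (eq_Ex (g := fun x => (V_ n x - V x) * s x + (V x - W x) * s x));
      last first.
    move=> x; rewrite -mulrDl subrKA /s indicE.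
    case: (boolP (x \in _)); rewrite ?inE ?notin_setE/= in_itv/= andbT.
      by move=> h; rewrite ger0_norm//; ring.
    by move=> /negP; rewrite -ltNge => h; rewrite ltr0_norm//; ring.
  have iVV : ig (fun x => V_ n x - V x) by exact: igB.
  have iVW : ig (fun x => V x - W x) by exact: igB.
  rewrite ExD; [|exact: is_|exact: is_].
  rewrite (orthM oW)// ?addr0; last exact: is_.
  apply: le_trans (ler_norm _) _; apply: Ex_abs_le; [exact: is_|exact: ig_abs|].
  by move=> x; rewrite normrM ler_piMr.
have : {ae P, forall x, V x - W x = 0}.
  apply: Ex_abs_eq0; first exact: igB.
  apply/eqP; rewrite eq_le Ex_ge0 ?andbT; last by move=> x.
  apply/ler_addgt0Pl => e e0; rewrite addr0.
  have [n Hn] := lV _ (divr_gt0 e0 (ltr0n _ 2)).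
  apply: (@le_trans _ _ (Ex (fun x => `|V_ n x - V x| + `|V_ n x - W x|))).
    apply: le_Ex; [|apply: igD|]; try by apply/ig_abs/igB.
    move=> x; rewrite (distrC (V_ n x) (V x)).
    by rewrite (le_trans _ (ler_normD _ _))// subrKA.
  rewrite ExD; try by apply/ig_abs/igB.
  have := key n; lra.
by apply: filterS => x /eqP; rewrite subr_eq0 => /eqP.
Qed.

End SubSigmaAlgebra.
Section ConditionalExpectationL3.
Context (d : measure_display) (T : measurableType d) (R : realType).
Variable P : probability T R.
Variable G : set (set T).
Hypothesis sG : sigma_algebra setT G.
Hypothesis GT : G `<=` measurable.

(* Truncating the conditional expectation [C] to [Z = C 1_(|C| <= K)] and testing
   against [Z |Z|] gives ||Z||^3 <= ||Y|| ||Z||^2, whatever [K]. *)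
Lemma condexp_L3 (Y : T -> R) : L3 P Y -> L3 P (condexp P G Y).
Proof.
move=> LY; have [GC iC oC] := condexp_spec sG GT (ig1 LY).
set C := condexp P G Y in GC iC oC *.
have mC := ig_meas iC.
pose I K : T -> R := \1_((fun w => `|C w|) @^-1` `]-oo, K%:R]).
have GI K : Gm G (I K).
  apply: (Gm_indic sG); apply: (Gm_comp sG (phi := Num.Def.normr)) GC _ _ => //.
have IE K w : I K w = (`|C w| <= K%:R)%R%:R.
  by rewrite /I indicE; congr (nat_of_bool _)%:R; apply/idP/idP; rewrite inE/= in_itv.
pose Z K w : R := C w * I K w.
have mZ K : measurable_fun setT (Z K).
  by apply: measurable_funM => //; exact: (Gm_meas GT (GI K)).
have ZK K w : `|Z K w| <= K%:R.
  rewrite /Z IE; case: (boolP (`|C w| <= K%:R)) => h.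
    by rewrite mulr1.
  by rewrite mulr0 normr0.
have LZ K : L3 P (Z K).
  apply: (proj1 (@L3_le _ _ _ _ _ (fun=> K%:R) _ _ (L3_cst P K%:R))) => // w.
  by rewrite [leRHS]ger0_norm.
have GZ K : Gm G (Z K) by exact: (GmM sG).
have key K : N3 P (Z K) <= N3 P Y.
  have [->|Z0] := eqVneq (N3 P (Z K)) 0; first exact: N3_ge0.
  have {}Z0 : 0 < N3 P (Z K) by rewrite lt_neqAle eq_sym Z0 N3_ge0.
  have LaZ := L3_abs (LZ K).
  have iCZ : ig P (fun w => C w * (Z K w * `|Z K w|)).
    apply: (ig_le (g := fun w => K%:R ^+ 2 * `|C w|)); last exact/igZ/ig_abs.
      by do 2 (apply: measurable_funM => //); exact: measurableT_comp.
    move=> w; rewrite normrM mulrC ler_wpM2r// normrM normr_id expr2.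
    by rewrite ler_pM.
  have iYZ : ig P (fun w => Y w * (Z K w * `|Z K w|)).
    by have := ig3 LY (LZ K) LaZ; congr ig; apply/funext => w; rewrite mulrA.
  have : N3 P (Z K) ^+ 3 <= N3 P Y * N3 P (Z K) * N3 P (Z K).
    rewrite N3X -[X in _ * X](N3_abs P (Z K)).
    rewrite (eq_Ex (g := fun w => C w * (Z K w * `|Z K w|))); last first.
      move=> w; rewrite /Z IE; case: (`|C w| <= K%:R)%R => /=; last first.
        by rewrite !(mulr0, normr0, expr0n).
      by rewrite mulr1 mulrA -expr2 -real_normK ?num_real// -exprSr.
    have -> : Ex P (fun w => C w * (Z K w * `|Z K w|)) =
       Ex P (fun w => Y w * Z K w * `|Z K w|).
      rewrite [RHS](eq_Ex (g := fun w => Y w * (Z K w * `|Z K w|))).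
        apply/eqP; rewrite -subr_eq0 -oppr_eq0 opprB; apply/eqP.
        rewrite -ExB// (eq_Ex (g := fun w => (Y w - C w) * (Z K w * `|Z K w|))).
          apply: (orthM sG GT oC).
            by apply: (GmM sG) => //; exact: (Gm_comp sG (phi := Num.Def.normr)).
          have := igB iYZ iCZ; congr ig; apply/funext => w; by rewrite mulrBl.
        by move=> w; rewrite mulrBl.
      by move=> w; rewrite mulrA.
    by apply: le_trans (ler_norm _) _; exact: Ex3_le.
  by rewrite -mulrA -expr2 exprS ler_pM2r// exprn_gt0.
split=> //; apply/integrableP; split.
  by apply/measurable_EFinP/measurable_funX/measurableT_comp.
(* The bound [key] is uniform in [K] and the truncated cubes increase to [|C| ^+ 3], so monotone
   convergence gives integrability. *)
have cvgZ w : (`|Z K w| ^+ 3)%:E @[K --> \oo] --> (`|C w| ^+ 3)%:E.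
  apply: cvg_near_cst; near=> K; congr (EFin (`|_| ^+ 3)).
  rewrite /Z IE; suff -> : `|C w| <= K%:R by rewrite mulr1.
  by near: K; exact: nbhs_infty_ger.
have mon w m n : (m <= n)%N -> ((`|Z m w| ^+ 3)%:E <= (`|Z n w| ^+ 3)%:E)%E.
  move=> mn; rewrite lee_fin lerXn2r ?nnegrE// /Z !normrM ler_wpM2l// !IE.
  case: (boolP (`|C w| <= m%:R)) => h; last by rewrite normr0.
  by rewrite (le_trans h) ?ler_nat.
have := @monotone_convergence _ _ _ P setT measurableT
  (fun K w => (`|Z K w| ^+ 3)%:E) _ _ _.
have -> : (\int[P]_x `|(EFin \o (fun x => `|C x| ^+ 3)%R) x| =
    \int[P]_x limn (fun K => (`|Z K x| ^+ 3)%:E))%E.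
  apply: eq_integral => w _; rewrite /= ger0_norm ?exprn_ge0//.
  by apply/esym/cvg_lim => //; exact: cvgZ.
move=> ->; last 3 first.
- by move=> K; apply/measurable_EFinP/measurable_funX/measurableT_comp.
- by move=> K w _; rewrite lee_fin exprn_ge0.
- by move=> w _ m n; exact: mon.
apply: (@le_lt_trans _ _ (N3 P Y ^+ 3)%:E); last exact: ltry.
apply: lime_le.
  apply: ereal_nondecreasing_is_cvgn => m n mn; apply: ge0_le_integral => //.
  - by apply/measurable_EFinP/measurable_funX/measurableT_comp.
  - by apply/measurable_EFinP/measurable_funX/measurableT_comp.
  - by move=> w _; exact: mon.
apply: nearW => K; rewrite ge0_ExE; last by case: (LZ K).
by rewrite lee_fin -N3X lerXn2r ?nnegrE ?N3_ge0.
Unshelve. all: by end_near. Qed.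

End ConditionalExpectationL3.

(** * Measure-preserving maps and the shifted filtration *)

Section MeasurePreserving.
Context (d : measure_display) (T : measurableType d) (R : realType).
Variable P : probability T R.
Variable phi : T -> T.
Hypothesis mphi : measurable_fun setT phi.
Hypothesis phiP : forall A, measurable A -> P (phi @^-1` A) = P A.

Let ge0_integral_comp (f : T -> \bar R) : measurable_fun setT f ->
  (forall x, 0 <= f x)%E -> (\int[P]_x f (phi x) = \int[P]_x f x)%E.
Proof.
move=> mf f0.
rewrite -[LHS](@ge0_integral_pushforward _ _ _ _ _ phi mphi P setT f)//.
by apply: eq_measure_integral => A mA _; exact: phiP.
Qed.

Let integral_comp (f : T -> \bar R) : measurable_fun setT f ->
  (\int[P]_x f (phi x) = \int[P]_x f x)%E.
Proof.
move=> mf; rewrite integralE [RHS]integralE; congr (_ - _)%E.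
  rewrite -(ge0_integral_comp (measurable_funepos mf)) => [|x]; last exact: funepos_ge0.
  by apply: eq_integral => x _; rewrite !funeposE.
rewrite -(ge0_integral_comp (measurable_funeneg mf)) => [|x]; last exact: funeneg_ge0.
  by apply: eq_integral => x _; rewrite !funenegE.
Qed.

Lemma Ex_comp (f : T -> R) : measurable_fun setT f ->
  Ex P (fun x => f (phi x)) = Ex P f.
Proof.
move=> mf; rewrite Ex.unlock /Rintegral; congr fine.
by apply: (integral_comp (f := EFin \o f)); exact/measurable_EFinP.
Qed.

Lemma ig_comp (f : T -> R) : ig P f -> ig P (fun x => f (phi x)).
Proof.
move=> fi; have mf := ig_meas fi; apply/integrableP; split.
  by apply/measurable_EFinP; exact: measurableT_comp.
case/integrableP : fi => _.
rewrite -(ge0_integral_comp (f := fun x => `|(EFin \o f) x|%E))//.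
by apply: measurableT_comp => //; exact/measurable_EFinP.
Qed.

Lemma L3_comp (f : T -> R) : L3 P f -> L3 P (fun x => f (phi x)).
Proof.
by move=> [mf fi]; split; [exact: measurableT_comp|exact: (ig_comp fi)].
Qed.

Lemma N3_comp (f : T -> R) : measurable_fun setT f ->
  N3 P (fun x => f (phi x)) = N3 P f.
Proof.
move=> mf; rewrite N3.unlock; congr (_ `^ _).
apply: (Ex_comp (f := fun x => `|f x| ^+ 3)).
by apply: measurable_funX; exact: measurableT_comp.
Qed.

Lemma orth_comp (G : set (set T)) (Y : T -> R) : G `<=` measurable ->
  orth P G Y ->
  orth P (preimage_set_system setT phi G) (fun x => Y (phi x)).
Proof.
move=> GT [iY oY]; split; first exact: ig_comp.
move=> _ [A GA <-]; rewrite setTI.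
rewrite (eq_Ex (g := fun x => (fun y => Y y * \1_A y) (phi x))).
  rewrite (Ex_comp (f := fun y => Y y * \1_A y)) ?oY//; apply: measurable_funM;
    first exact: ig_meas iY.
  exact/measurable_indic/GT.
by move=> x /=; rewrite !indicE; congr (_ * (nat_of_bool _)%:R);
  apply/idP/idP; rewrite !inE.
Qed.

Lemma Gm_comp_preimage (G : set (set T)) (Y : T -> R) :
  Gm G Y -> Gm (preimage_set_system setT phi G) (fun x => Y (phi x)).
Proof. by move=> GY B mB; exists (Y @^-1` B); [exact: GY|rewrite setTI]. Qed.

Lemma ae_comp (Q : T -> Prop) : {ae P, forall x, Q x} ->
  {ae P, forall x, Q (phi x)}.
Proof.
move=> [A [mA A0 QA]]; exists (phi @^-1` A); split.
- by rewrite -[_ @^-1` _]setTI; exact: mphi.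
- by rewrite phiP.
- by move=> x /= nQ; exact: QA.
Qed.

End MeasurePreserving.

Section Filtration.
Context (d : measure_display) (T : measurableType d) (R : realType).
Variable P : probability T R.
Variables tau tauV : {mfun T >-> T}.
Hypothesis tauK : cancel tau tauV.
Hypothesis tauVK : cancel tauV tau.
Hypothesis tauP : forall A, measurable A -> P (tau @^-1` A) = P A.
Variable F0 : set (set T).
Hypothesis F0_sigma : sigma_algebra setT F0.
Hypothesis F0_measurable : F0 `<=` measurable.
Hypothesis F0_incl : F0 `<=` preimage_set_system setT tau F0.

Lemma iter_meas (f : {mfun T >-> T}) k : measurable_fun setT (iter k f).
Proof.
elim: k => [|k IH]; first exact: measurable_id.
exact: measurableT_comp (measurable_funP f) IH.
Qed.

Lemma iterK k : cancel (iter k tau) (iter k tauV).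
Proof. by elim: k => // k IH w; rewrite iterSr/= tauK IH. Qed.

Lemma iterVK k : cancel (iter k tauV) (iter k tau).
Proof. by elim: k => // k IH w; rewrite iterSr/= tauVK IH. Qed.

Lemma iter_P k A : measurable A -> P (iter k tau @^-1` A) = P A.
Proof.
elim: k A => // k IH A mA; rewrite -[RHS](tauP mA) -[RHS]IH//.
by rewrite -[_ @^-1` _]setTI; exact: (measurable_funP tau).
Qed.

Lemma iterV_P k A : measurable A -> P (iter k tauV @^-1` A) = P A.
Proof.
move=> mA; rewrite -(iter_P k).
  congr (P _); apply/seteqP; split=> w /=; first by rewrite iterK.
  by rewrite iterK.
by rewrite -[_ @^-1` _]setTI; exact: (iter_meas tauV k).
Qed.

Definition filt k := preimage_set_system setT (iter k tau) F0.

Lemma filt_sigma k : sigma_algebra setT (filt k).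
Proof. exact: sigma_algebra_preimage. Qed.

Lemma filt_measurable k : filt k `<=` measurable.
Proof.
by move=> _ [A FA <-]; apply: (iter_meas tau k) => //; exact: F0_measurable.
Qed.

Lemma filtS k : filt k `<=` filt k.+1.
Proof.
move=> _ [A /F0_incl[B FB <-] <-]; exists B => //.
by rewrite !setTI.
Qed.

Lemma filt0 : filt 0 = F0.
Proof.
apply/seteqP; split=> [_ [A FA <-]|A FA]; first by rewrite setTI.
by exists A; rewrite ?setTI.
Qed.

(** Shifting back by k steps carries a test function known at time [k] to one known at time 0; this
    is how a bound given for [F0] serves blocks starting at any [k]. *)
Lemma Gm_filtV k (Z : T -> R) : Gm (filt k) Z -> Gm F0 (fun w => Z (iter k tauV w)).
Proof.
move=> GZ B mB; have [A FA] := GZ B mB.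
rewrite setTI => /seteqP AE.
suff -> : (fun w => Z (iter k tauV w)) @^-1` B = A by [].
apply/seteqP; split=> w.
  by move=> /= ZB; have /= := AE.2 (iter k tauV w) ZB; rewrite iterVK.
by move=> Aw; apply: (AE.1 (iter k tauV w)); rewrite /= iterVK.
Qed.

Lemma preimage_filt k m :
  preimage_set_system setT (iter k tau) (filt m) = filt (k + m).
Proof.
have E (A : set T) : iter (k + m) tau @^-1` A = iter k tau @^-1` (iter m tau @^-1` A).
  by apply/seteqP; split=> w; rewrite /= addnC iterD.
apply/seteqP; split=> [_ [_ [A FA <-] <-]|_ [A FA <-]].
  by exists A; rewrite ?setTI ?E.
exists (iter m tau @^-1` A); last by rewrite !setTI E.
by exists A; rewrite ?setTI.
Qed.

End Filtration.
(** * Gaussian smoothing *)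

Section NormalIntegrals.
Context (R : realType).
Implicit Types (m s t x y : R) (h f : R -> R).
Local Notation leb := (@lebesgue_measure R).
Import HBNNSimple.

(** [normal_prob] is given by its values on sets. Its density formula passes from level sets to
    simple functions here, and to all nonnegative functions by monotone convergence afterwards. *)
Let density_nnsfun m s (g : {nnsfun (measurableTypeR R) >-> R}) :
  (\int[normal_prob m s]_x (g x)%:E =
   \int[leb]_x ((g x)%:E * (normal_pdf m s x)%:E))%E.
Proof.
have mn : measurable_fun setT (normal_pdf m s) := measurable_normal_pdf m s.
have n0 x : (0 <= (normal_pdf m s x)%:E)%E.
  by rewrite lee_fin normal_pdf_ge0.
under [LHS]eq_integral do rewrite fimfunE -fsumEFin//.
rewrite [LHS]ge0_integral_fsum//; last 2 first.
  - by move=> r; exact/measurable_EFinP/measurableT_comp.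
  - by move=> n x _; rewrite EFinM nnfun_muleindic_ge0.
under [RHS]eq_integral.
  move=> x xD; rewrite fimfunE -fsumEFin// muleC ge0_mule_fsumr; last first.
    by move=> r; rewrite EFinM nnfun_muleindic_ge0.
  over.
rewrite [RHS]ge0_integral_fsum//; last 2 first.
  - move=> r; apply/measurable_EFinP/measurable_funM => //.
    exact/measurable_funM/measurable_indic.
  - by move=> n x _; rewrite mule_ge0// EFinM nnfun_muleindic_ge0.
apply: eq_fsbigr => r _.
(* The simple function is nonnegative, so a negative value has an empty level set and both sides
   vanish. *)
have [r0|r0] := ltP r 0.
  have g0 : g @^-1` [set r] = set0.
    apply/seteqP; split => // x /= gx.
    by have : 0 <= g x by []; rewrite gx leNgt r0.
  rewrite g0 indic0 (eq_integral (cst 0%E)) ?integral0; last first.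
    by move=> x _; rewrite mulr0.
  by rewrite (eq_integral (cst 0%E)) ?integral0// => x _; rewrite mulr0 mule0.
rewrite (@integralZl_indic_nnsfun _ _ _ (normal_prob m s) _ measurableT)//.
rewrite integral_indic//= setIT.
have mi : measurable_fun setT (fun x => normal_pdf m s x * \1_(g @^-1` [set r]) x).
  apply: measurable_funM => //; apply: measurable_indic.
  exact: (measurable_sfunP g).
transitivity (\int[leb]_x
    (r%:E * (normal_pdf m s x * \1_(g @^-1` [set r]) x)%:E))%E.
  rewrite ge0_integralZl//; last 2 first.
  - exact/measurable_EFinP.
  - by move=> x _; rewrite lee_fin mulr_ge0 ?normal_pdf_ge0.
  congr (_ * _)%E; rewrite /normal_prob [LHS]integral_mkcond.
  apply: eq_integral => x _; rewrite patchE indicE.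
  by case: ifP => _; rewrite ?mulr1// mulr0.
by apply: eq_integral => x _; rewrite -EFinM mulrCA.
Qed.

Lemma ge0_integral_normal m s (h : R -> \bar R) :
  measurable_fun setT h -> (forall x, 0 <= h x)%E ->
  (\int[normal_prob m s]_x h x =
   \int[leb]_x (h x * (normal_pdf m s x)%:E))%E.
Proof.
move=> mf f0.
have mn : measurable_fun setT (normal_pdf m s) := measurable_normal_pdf m s.
have n0 x : (0 <= (normal_pdf m s x)%:E)%E.
  by rewrite lee_fin normal_pdf_ge0.
have f0' (x : measurableTypeR R) : setT x -> (0 <= h x)%E by [].
pose f_ := nnsfun_approx (measurableT : measurable [set: measurableTypeR R]) mf.
have cf (x : measurableTypeR R) : (f_ n x)%:E @[n --> \oo] --> h x.
  exact: cvg_nnsfun_approx.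
transitivity (limn (fun n => \int[normal_prob m s]_x (f_ n x)%:E)%E).
  rewrite -monotone_convergence//=.
  - apply: eq_integral => x _; exact/esym/cvg_lim.
  - by move=> n; apply: measurableT_comp => //; exact: measurable_funTS.
  - by move=> n x _; rewrite lee_fin.
  - by move=> x _ a b ab; rewrite lee_fin//; exact/lefP/nd_nnsfun_approx.
transitivity (limn (fun n => \int[leb]_x ((f_ n x)%:E * (normal_pdf m s x)%:E))%E).
  by congr (limn _); apply/funext => n; exact: density_nnsfun.
rewrite -monotone_convergence//=.
- apply: eq_integral => x _; apply/cvg_lim => //=.
  apply: cvgeMr => //; exact: cf.
- by move=> n; apply/measurable_EFinP/measurable_funM.
- by move=> n x _; rewrite lee_fin mulr_ge0 ?normal_pdf_ge0.
- move=> x _ a b ab; rewrite lee_fin ler_wpM2r ?normal_pdf_ge0//.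
  exact/lefP/nd_nnsfun_approx.
Qed.

Lemma ge0_integral_affine (h : R -> R) s x : 0 < s -> continuous h ->
  (forall z, 0 <= h z) ->
  (\int[leb]_z (h z)%:E = \int[leb]_z (h (x + s * z) * s)%:E)%E.
Proof.
move=> s0 ch h0.
pose F z : R := x + s * z.
have dF (z : R) : is_derive z 1 F s.
  have -> : F = horner (x%:P + s *: 'X) by apply/funext => u; rewrite !hornerE.
  have := is_derive_poly (x%:P + s *: 'X) z.
  by rewrite derivD derivZ derivX derivC !hornerE.
have F'E : F^`()%classic = cst s.
  by apply/funext => z; rewrite derive1E derive_val.
rewrite (@increasing_ge0_integration_by_substitutionT _ F h)//.
- by apply: eq_integral => z _; rewrite F'E.
- by move=> a b ab; rewrite ltrD2l ltr_pM2l.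
- by rewrite F'E => z; exact: cvg_cst.
- by rewrite F'E; exact: is_cvg_cst.
- by rewrite F'E; exact: is_cvg_cst.
- exact: (cvg_comp (fun z => s * z) _ (gt0_cvgMrNy s0 cvg_id) (cvg_addrl_Ny x)).
- exact: (cvg_comp (fun z => s * z) _ (gt0_cvgMry s0 cvg_id) (cvg_addrl x)).
Qed.

Lemma normal_peakE s : 0 < s ->
  normal_peak s = (s * Num.sqrt (pi *+ 2))^-1.
Proof.
move=> s0; rewrite /normal_peak -mulrnAr sqrtrM ?sqr_ge0//.
by rewrite sqrtr_sqr gtr0_norm.
Qed.

Lemma sqrt2pi_gt0 : 0 < Num.sqrt (pi *+ 2 : R).
Proof. by rewrite sqrtr_gt0 mulrn_wgt0// pi_gt0. Qed.

Lemma normal_pdf_affine x s z : 0 < s ->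
  normal_pdf x s (x + s * z) * s = normal_pdf 0 1 z.
Proof.
move=> s0; rewrite !normal_pdfE ?gt_eqF// !normal_peakE//.
have := sqrt2pi_gt0; set w := Num.sqrt _ => w0.
have -> : normal_fun x s (x + s * z) = normal_fun 0 1 z.
  by congr expR; field; rewrite gt_eqF.
by field; rewrite !gt_eqF.
Qed.

Lemma continuous_normal_pdf_mean s z : 0 < s ->
  continuous (fun u => normal_pdf u s z).
Proof.
move=> s0.
have -> : (fun u => normal_pdf u s z) = normal_pdf z s.
  apply/funext => u; rewrite !normal_pdfE ?gt_eqF//.
  by congr (_ * expR _); rewrite -sqrrN opprB.
by apply: continuous_normal_pdf; rewrite gt_eqF.
Qed.

(** Completing the square in [u]: the joint density of an intermediate point [u] and an endpoint [z]
    factors as the density of [z] times the conditional density of [u] given [z], which integrates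
    to 1. *)
Lemma normal_pdf_mul x s t u z : 0 < s -> 0 < t ->
  let q := Num.sqrt (s ^+ 2 + t ^+ 2) in
  normal_pdf u t z * normal_pdf x s u = normal_pdf x q z *
    normal_pdf ((x * t ^+ 2 + z * s ^+ 2) / (s ^+ 2 + t ^+ 2)) (s * t / q) u.
Proof.
move=> s0 t0 q.
have st0 : 0 < s ^+ 2 + t ^+ 2 by rewrite addr_gt0// exprn_gt0.
have q0 : 0 < q by rewrite sqrtr_gt0.
have q2 : q ^+ 2 = s ^+ 2 + t ^+ 2 by rewrite sqr_sqrtr// ltW.
have v0 : 0 < s * t / q by rewrite divr_gt0// mulr_gt0.
rewrite !normal_pdfE ?gt_eqF// !normal_peakE//.
have := sqrt2pi_gt0; set w := Num.sqrt (pi *+ 2) => w0.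
rewrite mulrACA [RHS]mulrACA /normal_fun -!expRD; congr (_ * expR _).
  by field; rewrite !gt_eqF.
have -> : (s * t / q) ^+ 2 = (s * t) ^+ 2 / (s ^+ 2 + t ^+ 2).
  by rewrite exprMn exprVn q2.
rewrite q2; field; rewrite !gt_eqF//.
Qed.

Notation gam := (normal_prob (0 : R) 1).

Lemma ge0_integral_shift h x s : 0 < s -> continuous h ->
  (forall z, 0 <= h z) ->
  (\int[gam]_y (h (x + s * y))%:E =
   \int[leb]_z (h z * normal_pdf x s z)%:E)%E.
Proof.
move=> s0 ch h0.
have s0' : s != 0 by rewrite gt_eqF.
have caff : continuous (fun y : R => x + s * y).
  by move=> y; apply: cvgD; [exact: cvg_cst|apply: cvgM; [exact: cvg_cst|exact: cvg_id]].
rewrite ge0_integral_normal; last 2 first.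
- apply/measurable_EFinP; apply: continuous_measurable_fun => y.
  by apply: continuous_comp; [exact: caff|exact: ch].
- by move=> y; rewrite lee_fin.
rewrite [RHS](@ge0_integral_affine _ s x)//; last 2 first.
- by move=> z; apply: cvgM; [exact: ch|exact: continuous_normal_pdf].
- by move=> z; rewrite mulr_ge0// normal_pdf_ge0.
apply: eq_integral => z _; rewrite -EFinM; congr EFin.
by rewrite -mulrA normal_pdf_affine.
Qed.

(** N(0, s^2) convolved with N(0, t^2) is N(0, s^2 + t^2): Tonelli puts the integral over the
    intermediate point inside, where [normal_pdf_mul] evaluates it. *)
Lemma ge0_integral_semigroup h x s t : 0 < s -> 0 < t -> continuous h ->
  (forall z, 0 <= h z) ->
  (\int[gam]_y \int[gam]_z (h (x + s * y + t * z))%:E =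
   \int[gam]_w (h (x + Num.sqrt (s ^+ 2 + t ^+ 2) * w))%:E)%E.
Proof.
move=> s0 t0 ch h0; set q := Num.sqrt _.
have q0 : 0 < q by rewrite sqrtr_gt0 addr_gt0// exprn_gt0.
have v0 : 0 < s * t / q by rewrite divr_gt0// mulr_gt0.
have mh : measurable_fun setT h by exact: continuous_measurable_fun.
pose F (yz : measurableTypeR R * measurableTypeR R) : \bar R :=
  (h yz.2 * normal_pdf (x + s * yz.1) t yz.2)%:E.
have mF : measurable_fun setT F.
  apply/measurable_EFinP/measurable_funM.
    by apply: measurableT_comp => //.
  rewrite (_ : (fun _ => _) = (fun yz : measurableTypeR R * measurableTypeR R =>
     normal_peak t * expR (- (yz.2 - (x + s * yz.1)) ^+ 2 / (t ^+ 2 *+ 2)))).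
    apply: measurable_funM => //.
    apply: measurableT_comp => //.
    apply: measurable_funM => //.
    apply: measurableT_comp => //.
    apply: measurable_funX.
    apply: measurable_funB => //.
    apply: measurable_funD => //.
    exact: measurable_funM.
  by apply/funext => yz; rewrite normal_pdfE// gt_eqF.
have F0 yz : (0 <= F yz)%E by rewrite lee_fin mulr_ge0// normal_pdf_ge0.
under eq_integral do rewrite ge0_integral_shift//.
transitivity (\int[gam]_y \int[leb]_z F (y, z))%E; first by [].
rewrite (@fubini_tonelli _ _ _ _ _ gam leb F mF F0).
rewrite ge0_integral_shift//; apply: eq_integral => z _ /=.
rewrite /F/=.
transitivity ((h z)%:E * \int[gam]_y (normal_pdf (x + s * y) t z)%:E)%E.
  rewrite -ge0_integralZl//.
  - apply/measurable_EFinP.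
    apply: (measurableT_comp (f := fun u => normal_pdf u t z)).
      by apply: continuous_measurable_fun; exact: continuous_normal_pdf_mean.
    by apply: measurable_funD => //; exact: measurable_funM.
  - by move=> y _; rewrite lee_fin normal_pdf_ge0.
  - by rewrite lee_fin.
rewrite (ge0_integral_shift (h := fun u => normal_pdf u t z))//; last 2 first.
- exact: continuous_normal_pdf_mean.
- by move=> u; rewrite normal_pdf_ge0.
under eq_integral do rewrite normal_pdf_mul// EFinM.
rewrite ge0_integralZl//.
- by rewrite integral_normal_pdf mule1 -EFinM.
- by apply/measurable_EFinP; exact: measurable_normal_pdf.
- by move=> u _; rewrite lee_fin normal_pdf_ge0.
- by rewrite lee_fin normal_pdf_ge0.
Qed.

End NormalIntegrals.

(** * Integrability and differentiation against the Gaussian kernel *)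

Section SubGaussian.
Context (R : realType).
Implicit Types (m s t x y z c : R) (f g h : R -> R) (p q : {poly R}).
Local Notation leb := (@lebesgue_measure R).
Local Notation gam := (normal_prob (0 : R) 1).

(** Growth below exp(c z^2) for every c > 0. Unlike a bound with one fixed c, this is stable under
    products, affine substitution and Gaussian smoothing, and it implies integrability under the
    standard normal law. *)
Definition subgauss f := continuous f /\
  forall c, 0 < c -> exists C, forall z, `|f z| <= C * expR (c * z ^+ 2).

Lemma subgauss_cont f : subgauss f -> continuous f.
Proof. by case. Qed.

Lemma subgauss_bound f c : subgauss f -> 0 < c ->
  exists2 C, 0 <= C & forall z, `|f z| <= C * expR (c * z ^+ 2).
Proof.
move=> [_ /[apply] -[C hC]]; exists C => //.
have := hC 0; rewrite expr0n/= mulr0 expR0 mulr1; exact: le_trans.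
Qed.

Lemma subgauss_le f g : continuous f -> (forall z, `|f z| <= `|g z|) ->
  subgauss g -> subgauss f.
Proof.
move=> cf fg [_ sg]; split=> // c /sg[C hC]; exists C => z.
exact: le_trans (fg z) (hC z).
Qed.

Lemma expR_ge1' z : 0 <= z -> 1 <= expR z.
Proof. by move=> z0; rewrite -expR0 ler_expR. Qed.

Lemma subgauss_cst c : subgauss (fun=> c).
Proof.
split=> [|k k0]; first exact: cst_continuous.
by exists `|c| => z; rewrite ler_peMr// expR_ge1'// mulr_ge0 ?sqr_ge0// ltW.
Qed.

Lemma subgauss_id : subgauss id.
Proof.
split=> [|c c0]; first by move=> z; exact: cvg_id.
exists (1 + c^-1) => z.
have h : 1 + c * z ^+ 2 <= expR (c * z ^+ 2) by exact: expR_ge1Dx.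
have cV0 : 0 < c^-1 by rewrite invr_gt0.
apply: (@le_trans _ _ ((1 + c^-1) * (1 + c * z ^+ 2))); last first.
  by rewrite ler_wpM2l// addr_ge0// ltW.
have -> : (1 + c^-1) * (1 + c * z ^+ 2) = 1 + c^-1 + c * z ^+ 2 + z ^+ 2.
  by field; rewrite gt_eqF.
have : 0 <= c * z ^+ 2 by rewrite mulr_ge0 ?sqr_ge0// ltW.
have : 0 <= (`|z| - 1) ^+ 2 by exact: sqr_ge0.
rewrite sqrrB1 real_normK ?num_real//.
have := normr_ge0 z; lra.
Qed.

Lemma subgaussD f g : subgauss f -> subgauss g -> subgauss (fun z => f z + g z).
Proof.
move=> [cf sf] [cg sg]; split=> [z|c c0]; first exact: cvgD (cf z) (cg z).
have [A hA] := sf _ c0; have [B hB] := sg _ c0.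
exists (A + B) => z; rewrite mulrDl; apply: le_trans (ler_normD _ _) _.
exact: lerD.
Qed.

Lemma subgaussM f g : subgauss f -> subgauss g -> subgauss (fun z => f z * g z).
Proof.
move=> sf sg; split=> [z|c c0].
  exact: cvgM (subgauss_cont sf (x := z)) (subgauss_cont sg (x := z)).
have c20 : 0 < c / 2 by rewrite divr_gt0.
have [A A0 hA] := subgauss_bound sf c20.
have [B B0 hB] := subgauss_bound sg c20.
exists (A * B) => z; rewrite normrM.
have -> : expR (c * z ^+ 2) = expR (c / 2 * z ^+ 2) * expR (c / 2 * z ^+ 2).
  by rewrite -expRD -mulrDl -mulrDr; congr expR; lra.
by rewrite mulrACA ler_pM.
Qed.

Lemma subgaussZ c f : subgauss f -> subgauss (fun z => c * f z).
Proof. by apply: subgaussM; exact: subgauss_cst. Qed.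

Lemma subgaussB f g : subgauss f -> subgauss g -> subgauss (fun z => f z - g z).
Proof.
move=> sf sg; rewrite (_ : (fun z => f z - g z) = (fun z => f z + (-1) * g z)).
  by apply: subgaussD => //; exact: subgaussZ.
by apply/funext => z; rewrite mulN1r.
Qed.

Lemma subgaussX n f : subgauss f -> subgauss (fun z => f z ^+ n).
Proof.
move=> sf; elim: n => [|n IH]; first exact: subgauss_cst.
by under eq_fun do rewrite exprS; exact: subgaussM.
Qed.

Lemma subgauss_norm f : subgauss f -> subgauss (fun z => `|f z|).
Proof.
move=> sf; apply: (subgauss_le (g := f)) => // [z|z]; last by rewrite normr_id.
exact: cvg_norm (subgauss_cont sf (x := z)).
Qed.

Lemma subgauss_max0 f : subgauss f -> subgauss (fun z => Num.max (f z) 0).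
Proof.
move=> sf; apply: (subgauss_le (g := f)) => // [z|z]; last first.
  by case: (leP (f z) 0); rewrite ?normr0.
rewrite (_ : (fun z => _) = (fun z => 2^-1 * (f z + `|f z|))); last first.
  apply/funext => u; case: (leP (f u) 0) => h; first by rewrite ler0_norm// subrr mulr0.
  by rewrite gtr0_norm//; lra.
have := subgaussZ 2^-1 (subgaussD sf (subgauss_norm sf)).
by move=> /subgauss_cont; apply.
Qed.

Lemma subgauss_horner p : subgauss (horner p).
Proof.
elim/poly_ind: p => [|p c IH].
  rewrite (_ : horner 0 = fun=> 0); first exact: subgauss_cst.
  by apply/funext => z; rewrite horner0.
rewrite (_ : horner (p * 'X + c%:P) = fun z => p.[z] * z + c).
  by apply: subgaussD (subgauss_cst c); apply: subgaussM IH subgauss_id.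
by apply/funext => z; rewrite !hornerE.
Qed.

Lemma subgauss_affine f x s : subgauss f -> subgauss (fun y => f (x + s * y)).
Proof.
move=> [cf sf]; split=> [y|c c0].
  apply: (continuous_comp (f := fun y => x + s * y) (g := f)); last exact: cf.
  by apply: cvgD; [exact: cvg_cst|apply: cvgM; [exact: cvg_cst|exact: cvg_id]].
have d0 : 0 < 2 * (1 + s ^+ 2) by have := sqr_ge0 s; lra.
(* From (x + s y)^2 <= 2 x^2 + 2 (1 + s^2) y^2; [1 + s ^+ 2] in place of [s ^+ 2] keeps the
   denominator positive when [s = 0]. *)
pose k := c / (2 * (1 + s ^+ 2)).
have k0 : 0 < k by rewrite divr_gt0.
have [C C0 hC] := subgauss_bound (conj cf sf) k0.
exists (C * expR (k * (2 * x ^+ 2))) => y.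
apply: le_trans (hC _) _; rewrite -[leRHS]mulrA ler_wpM2l// -expRD ler_expR.
apply: (@le_trans _ _ (k * (2 * x ^+ 2) + k * (2 * (1 + s ^+ 2)) * y ^+ 2)).
  rewrite -mulrA -mulrDr; apply: ler_wpM2l; first exact: ltW.
  rewrite -subr_ge0.
  have -> : 2 * x ^+ 2 + 2 * (1 + s ^+ 2) * y ^+ 2 - (x + s * y) ^+ 2 =
    (x - s * y) ^+ 2 + 2 * y ^+ 2 by ring.
  by rewrite addr_ge0 ?sqr_ge0// mulr_ge0// sqr_ge0.
by rewrite {2}/k divfK// gt_eqF.
Qed.

Lemma integrable_gauss x s : 0 < s ->
  leb.-integrable setT (fun z => (expR (- (z - x) ^+ 2 / (s ^+ 2 *+ 2)))%:E).
Proof.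
move=> s0.
have p0 : 0 < normal_peak s by rewrite normal_peak_gt0// gt_eqF.
rewrite (_ : (fun _ => _) = (fun z => (normal_peak s)^-1%:E *
    (normal_pdf x s z)%:E)%E).
  by apply: integrableZl => //; exact: integrable_normal_pdf.
apply/funext => z; rewrite -EFinM normal_pdfE ?gt_eqF//.
by rewrite mulrA mulVf ?mul1r// gt_eqF.
Qed.

Lemma subgauss_meas f : subgauss f -> measurable_fun setT f.
Proof. by move=> /subgauss_cont; exact: continuous_measurable_fun. Qed.

Lemma gam_ig_le f C : measurable_fun setT f -> 0 <= C ->
  (forall z, `|f z| <= C * expR (1 / 4 * z ^+ 2)) -> ig gam f.
Proof.
move=> mf C0 hC.
apply/integrableP; split; first exact/measurable_EFinP.
rewrite ge0_integral_normal//; last exact/measurableT_comp/measurable_EFinP.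
(* exp(z^2 / 4) times the weight exp(- z^2 / 2) is exp(- z^2 / 4), the profile of a normal density
   of variance 2. *)
have s20 : 0 < Num.sqrt (2 : R) by rewrite sqrtr_gt0.
have H := integrable_gauss 0 s20.
have /integrableP[_] := integrableZl measurableT (C * normal_peak 1) H.
apply: le_lt_trans; apply: ge0_le_integral => //.
- by move=> z _; rewrite lee_fin mulr_ge0// normal_pdf_ge0.
- apply/measurable_EFinP/measurable_funM; first exact: measurableT_comp.
  exact: measurable_normal_pdf.
- apply: measurableT_comp => //.
  have /integrableP[+ _] := integrableZl measurableT (C * normal_peak 1) H.
  by [].
move=> z _; rewrite -EFinM lee_fin normal_pdfE ?oner_neq0//.
rewrite (ger0_norm (_ : 0 <= C * _ * _)); last first.
  by rewrite !mulr_ge0 ?expR_ge0 ?normal_peak_ge0.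
apply: (@le_trans _ _ (C * expR (1 / 4 * z ^+ 2) *
    (normal_peak 1 * normal_fun 0 1 z))).
  by rewrite ler_wpM2r// mulr_ge0 ?expR_ge0 ?normal_peak_ge0.
rewrite mulrACA -!mulrA ler_wpM2l// ler_wpM2l ?normal_peak_ge0//.
rewrite /normal_fun -expRD ler_expR sqr_sqrtr// subr0 expr1n.
by rewrite le_eqVlt; apply/orP; left; apply/eqP; field.
Qed.

Lemma subgauss_ig f : subgauss f -> ig gam f.
Proof.
move=> sf; have mf := subgauss_meas sf.
have [C C0 hC] := subgauss_bound sf (divr_gt0 (ltr01 : 0 < 1 :> R) (ltr0n R 4)).
exact: gam_ig_le hC.
Qed.

Lemma subgauss_L3 f : subgauss f -> L3 gam f.
Proof.
move=> sf; split; first exact: subgauss_meas.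
by apply: subgauss_ig; apply: subgaussX; exact: subgauss_norm.
Qed.

Lemma Ex_gam_shift h x s : 0 < s -> subgauss h ->
  Ex gam (fun y => h (x + s * y)) = \int[leb]_z (h z * normal_pdf x s z).
Proof.
move=> s0 sh; rewrite Ex.unlock /Rintegral; congr fine.
rewrite integralE [RHS]integralE; congr (_ - _)%E.
- transitivity (\int[gam]_y (Num.max (h (x + s * y)) 0)%:E)%E.
    by apply: eq_integral => y _; rewrite funeposE EFin_max.
  rewrite (ge0_integral_shift (h := fun z => Num.max (h z) 0))//.
  + apply: eq_integral => z _; rewrite funeposE -EFin_max maxr_pMl//.
      by rewrite mul0r.
    exact: normal_pdf_ge0.
  + exact/subgauss_cont/subgauss_max0.
  + by move=> z; rewrite le_max lexx orbT.
- transitivity (\int[gam]_y (Num.max (- h (x + s * y)) 0)%:E)%E.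
    by apply: eq_integral => y _; rewrite funenegE EFin_max.
  have sNh : subgauss (fun z => - h z).
    have := subgaussZ (-1) sh; congr subgauss.
    by apply/funext => z; rewrite mulN1r.
  rewrite (ge0_integral_shift (h := fun z => Num.max (- h z) 0))//.
  + apply: eq_integral => z _; rewrite funenegE -EFinN -EFin_max maxr_pMl//.
      by rewrite mul0r mulNr.
    exact: normal_pdf_ge0.
  + exact/subgauss_cont/subgauss_max0.
  + by move=> z; rewrite le_max lexx orbT.
Qed.

(* X p - p' is the adjoint derivative of p for the Gaussian weight. *)
Definition gauss_adj p : {poly R} := 'X * p - p^`().

(** After the change of variable z = x + y the point [x] sits in the kernel only, so derivatives in
    [x] never fall on [f]: each one replaces [p] by [gauss_adj p]. Starting from 1 this produces the
    Hermite polynomials. *)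
Definition Gp f p x := Ex gam (fun y => f (x + y) * p.[y]).

Lemma subgauss_shift f x : subgauss f -> subgauss (fun y => f (x + y)).
Proof.
move=> /(subgauss_affine x 1); congr subgauss.
by apply/funext => y; rewrite mul1r.
Qed.

Lemma subgauss_Gp f p x : subgauss f -> subgauss (fun y => f (x + y) * p.[y]).
Proof.
by move=> sf; apply: subgaussM (subgauss_horner p); exact: subgauss_shift.
Qed.

Lemma subgauss_horner_shift p x : subgauss (fun z => p.[z - x]).
Proof.
have := subgauss_affine (- x) 1 (subgauss_horner p); congr subgauss.
by apply/funext => z; rewrite mul1r addrC.
Qed.

Let ker p x z := p.[z - x] * normal_pdf x 1 z.

Let GpE f p x : subgauss f -> Gp f p x = \int[leb]_z (f z * ker p x z).
Proof.
move=> sf; rewrite /Gp.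
have sh : subgauss (fun z => f z * p.[z - x]).
  by apply: subgaussM => //; exact: subgauss_horner_shift.
transitivity (Ex gam (fun y => (fun z => f z * p.[z - x]) (x + 1 * y))).
  by apply: eq_Ex => y; rewrite mul1r addrAC subrr add0r.
rewrite (Ex_gam_shift x ltr01 sh); apply: eq_Rintegral => z _.
by rewrite -mulrA.
Qed.

Let ker_derive p x z : is_derive x 1 (ker p ^~ z) (ker (gauss_adj p) x z).
Proof.
have -> : ker p ^~ z = (fun u => normal_peak 1 *
    ((fun w => p.[w] * expR ((2^-1 *: - 'X^2 : {poly R}).[w])) \o
     (horner (z%:P - 'X))) u).
  apply/funext => u; rewrite /ker /=.
  have -> : (z%:P - 'X).[u] = z - u by rewrite !hornerE.
  have -> : (2^-1 *: - 'X^2 : {poly R}).[z - u] = 2^-1 * - (z - u) ^+ 2.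
    by rewrite !hornerE.
  have -> : normal_pdf u 1 z = normal_peak 1 * expR (2^-1 * - (z - u) ^+ 2).
    rewrite normal_pdfE ?oner_neq0//; congr (_ * expR _).
    by rewrite expr1n; field.
  by rewrite mulrCA.
have dw : is_derive x 1 (horner (z%:P - 'X)) (-1).
  by have := is_derive_poly (z%:P - 'X) x; rewrite derivB derivC derivX !hornerE.
have de (w : R) : is_derive w (1 : R) (expR \o horner (2^-1 *: - 'X^2 : {poly R}))
    (expR (2^-1 *: - 'X^2 : {poly R}).[w] * - w).
  apply: is_derive1_comp.
  have := is_derive_poly (2^-1 *: - 'X^2 : {poly R}) w.
  rewrite derivZ derivN derivXn !hornerE/= => /is_derive_eq; apply.
  by field.
have dm (w : R) : is_derive w (1 : R) (fun w =>
  p.[w] * expR (2^-1 *: - 'X^2 : {poly R}).[w])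
    (p.[w] * (expR (2^-1 *: - 'X^2 : {poly R}).[w] * - w) +
     expR (2^-1 *: - 'X^2 : {poly R}).[w] * p^`().[w]).
  have := @is_deriveM R R^o (horner p) (expR \o horner (2^-1 *: - 'X^2 : {poly R}))
    w 1 _ _ (is_derive_poly p w) (de w).
  by [].
have dc := is_derive1_comp (dm (horner (z%:P - 'X) x)) dw.
have := @is_deriveZ R R^o R^o _ (normal_peak 1) x 1 _ dc.
move=> /is_derive_eq; apply.
rewrite /ker normal_pdfE ?oner_neq0//= /gauss_adj !hornerE.
have -> : expR (2^-1 * - (z - x) ^+ 2) = normal_fun x 1 z.
  by congr expR; rewrite expr1n; field.
by rewrite /GRing.scale/=; ring.
Qed.

(** A dominating function uniform over |x - a| < 1, as differentiation under the integral requires.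
    The 8 comes from (z - a)^2 <= 2 (z - x)^2 + 2 (x - a)^2, once the polynomial has taken half of
    the exponent. *)
Let ker_bound p a : exists C, forall x z, `|x - a| < 1 ->
  `|ker p x z| <= C * expR (- (z - a) ^+ 2 / 8).
Proof.
have [C C0 hC] := subgauss_bound (subgauss_horner p)
  (divr_gt0 (ltr01 : 0 < 1 :> R) (ltr0n R 4)).
exists (C * normal_peak 1 * expR (1 / 4)) => x z xa.
rewrite /ker normal_pdfE ?oner_neq0// normrM.
rewrite (ger0_norm (_ : 0 <= _ * normal_fun _ _ _)); last first.
  by rewrite mulr_ge0 ?expR_ge0 ?normal_peak_ge0.
apply: (@le_trans _ _ (C * expR (1 / 4 * (z - x) ^+ 2) *
    (normal_peak 1 * normal_fun x 1 z))).
  by rewrite ler_wpM2r// mulr_ge0 ?expR_ge0 ?normal_peak_ge0.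
rewrite mulrACA -!mulrA ler_wpM2l// ler_wpM2l ?normal_peak_ge0//.
rewrite /normal_fun -!expRD ler_expR expr1n.
have h1 : (x - a) ^+ 2 <= 1.
  by rewrite -real_normK ?num_real// expr_le1// ltW.
have h2 := sqr_ge0 (z - x - (x - a)).
have -> : z - a = (z - x) + (x - a) by ring.
move: h1 h2; set u := z - x; set v := x - a => h1 h2; nra.
Qed.

Lemma integrable_normal_weight h x s : 0 < s -> subgauss h ->
  leb.-integrable setT (EFin \o (fun z => h z * normal_pdf x s z)).
Proof.
move=> s0 sh; apply/integrableP; split.
  apply/measurable_EFinP/measurable_funM; first exact: subgauss_meas.
  exact: measurable_normal_pdf.
have /integrableP[_] := subgauss_ig (subgauss_norm (subgauss_affine x s sh)).
have -> : (\int[gam]_y `|(EFin \o (fun y => `|h (x + s * y)|)%R) y| =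
  \int[gam]_y (`|h (x + s * y)|)%:E)%E.
  by apply: eq_integral => y _ /=; rewrite normr_id.
rewrite (ge0_integral_shift (h := fun z => `|h z|))//; last first.
  exact/subgauss_cont/subgauss_norm.
apply: le_lt_trans; rewrite le_eqVlt; apply/orP; left; apply/eqP.
apply: eq_integral => z _ /=; rewrite normrM.
by rewrite (ger0_norm (normal_pdf_ge0 _ _ _)).
Qed.

Lemma is_derive_Gp f p x : subgauss f ->
  is_derive x 1 (Gp f p) (Gp f (gauss_adj p) x).
Proof.
move=> sf.
(* The rate 1/32 is small enough for the kernel: z^2/32 - (z - x)^2/8 <= x^2/16 - (z - x)^2/16, the
   difference being (z - 2x)^2/32. *)
have [F FF0 hF] := subgauss_bound sf (divr_gt0 (ltr01 : 0 < 1 :> R) (ltr0n R 32)).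
have [C hC] := ker_bound (gauss_adj p) x.
have C0 : 0 <= C.
  have := hC x x; rewrite subrr normr0 ltr01 => /(_ isT).
  rewrite expr0n/= oppr0 mul0r expR0 mulr1; exact: le_trans.
have E q : Gp f q = (fun u => \int[leb]_z (f z * ker q u z)).
  by apply/funext => u; exact: GpE.
pose k (u : R) (z : R) := f z * ker p u z.
have dk (u : R) (z : R) : is_derive u (1 : R) (k ^~ z) (f z * ker (gauss_adj p) u z).
  have := @is_deriveZ R R^o R^o _ (f z) u 1 _ (ker_derive p u z).
  by [].
have kint q (u : R) : leb.-integrable setT (EFin \o (fun z => f z * ker q u z)).
  have sh : subgauss (fun z => f z * q.[z - u]).
    by apply: subgaussM => //; exact: subgauss_horner_shift.
  have := integrable_normal_weight u ltr01 sh.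
  by congr integrable; apply/funext => z /=; rewrite /ker mulrA.
pose G z := F * C * expR (1 / 16 * x ^+ 2) * expR (- (z - x) ^+ 2 / 16).
have d1k u z : partial1of2 k u z = f z * ker (gauss_adj p) u z.
  by rewrite partial1of2E; apply: derive_val.
have Ix : `]x - 1, x + 1[%classic x.
  by rewrite /= in_itv/=; apply/andP; split; lra.
have intG : leb.-integrable setT (EFin \o G).
  have s80 : 0 < Num.sqrt (8 : R) by rewrite sqrtr_gt0.
  have := integrableZl measurableT (F * C * expR (1 / 16 * x ^+ 2))
    (integrable_gauss x s80).
  congr integrable; apply/funext => z /=; rewrite /G -EFinM sqr_sqrtr//.
  by rewrite -mulrnA.
have G0 z : 0 <= G z by rewrite !mulr_ge0 ?expR_ge0.
have Gub u z : `]x - 1, x + 1[%classic u -> setT z -> `|partial1of2 k u z| <= G z.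
  rewrite /= in_itv/= => /andP[u1 u2] _; rewrite d1k normrM.
  have ux : `|u - x| < 1 by rewrite ltr_norml; apply/andP; split; lra.
  apply: le_trans (ler_pM (normr_ge0 _) (normr_ge0 _) (hF z) (hC u z ux)) _.
  have -> : G z = F * C * (expR (1 / 16 * x ^+ 2) * expR (- (z - x) ^+ 2 / 16)).
    by rewrite /G [RHS]mulrA.
  rewrite mulrACA; apply: ler_wpM2l; first exact: mulr_ge0.
  rewrite -!expRD ler_expR.
  rewrite -subr_ge0.
  set lhs := (X in 0 <= X).
  have -> : lhs = (z - 2 * x) ^+ 2 / 32 by rewrite /lhs; field.
  by rewrite divr_ge0 ?sqr_ge0.
have dG := @derivable_under_integral R _ _ leb k setT measurableT x (x - 1) (x + 1)
  Ix (fun u _ => kint p u) (fun u z _ _ => @ex_derive _ _ _ _ _ _ _ (dk u z)) G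
  G0 intG Gub.
have dGE := @differentiation_under_integral R _ _ leb k setT measurableT x (x - 1)
  (x + 1) Ix (fun u _ => kint p u)
  (fun u z _ _ => @ex_derive _ _ _ _ _ _ _ (dk u z)) G G0 intG Gub.
rewrite !E; apply: DeriveDef; first exact: dG.
rewrite -derive1E dGE; apply: eq_Rintegral => z _; exact: d1k.
Qed.

End SubGaussian.

(** * Derivatives of Gaussian smoothings *)

Section Smoothing.
Context (R : realType).
Implicit Types (s t x y z c r : R) (f g h : R -> R) (p q : {poly R}).
Local Notation gam := (normal_prob (0 : R) 1).

Lemma lipschitz_is_derive f (f1 : R -> R) K :
  (forall x, is_derive x (1 : R) f (f1 x)) -> (forall x, `|f1 x| <= K) ->
  forall x y, `|f x - f y| <= K * `|x - y|.
Proof.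
move=> df f1K.
have cf : continuous f.
  by move=> x; apply/differentiable_continuous/derivable1_diffP; exact: ex_derive.
have wlog x y : y < x -> `|f x - f y| <= K * `|x - y|.
  move=> yx.
  have [c _ ->] := MVT yx (fun z _ => df z) (continuous_subspaceT cf).
  by rewrite normrM ler_wpM2r.
move=> x y; have [xy|xy|->] := ltgtP x y.
- by rewrite distrC (distrC x); exact: wlog.
- exact: wlog.
- by rewrite !subrr normr0 mulr0.
Qed.

(** Gaussian integration by parts, read off from [is_derive_Gp] at the constant function 1: there
    [Gp] does not depend on [x], so its derivative is 0. *)
Lemma Ex_gauss_adj p : Ex gam (horner (gauss_adj p)) = 0.
Proof.
have h := is_derive_Gp p 0 (subgauss_cst (1 : R)).
have E q : Gp (fun=> 1) q = fun=> Ex gam (horner q).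
  by apply/funext => x; apply: eq_Ex => y; rewrite mul1r.
have h0 : is_derive (0 : R) (1 : R) (Gp (fun=> 1) p) 0.
  by rewrite E; exact: is_derive_cst.
have := @derive_val _ _ _ _ _ _ _ h; rewrite (@derive_val _ _ _ _ _ _ _ h0).
by rewrite E => <-.
Qed.

Lemma Ex_gam_id : Ex gam id = 0.
Proof.
rewrite -[RHS](Ex_gauss_adj 1); apply: eq_Ex => y.
by rewrite /gauss_adj mulr1 -polyC1 derivC subr0 hornerX.
Qed.

Lemma Ex_gam_sqr : Ex gam (fun y => y ^+ 2) = 1.
Proof.
have i2 : ig gam (fun y => y ^+ 2) by apply/subgauss_ig/subgaussX/subgauss_id.
have := Ex_gauss_adj 'X.
rewrite (_ : Ex gam _ = Ex gam (fun y => y ^+ 2 - 1)); last first.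
  by apply: eq_Ex => y; rewrite /gauss_adj derivX !hornerE.
by rewrite ExB ?Ex_cst//; [move/eqP; rewrite subr_eq0 => /eqP|exact: ig_cst].
Qed.

(** The third Hermite polynomial y^3 - 3y, the weight that represents a third derivative of a
    smoothing. *)
Let H3 : {poly R} := gauss_adj (gauss_adj (gauss_adj 1)).

Let H3E y : H3.[y] = y ^+ 3 - 3 * y.
Proof.
rewrite /H3 /gauss_adj !(derivC, derivB, derivM, derivX, derivD) !hornerE; ring.
Qed.

Let H3_orth (a b c : R) :
  Ex gam (fun y => (a + b * y + c * y ^+ 2) * H3.[y]) = 0.
Proof.
(* [p] solves y p - p' = (a + b y + c y^2) (y^3 - 3 y), one coefficient at a time. *)
pose p : {poly R} := a *: ('X^2 - 1) + b *: 'X^3 + c *: ('X^4 + 'X^2 + 2%:P).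
rewrite -[RHS](Ex_gauss_adj p); apply: eq_Ex => y.
rewrite H3E /gauss_adj /p !(derivC, derivB, derivM, derivXn, derivD, derivZ) /=.
by rewrite !hornerE/=; ring.
Qed.

(** Since 1 + |y|^3 >= |y|^r for all r in [0, 3], one constant serves every order. *)
Definition gauss_const : R := Ex gam (fun y => (1 + `|y| ^+ 3) * `|H3.[y]|).

Lemma gauss_const_ge0 : 0 <= gauss_const.
Proof. by apply: Ex_ge0 => y; rewrite mulr_ge0// addr_ge0. Qed.

Let subgauss_abs3 : subgauss (fun y : R => `|y| ^+ 3).
Proof. by apply/subgaussX/subgauss_norm/subgauss_id. Qed.

(** The form of regularity that smoothing converts into a Lipschitz second derivative: degree 2
    suffices for every [r <= 3], and the coefficients need no control because [H3] is orthogonal to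
    quadratic polynomials. *)
Definition quad_approx r f := forall x, exists a b c : R, forall h : R,
  `|f (x + h) - (a + b * h + c * h ^+ 2)| <= `|h| `^ r.

Lemma powR_le1X r y : 0 <= y -> 0 <= r <= 3 -> y `^ r <= 1 + y ^+ 3.
Proof.
move=> y0 /andP[r0 r3]; have [y1|y1] := leP y 1.
  rewrite (@le_trans _ _ 1) ?lerDl ?exprn_ge0//.
  by apply: le_trans (ge0_ler_powR r0 _ _ y1) _; rewrite ?nnegrE// powR1.
rewrite -powR_mulrn//; apply: (@le_trans _ _ (y `^ 3)); last by rewrite lerDr.
by rewrite ler_powR// ltW.
Qed.

Let Gp_bound f r t u : 0 < t -> 0 <= r <= 3 -> subgauss f -> quad_approx r f ->
  `|Gp (fun u => f (t * u)) H3 u| <= gauss_const * t `^ r.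
Proof.
move=> t0 r03 sf qf.
have [a [b [c h]]] := qf (t * u).
have sft : subgauss (fun u => f (t * u)).
  by have := subgauss_affine 0 t sf; congr subgauss; apply/funext => v; rewrite add0r.
have sq : subgauss (fun y => a + (b * t) * y + (c * t ^+ 2) * y ^+ 2).
  apply: subgaussD; last exact/subgaussZ/subgaussX/subgauss_id.
  by apply: subgaussD; [exact: subgauss_cst|exact/subgaussZ/subgauss_id].
have i1 : ig gam (fun y => f (t * (u + y)) * H3.[y]).
  exact: (subgauss_ig (subgauss_Gp H3 u sft)).
have i2 : ig gam (fun y => (a + (b * t) * y + (c * t ^+ 2) * y ^+ 2) * H3.[y]).
  by apply: subgauss_ig; apply: subgaussM sq (subgauss_horner _).
rewrite /Gp -[X in `|X|]subr0 -[X in _ - X](H3_orth a (b * t) (c * t ^+ 2)).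
rewrite -ExB// /gauss_const -ExZr; last first.
  apply: subgauss_ig; apply: subgaussM; last exact/subgauss_norm/subgauss_horner.
  by apply: subgaussD => //; exact: subgauss_cst.
apply: Ex_abs_le; first exact: igB.
  apply: igZr; apply: subgauss_ig; apply: subgaussM.
    by apply: subgaussD => //; exact: subgauss_cst.
  exact/subgauss_norm/subgauss_horner.
move=> y; rewrite -mulrBl normrM [leRHS]mulrAC ler_wpM2r//.
have := h (t * y); rewrite -mulrDr.
have -> : a + b * t * y + c * t ^+ 2 * y ^+ 2 = a + b * (t * y) + c * (t * y) ^+ 2.
  ring.
move=> /le_trans; apply.
rewrite normrM (gtr0_norm t0) powRM ?(ltW t0)// mulrC ler_wpM2r ?powR_ge0//.
exact: powR_le1X.
Qed.

Definition Q s f x := Ex gam (fun y => f (x + s * y)).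

(** [Q t f] is [Gp] of the dilated function, taken at [x / t]. Each derivative costs a factor 1/t,
    and the third weight only sees the remainder of the quadratic approximation, of size t^r: hence
    t^(r - 3). *)
Lemma Q_smooth f r t : 0 < t -> 0 <= r <= 3 -> subgauss f -> quad_approx r f ->
  exists g1 g2 : R -> R, [/\ forall x, is_derive x (1 : R) (Q t f) (g1 x),
    forall x, is_derive x (1 : R) g1 (g2 x) &
    forall x y, `|g2 x - g2 y| <= gauss_const * t `^ (r - 3) * `|x - y|].
Proof.
move=> t0 r03 sf qf.
have sft : subgauss (fun u => f (t * u)).
  by have := subgauss_affine 0 t sf; congr subgauss; apply/funext => v; rewrite add0r.
have tV (z : R) : is_derive z (1 : R) (fun z => z / t) t^-1.
  rewrite (_ : (fun z => z / t) = horner (t^-1 *: 'X)); last first.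
    by apply/funext => v; rewrite !hornerE mulrC.
  by have := is_derive_poly (t^-1 *: 'X) z; rewrite derivZ derivX !hornerE.
have step n p (z : R) : is_derive z (1 : R)
    (fun z => t^-1 ^+ n * Gp (fun u => f (t * u)) p (z / t))
    (t^-1 ^+ n.+1 * Gp (fun u => f (t * u)) (gauss_adj p) (z / t)).
  have d1 := @is_derive1_comp R _ (fun z => z / t) z _ _
    (is_derive_Gp p (z / t) sft) (tV z).
  have := @is_deriveZ R R^o R^o _ (t^-1 ^+ n) z 1 _ d1.
  move=> /is_derive_eq; apply.
  by rewrite /GRing.scale/= exprSr; ring.
have QE : Q t f = fun z => t^-1 ^+ 0 * Gp (fun u => f (t * u)) 1 (z / t).
  apply/funext => z; rewrite expr0 mul1r; apply: eq_Ex => y.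
  by rewrite hornerE mulr1 mulrDr mulrCA mulfV ?gt_eqF// mulr1.
exists (fun z => t^-1 ^+ 1 * Gp (fun u => f (t * u)) (gauss_adj 1) (z / t)).
exists (fun z => t^-1 ^+ 2 * Gp (fun u => f (t * u)) (gauss_adj (gauss_adj 1)) (z / t)).
split=> [x|x|].
- by rewrite QE; exact: step.
- exact: step.
apply: lipschitz_is_derive (step 2%N _) _ => x.
rewrite normrM ger0_norm; last by rewrite exprn_ge0// invr_ge0 ltW.
apply: le_trans (ler_wpM2l _ (Gp_bound _ t0 r03 sf qf)) _.
  by rewrite exprn_ge0// invr_ge0 ltW.
rewrite mulrCA ler_wpM2l ?gauss_const_ge0// powRD; last first.
  by rewrite (gt_eqF t0) implybT.
rewrite mulrC ler_wpM2l ?powR_ge0// powRN powR_mulrn ?(ltW t0)//.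
by rewrite exprVn.
Qed.

Lemma subgauss_Q s f : 0 < s -> subgauss f -> subgauss (Q s f).
Proof.
move=> s0 sf; split.
  have sft : subgauss (fun u => f (s * u)).
    by have := subgauss_affine 0 s sf; congr subgauss; apply/funext => v; rewrite add0r.
  have -> : Q s f = Gp (fun u => f (s * u)) 1 \o (fun z => z / s).
    apply/funext => z; apply: eq_Ex => y.
    by rewrite hornerE mulr1 mulrDr mulrCA mulfV ?gt_eqF// mulr1.
  move=> z; apply: continuous_comp.
    by apply: cvgM; [exact: cvg_id|exact: cvg_cst].
  apply/differentiable_continuous/derivable1_diffP.
  exact: (@ex_derive _ _ _ _ _ _ _ (is_derive_Gp 1 (z / s) sft)).
move=> c c0.
(* (z + s y)^2 <= 2 z^2 + 2 s^2 y^2: the first entry of the minimum keeps the growth rate in [z] at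
   most [c], the second keeps exp(2 k s^2 y^2) below the integrable exp(y^2 / 4). *)
pose k := Num.min (c / 2) (1 / 8 / s ^+ 2).
have s20 : 0 < s ^+ 2 by rewrite exprn_gt0.
have k0 : 0 < k by rewrite /k lt_min !divr_gt0.
have kc : 2 * k <= c.
  have : k <= c / 2 by rewrite /k ge_min lexx.
  lra.
have ks : 2 * k * s ^+ 2 <= 1 / 4.
  have : k <= 1 / 8 / s ^+ 2 by rewrite /k ge_min lexx orbT.
  rewrite ler_pdivlMr//; lra.
have [C C0 hC] := subgauss_bound sf k0.
have iC : ig gam (fun y => expR (1 / 4 * y ^+ 2)).
  apply: (@gam_ig_le _ _ 1) => // [|z]; last first.
    by rewrite [leRHS]mul1r ger0_norm ?expR_ge0.
  by apply: measurableT_comp => //; apply: measurable_funM.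
exists (C * Ex gam (fun y => expR (1 / 4 * y ^+ 2))) => z.
rewrite mulrAC -ExZ//; apply: Ex_abs_le.
- by apply: subgauss_ig; exact: subgauss_affine.
- exact: igZ.
move=> y; apply: le_trans (hC _) _; rewrite -[leRHS]mulrA ler_wpM2l// -expRD ler_expR.
apply: (@le_trans _ _ (2 * k * z ^+ 2 + 2 * k * s ^+ 2 * y ^+ 2)).
  rewrite -subr_ge0.
  have -> : 2 * k * z ^+ 2 + 2 * k * s ^+ 2 * y ^+ 2 - k * (z + s * y) ^+ 2 =
     k * (z - s * y) ^+ 2 by ring.
  by rewrite mulr_ge0 ?sqr_ge0// ltW.
by apply: lerD; rewrite ler_wpM2r ?sqr_ge0.
Qed.

Lemma Q_semigroup s t f x : 0 < s -> 0 < t -> subgauss f ->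
  Q s (Q t f) x = Q (Num.sqrt (s ^+ 2 + t ^+ 2)) f x.
Proof.
move=> s0 t0 sf.
have ge0 g : subgauss g -> (forall z, 0 <= g z) ->
    Q s (Q t g) x = Q (Num.sqrt (s ^+ 2 + t ^+ 2)) g x.
  move=> sg g0; apply: EFin_inj.
  rewrite /Q -!ge0_ExE; last 2 first.
  - by apply: subgauss_ig; exact: subgauss_affine.
  - by apply: subgauss_ig; exact: (subgauss_affine x s (subgauss_Q t0 sg)).
  rewrite -ge0_integral_semigroup//; last exact: subgauss_cont.
  apply: eq_integral => y _; rewrite ge0_ExE//.
  by apply: subgauss_ig; exact: subgauss_affine.
pose fp z := Num.max (f z) 0; pose fn z := Num.max (- f z) 0.
have sfp : subgauss fp by exact: subgauss_max0.
have sfn : subgauss fn.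
  apply: subgauss_max0; have := subgaussZ (-1) sf; congr subgauss.
  by apply/funext => z; rewrite mulN1r.
have fE : f = fun z => fp z - fn z.
  apply/funext => z; rewrite /fp /fn.
  by case: (leP (f z) 0); case: (leP (- f z) 0) => *; lra.
have QB w g h : subgauss g -> subgauss h ->
    Q w (fun z => g z - h z) = fun z => Q w g z - Q w h z.
  move=> sg sh; apply/funext => z; rewrite /Q ExB//;
    by apply: subgauss_ig; exact: subgauss_affine.
have Qf w : Q w f = fun z => Q w fp z - Q w fn z by rewrite [in LHS]fE QB.
rewrite (Qf t) (QB _ _ _ (subgauss_Q t0 sfp) (subgauss_Q t0 sfn)) Qf.
by rewrite !ge0// => z; rewrite le_max lexx orbT.
Qed.

Definition gam_abs1 : R := Ex gam (fun y => `|y|).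
Definition gam_abs3 : R := Ex gam (fun y => `|y| ^+ 3).

Lemma gam_abs1_ge0 : 0 <= gam_abs1.
Proof. by apply: Ex_ge0 => y. Qed.

Lemma gam_abs3_ge0 : 0 <= gam_abs3.
Proof. by apply: Ex_ge0 => y; rewrite exprn_ge0. Qed.

Lemma ig_gam n : ig gam (fun y : R => `|y| ^+ n).
Proof. by apply/subgauss_ig/subgaussX/subgauss_norm/subgauss_id. Qed.

End Smoothing.

(** * Taylor remainders and cubic inequalities *)

Section Taylor.
Context (R : realType).
Implicit Types (f g : R -> R).

Lemma is_derive_continuous f f1 :
  (forall x, is_derive x (1 : R) f (f1 x)) -> continuous f.
Proof.
move=> df x; apply/differentiable_continuous/derivable1_diffP.
exact: (@ex_derive _ _ _ _ _ _ _ (df x)).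
Qed.

Lemma mean_value f f1 x h : (forall z, is_derive z (1 : R) f (f1 z)) ->
  exists2 c, `|c| <= `|h| & f (x + h) - f x = f1 (x + c) * h.
Proof.
move=> df; have cf := is_derive_continuous df.
have [h0|h0|->] := ltgtP h 0.
- have xh : x + h < x by rewrite -[ltRHS]addr0 ltrD2l.
  have [c] := MVT xh (fun z _ => df z) (continuous_subspaceT cf).
  rewrite in_itv/= => /andP[c1 c2] Hc; exists (c - x); last by rewrite subrKC; lra.
  by rewrite !ltr0_norm ?subr_lt0//; lra.
- have xh : x < x + h by rewrite -[ltLHS]addr0 ltrD2l.
  have [c] := MVT xh (fun z _ => df z) (continuous_subspaceT cf).
  rewrite in_itv/= => /andP[c1 c2] Hc; exists (c - x); last by rewrite subrKC; lra.
  by rewrite !gtr0_norm ?subr_gt0//; lra.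
- by exists 0; rewrite ?normr0// !addr0 subrr mulr0.
Qed.

Lemma taylor1 f f1 (K s : R) : 0 <= s -> 0 <= K ->
  (forall x, is_derive x (1 : R) f (f1 x)) -> forall x,
  (forall y, `|f1 (x + y) - f1 x| <= K * `|y| `^ s) ->
  forall h, `|f (x + h) - f x - f1 x * h| <= K * `|h| `^ (s + 1).
Proof.
move=> s0 K0 df x Hf1 h; have [c ch ->] := mean_value x h df.
rewrite -mulrBl normrM powRD; last by rewrite gt_eqF// (lt_le_trans ltr01)// lerDr.
rewrite powRr1// mulrA ler_wpM2r//; apply: le_trans (Hf1 c) _.
by rewrite ler_wpM2l// ge0_ler_powR ?nnegrE.
Qed.

Lemma taylor2 f f1 f2 (K s : R) : 0 <= s -> 0 <= K ->
  (forall x, is_derive x (1 : R) f (f1 x)) ->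
  (forall x, is_derive x (1 : R) f1 (f2 x)) -> forall x,
  (forall y, `|f2 (x + y) - f2 x| <= K * `|y| `^ s) ->
  forall h, `|f (x + h) - f x - f1 x * h - f2 x * h ^+ 2 / 2| <=
    K * `|h| `^ (s + 2).
Proof.
move=> s0 K0 df df1 x Hf2 h.
pose g z := f z - (horner (f2 x / 2 *: (('X - x%:P) * ('X - x%:P)))) z.
have dg z : is_derive z (1 : R) g (f1 z - f2 x * (z - x)).
  have := is_derive_poly (f2 x / 2 *: (('X - x%:P) * ('X - x%:P))) z.
  rewrite derivZ derivM derivB derivX derivC !hornerE/= => dp.
  have := @is_deriveB R R^o R^o f (horner (f2 x / 2 *: (('X - x%:P) * ('X - x%:P)))) z 1 _ _
    (df z) dp.
  by move=> /is_derive_eq; apply; rewrite ?subr0; field.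
have h1 y : `|(f1 (x + y) - f2 x * (x + y - x)) - (f1 x - f2 x * (x - x))| <=
    K * `|y| `^ (s + 1).
  have := taylor1 s0 K0 df1 Hf2 y.
  by congr (`|_| <= _); ring.
have s10 : 0 <= s + 1 by rewrite addr_ge0.
have := taylor1 s10 K0 dg h1 h.
have -> : s + 1 + 1 = s + 2 by ring.
by congr (`|_| <= _); rewrite /g !hornerE/=; field.
Qed.

(** The term of first order in [y] keeps its sign, so it vanishes in mean when [y] is a martingale
    increment; an absolute value there would destroy the square root growth. *)
Lemma cube_le (x y : R) : `|x + y| ^+ 3 <=
  `|x| ^+ 3 + 3 * (x * `|x| * y) + 3 * (`|x| * y ^+ 2) + `|y| ^+ 3.
Proof.
have key (u v : R) : 0 <= u -> `|u + v| ^+ 3 <=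
  u ^+ 3 + 3 * (u * u * v) + 3 * (u * v ^+ 2) + `|v| ^+ 3.
  move=> u0; have [uv|uv] := leP 0 (u + v).
    rewrite (ger0_norm uv) -subr_ge0.
    have -> : u ^+ 3 + 3 * (u * u * v) + 3 * (u * v ^+ 2) + `|v| ^+ 3 - (u + v) ^+ 3
      = `|v| ^+ 3 - v ^+ 3 by ring.
    by rewrite subr_ge0 -normrX ler_norm.
  have v0 : v < 0 by lra.
  rewrite (ltr0_norm uv) (ltr0_norm v0) -subr_ge0.
  have -> : u ^+ 3 + 3 * (u * u * v) + 3 * (u * v ^+ 2) + (- v) ^+ 3 -
    (- (u + v)) ^+ 3 = 2 * u * ((u + 3 / 2 * v) ^+ 2 + 3 / 4 * v ^+ 2) by field.
  by rewrite !mulr_ge0// addr_ge0 ?sqr_ge0// mulr_ge0 ?sqr_ge0.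
have [x0|x0] := leP 0 x; first by rewrite (ger0_norm x0); exact: key.
have := key (- x) (- y); rewrite oppr_ge0 => /(_ (ltW x0)).
rewrite -opprD !normrN (ltr0_norm x0) sqrrN.
congr (_ <= _); ring.
Qed.

(** Closes the induction of [msum_incr] with a = sqrt k and b = sqrt (k + 1): then 8 (b^3 - a^3) >=
    6 (a + b) and b >= 1, so the constant 2 is large enough. *)
Lemma cube_step (a b : R) : 0 <= a -> 0 <= b -> b ^+ 2 = a ^+ 2 + 1 ->
  (2 * a) ^+ 3 + 3 * (2 * a) + 1 <= (2 * b) ^+ 3.
Proof.
move=> a0 b0 h.
have ab : a <= b by rewrite -ler_sqr ?nnegrE// h lerDl.
have b1 : 1 <= b by rewrite -(@ler_sqr _ 1) ?nnegrE// h expr1n lerDr sqr_ge0.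
have e : b ^+ 3 - a ^+ 3 = 3 / 4 * (a + b) * (b ^+ 2 - a ^+ 2) + (b - a) ^+ 3 / 4.
  by field.
have : 0 <= (b - a) ^+ 3 by rewrite exprn_ge0// subr_ge0.
move: e; rewrite h [a ^+ 2 + 1]addrC addrK mulr1 !exprMn; lra.
Qed.

End Taylor.
(** * Lindeberg's method for martingales with stationary variance *)

Section MartingaleSums.
Context (d : measure_display) (T : measurableType d) (R : realType).
Variable P : probability T R.
Variable F : nat -> set (set T).
Hypothesis sF : forall k, sigma_algebra setT (F k).
Hypothesis FT : forall k, F k `<=` measurable.
Hypothesis FS : forall k, F k `<=` F k.+1.
Variables (D : nat -> T -> R) (kappa s : R).
Hypothesis DF : forall k, Gm (F k.+1) (D k).
Hypothesis D3 : forall k, L3 P (D k).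
Hypothesis Dorth : forall k, orth P (F k) (D k).
Hypothesis Dkappa : forall k, N3 P (D k) <= kappa.

Local Notation gam := (normal_prob (0 : R) 1).
Local Notation Exg := (Ex gam).
Local Notation igg := (ig gam).
Local Notation gam_abs1 := (gam_abs1 R).
Local Notation gam_abs3 := (gam_abs3 R).
Local Notation Ex := (Ex P).
Local Notation ig := (ig P).
Local Notation N3 := (N3 P).
Local Notation L3 := (L3 P).

Definition msum n w := \sum_(k < n) D k w.

Lemma msum0 w : msum 0 w = 0.
Proof. by rewrite /msum big_ord0. Qed.

Lemma msumS n w : msum n.+1 w = msum n w + D n w.
Proof. by rewrite /msum big_ord_recr. Qed.

Lemma msum_L3 n : L3 (msum n).
Proof. exact: L3_sum. Qed.

Lemma F_le m n : (m <= n)%N -> F m `<=` F n.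
Proof.
move=> mn; rewrite -(subnKC mn); elim: (n - m)%N => [|k IH].
  by rewrite addn0.
by rewrite addnS; apply: subset_trans IH (@FS _).
Qed.

Lemma Gm_le m n (Z : T -> R) : (m <= n)%N -> Gm (F m) Z -> Gm (F n) Z.
Proof. by move=> mn GZ B mB; apply: F_le mn _ (GZ B mB). Qed.

Lemma msum_Gm n : Gm (F n) (msum n).
Proof.
elim: n => [|n IH].
  have -> : msum 0 = fun=> 0 by apply/funext => w; rewrite msum0.
  exact: Gm_cst.
have -> : msum n.+1 = fun w => msum n w + D n w.
  by apply/funext => w; rewrite msumS.
apply: GmD => //; exact: Gm_le IH.
Qed.

Lemma orth_mul k Z : Gm (F k) Z -> ig (fun w => Z w * D k w) ->
  Ex (fun w => Z w * D k w) = 0.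
Proof.
move=> GZ iZ; rewrite (eq_Ex (g := fun w => D k w * Z w)).
  apply: (orthM (sF k) (@FT k) (Dorth k)) => //.
  by move: iZ; congr ig; apply/funext => w; rewrite mulrC.
by move=> w; rewrite mulrC.
Qed.

Lemma kappa_ge0 : 0 <= kappa.
Proof. exact: le_trans (N3_ge0 _ _) (Dkappa 0). Qed.

Lemma msum_incr_L3 m k : L3 (fun w => msum (m + k) w - msum m w).
Proof. by apply: L3B; exact: msum_L3. Qed.

(** A Burkholder type bound at exponent 3, by induction on [k]: in [cube_le] the linear term
    vanishes by orthogonality and the quadratic one is controlled by N3(A) kappa^2. *)
Lemma msum_incr m k :
  N3 (fun w => msum (m + k) w - msum m w) <= 2 * kappa * Num.sqrt k%:R.
Proof.
have K0 := kappa_ge0.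
elim: k => [|k IH].
  rewrite (eq_N3 (g := fun=> 0)) ?N3_cst ?normr0 ?mulr_ge0//.
  by move=> w; rewrite addn0 subrr normr0.
set A := fun w => msum (m + k) w - msum m w in IH *.
have LA : L3 A by exact: msum_incr_L3.
have GA : Gm (F (m + k)%N) A.
  by apply: GmB => //; [exact: msum_Gm|apply: Gm_le (msum_Gm m); exact: leq_addr].
have -> : (fun w => msum (m + k.+1) w - msum m w) =
    (fun w => A w + D (m + k)%N w).
  by apply/funext => w; rewrite /A addnS msumS addrAC.
set B := D (m + k)%N.
have LB : L3 B by exact: D3.
have sq0 : 0 <= Num.sqrt (k%:R : R) by exact: sqrtr_ge0.
have i1 : ig (fun w => `|A w| ^+ 3) by case: LA.
have i4 : ig (fun w => `|B w| ^+ 3) by case: LB.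
have i2 : ig (fun w => A w * `|A w| * B w) by apply: ig3 => //; exact: L3_abs.
have i3 : ig (fun w => `|A w| * B w ^+ 2).
  have := ig3 (L3_abs LA) LB LB; congr ig; apply/funext => w; ring.
have H : N3 (fun w => A w + B w) ^+ 3 <=
   N3 A ^+ 3 + 3 * (N3 A * kappa ^+ 2) + kappa ^+ 3.
  rewrite N3X; apply: (@le_trans _ _ (Ex (fun w => `|A w| ^+ 3 +
    3 * (A w * `|A w| * B w) + 3 * (`|A w| * B w ^+ 2) + `|B w| ^+ 3))).
    apply: le_Ex; first by case: (L3D LA LB).
      apply: igD => //; apply: igD; last exact: igZ.
      by apply: igD => //; exact: igZ.
    by move=> w; exact: cube_le.
  have j2 : ig (fun w => `|A w| ^+ 3 + 3 * (A w * `|A w| * B w)).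
    by apply: igD => //; exact: igZ.
  have j3 : ig (fun w => `|A w| ^+ 3 + 3 * (A w * `|A w| * B w) +
     3 * (`|A w| * B w ^+ 2)).
    by apply: igD => //; exact: igZ.
  rewrite ExD// ExD//; last exact: igZ.
  rewrite ExD//; last exact: igZ.
  rewrite !ExZ// (@orth_mul (m + k)%N (fun w => A w * `|A w|))//; last first.
    by apply: GmM => //; apply: Gm_comp => //; exact: measurable_normr.
  rewrite mulr0 addr0 -!N3X.
  have NB : N3 B ^+ 3 <= kappa ^+ 3.
    by rewrite lerXn2r ?nnegrE ?N3_ge0//; exact: Dkappa.
  have h2 : Ex (fun w => `|A w| * B w ^+ 2) <= N3 A * kappa ^+ 2.
    apply: (@le_trans _ _ (N3 A * N3 B ^+ 2)).
      have := Ex3_le (L3_abs LA) LB LB; rewrite N3_abs -mulrA -expr2.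
      apply: le_trans; rewrite (eq_Ex (g := fun w => `|A w| * B w * B w)).
        exact: ler_norm.
      by move=> w; ring.
    rewrite ler_wpM2l ?N3_ge0// lerXn2r ?nnegrE ?N3_ge0//; exact: Dkappa.
  lra.
have sqk (n : nat) : Num.sqrt (n%:R : R) ^+ 2 = n%:R by rewrite sqr_sqrtr.
have step : N3 A ^+ 3 + 3 * (N3 A * kappa ^+ 2) + kappa ^+ 3 <=
    (2 * kappa * Num.sqrt k.+1%:R) ^+ 3.
  apply: (@le_trans _ _ (kappa ^+ 3 *
     ((2 * Num.sqrt k%:R) ^+ 3 + 3 * (2 * Num.sqrt k%:R) + 1))).
    have h1 : N3 A ^+ 3 <= (2 * kappa * Num.sqrt k%:R) ^+ 3.
      by rewrite lerXn2r ?nnegrE ?N3_ge0 ?mulr_ge0.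
    have h2 : N3 A * kappa ^+ 2 <= (2 * kappa * Num.sqrt k%:R) * kappa ^+ 2.
      by rewrite ler_wpM2r ?exprn_ge0.
    have -> : kappa ^+ 3 * ((2 * Num.sqrt k%:R) ^+ 3 + 3 * (2 * Num.sqrt k%:R) + 1)
      = (2 * kappa * Num.sqrt k%:R) ^+ 3 +
        3 * ((2 * kappa * Num.sqrt k%:R) * kappa ^+ 2) + kappa ^+ 3 by ring.
    by rewrite lerD2r lerD// ler_wpM2l.
  have -> : (2 * kappa * Num.sqrt k.+1%:R) ^+ 3 =
    kappa ^+ 3 * (2 * Num.sqrt k.+1%:R) ^+ 3 by ring.
  rewrite ler_wpM2l ?exprn_ge0//; apply: cube_step; rewrite ?sqrtr_ge0//.
  by rewrite !sqk -natr1.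
have := le_trans H step.
by rewrite ler_pXn2r// nnegrE ?N3_ge0// !mulr_ge0.
Qed.

Lemma N3_msum n : N3 (msum n) <= 2 * kappa * Num.sqrt n%:R.
Proof.
have := msum_incr 0 n; rewrite add0n (eq_N3 (g := msum n))// => w.
by rewrite msum0 subr0.
Qed.

Hypothesis s0 : 0 < s.
Hypothesis Dsqr : forall k, Ex (fun w => D k w ^+ 2) = s ^+ 2.

Definition qsum n w := \sum_(k < n) (D k w ^+ 2 - s ^+ 2).

Lemma qsumS n w : qsum n.+1 w = qsum n w + (D n w ^+ 2 - s ^+ 2).
Proof. by rewrite /qsum big_ord_recr. Qed.

Lemma ig_DU k : ig (fun w => D k w ^+ 2 - s ^+ 2).
Proof. by apply: igB; [exact: ig_sqr|exact: ig_cst]. Qed.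

Lemma qsum_ig n : ig (qsum n).
Proof. by apply: ig_sum => k _; exact: ig_DU. Qed.

Lemma Ex_qsum n : Ex (qsum n) = 0.
Proof.
rewrite Ex_sum => [|k _]; last exact: ig_DU.
rewrite big1// => k _; rewrite ExB ?Ex_cst ?Dsqr ?subrr//; first exact: ig_sqr.
exact: ig_cst.
Qed.

Lemma ig_MDU k Z : L3 Z -> ig (fun w => Z w * (D k w ^+ 2 - s ^+ 2)).
Proof.
move=> LZ.
have := igB (ig3 LZ (D3 k) (D3 k)) (igZr (s ^+ 2) (ig1 LZ)).
congr ig; apply/funext => w; ring.
Qed.

Lemma ig_Mqsum n Z : L3 Z -> ig (fun w => Z w * qsum n w).
Proof.
move=> LZ; rewrite (_ : (fun w => _) =
    (fun w => \sum_(k < n) Z w * (D k w ^+ 2 - s ^+ 2))).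
  by apply: ig_sum => k _; exact: ig_MDU.
by apply/funext => w; rewrite mulr_sumr.
Qed.

(* The third derivative of [g j] is bounded by [Gam j], and [g (i + j)] is the
   convolution of [g j] with N(0, i s^2). *)
Variables (g g' g'' : nat -> R -> R) (Gam u : nat -> R) (V : R).
Hypothesis dg : forall j x, (0 < j)%N -> is_derive x (1 : R) (g j) (g' j x).
Hypothesis dg' : forall j x, (0 < j)%N -> is_derive x (1 : R) (g' j) (g'' j x).
Hypothesis lip : forall j x y, (0 < j)%N ->
  `|g'' j x - g'' j y| <= Gam j * `|x - y|.
Hypothesis sgg : forall j, (0 < j)%N -> subgauss (g j).
Hypothesis sem : forall i j x, (0 < i)%N -> (0 < j)%N ->
  g (i + j) x = Q (Num.sqrt i%:R * s) (g j) x.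
Hypothesis Gam_ge0 : forall j, 0 <= Gam j.
Hypothesis Gam_le : forall i j, (0 < i <= j)%N -> Gam j <= Gam i.
Hypothesis u_ge0 : forall l, 0 <= u l.
(** The dual form of a bound [u l] on the L^(3/2) norm of E (qsum (m + 2^l) - qsum m | F_m). *)
Hypothesis blocks : forall m l Z, Gm (F m) Z -> L3 Z ->
  `|Ex (fun w => Z w * (qsum (m + 2 ^ l) w - qsum m w))| <= N3 Z * u l.
Hypothesis uV : forall L, \sum_(l < L) u l / Num.sqrt (2 ^ l)%:R <= V.

Let taylorg j x h : (0 < j)%N ->
  `|g j (x + h) - g j x - g' j x * h - g'' j x * h ^+ 2 / 2| <= Gam j * `|h| ^+ 3.
Proof.
move=> j0.
have := @taylor2 R (g j) (g' j) (g'' j) (Gam j) 1 ler01 (Gam_ge0 j)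
  (fun x => dg x j0) (fun x => dg' x j0) x _ h.
have -> : 1 + 2 = 3 :> R by ring.
rewrite powR_mulrn//; apply => y; rewrite powRr1//.
by have := lip (x + y) x j0; rewrite addrAC subrr add0r.
Qed.

Let g''_cont j : (0 < j)%N -> continuous (g'' j).
Proof.
move=> j0 x; apply/cvgrPdist_le => e e0; near=> y.
apply: le_trans (lip _ _ j0) _.
rewrite -[leRHS](@divfK _ (Gam j + 1)) ?gt_eqF ?ltr_pwDr//.
apply: (@le_trans _ _ ((Gam j + 1) * `|x - y|)).
  by rewrite ler_wpM2r// lerDl.
rewrite mulrC ler_wpM2r ?addr_ge0//.
near: y; apply: cvgr_dist_le; first exact: cvg_id.
by rewrite divr_gt0// ltr_pwDr.
Unshelve. all: by end_near. Qed.

Let g'_cont j : (0 < j)%N -> continuous (g' j).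
Proof. by move=> j0; apply: is_derive_continuous => x; exact: dg'. Qed.

Let g_cont j : (0 < j)%N -> continuous (g j).
Proof. by move=> j0; apply: is_derive_continuous => x; exact: dg. Qed.

Let g''M_L3 j k : (0 < j)%N -> L3 (fun w => g'' j (msum k w)).
Proof.
move=> j0; have LM := msum_L3 k.
apply: (proj1 (@L3_le _ _ _ _ _ (fun w => `|g'' j 0| + Gam j * `|msum k w|) _ _ _)).
- apply: (measurableT_comp (continuous_measurable_fun (g''_cont j0))).
  by case: LM.
- move=> w; rewrite [leRHS]ger0_norm; last by rewrite addr_ge0// mulr_ge0.
  have := lip (msum k w) 0 j0; rewrite subr0 => h.
  rewrite -[X in `|X|](subrK (g'' j 0)) addrC.
  by rewrite (le_trans (ler_normD _ _))// lerD2l.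
- by apply: L3D; [exact: L3_cst|exact/L3Z/L3_abs].
Qed.

Let ig_cubic k (phi : R -> R) (a b c e : R) : continuous phi ->
  (forall x, `|phi x| <= a + b * `|x| + c * `|x| ^+ 2 + e * `|x| ^+ 3) ->
  ig (fun w => phi (msum k w)).
Proof.
move=> cphi hphi; have LM := msum_L3 k.
apply: (ig_le (g := fun w => a + b * `|msum k w| + c * `|msum k w| ^+ 2 +
  e * `|msum k w| ^+ 3)).
- apply: (measurableT_comp (continuous_measurable_fun cphi)); by case: LM.
- by move=> w; exact: hphi.
apply: igD; last by apply: igZ; case: LM.
apply: igD; last by apply: igZ; exact: ig_sqr (L3_abs LM).
apply: igD; first exact: ig_cst.
by apply: igZ; exact: ig1 (L3_abs LM).
Qed.

Let gM_ig j k : (0 < j)%N -> ig (fun w => g j (msum k w)).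
Proof.
move=> j0; apply: (@ig_cubic k (g j) (`|g j 0|) (`|g' j 0|) (`|g'' j 0|) (Gam j)).
  exact: g_cont.
move=> x; have := taylorg 0 x j0; rewrite add0r => h.
have -> : g j x = (g j x - g j 0 - g' j 0 * x - g'' j 0 * x ^+ 2 / 2) +
   (g j 0 + g' j 0 * x + g'' j 0 * x ^+ 2 / 2) by ring.
apply: le_trans (ler_normD _ _) _; rewrite addrC lerD//.
apply: le_trans (ler_normD _ _) _; rewrite lerD//.
  by apply: le_trans (ler_normD _ _) _; rewrite lerD// normrM.
rewrite normrM [`|_ * _ ^+ 2|]normrM normrX ler_piMr ?mulr_ge0 ?exprn_ge0//.
by rewrite ger0_norm// invf_le1// ler1n.
Qed.

Let g'MD_ig j k : (0 < j)%N -> ig (fun w => g' j (msum k w) * D k w).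
Proof.
move=> j0; have LM := L3_abs (msum_L3 k).
apply: (ig_le (g := fun w => `|g' j 0| * `|D k w| +
  `|g'' j 0| * (`|msum k w| * `|D k w|) +
  Gam j * (`|msum k w| * `|msum k w| * `|D k w|))).
- apply: measurable_funM; last by case: (D3 k).
  apply: (measurableT_comp (continuous_measurable_fun (g'_cont j0))).
  by case: (msum_L3 k).
- move=> w; set x := msum k w; rewrite normrM.
  rewrite !mulrA -!mulrDl ler_wpM2r//.
  have := @taylor1 R (g' j) (g'' j) (Gam j) 1 ler01 (Gam_ge0 j)
    (fun x => dg' x j0) 0 _ x.
  have -> : 1 + 1 = 2 :> R by ring.
  rewrite add0r powR_mulrn// => h.
  have -> : g' j x = (g' j x - g' j 0 - g'' j 0 * x) + (g' j 0 + g'' j 0 * x).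
    by ring.
  rewrite (le_trans (ler_normD _ _))// addrC lerD//.
    by rewrite (le_trans (ler_normD _ _))// normrM.
  rewrite -mulrA -expr2; apply: h => y; rewrite powRr1//.
  by have := lip (0 + y) 0 j0; rewrite addrAC subrr add0r.
have LD := L3_abs (D3 k).
apply: igD; last by apply: igZ; exact: ig3.
by apply: igD; apply: igZ; [exact: ig1|exact: ig2].
Qed.

Let g''MD_ig j k : (0 < j)%N -> ig (fun w => g'' j (msum k w) * D k w ^+ 2).
Proof.
move=> j0; have := ig3 (g''M_L3 k j0) (D3 k) (D3 k).
by congr ig; apply/funext => w; rewrite expr2 mulrA.
Qed.

(** The Gaussian twin of a Lindeberg step: the Taylor expansion of [g j] is averaged over an N(0,
    s^2) increment, whose mean is 0 and whose variance is [s ^+ 2]. *)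
Let semT j x : (0 < j)%N ->
  `|g j.+1 x - g j x - g'' j x * s ^+ 2 / 2| <= Gam j * (s ^+ 3 * gam_abs3).
Proof.
move=> j0; have sj := subgauss_affine x s (sgg j0).
have i1 := subgauss_ig sj.
have i2 : igg (fun y => g' j x * (s * y)).
  by apply/subgauss_ig/subgaussZ/subgaussZ/subgauss_id.
have i3 : igg (fun y => g'' j x * (s * y) ^+ 2 / 2).
  apply: igZr; apply/subgauss_ig/subgaussZ/subgaussX/subgaussZ/subgauss_id.
have -> : g j.+1 x - g j x - g'' j x * s ^+ 2 / 2 = Exg (fun y =>
    g j (x + s * y) - g j x - g' j x * (s * y) - g'' j x * (s * y) ^+ 2 / 2).
  have c1 : igg (fun=> g j x) by exact: ig_cst.
  have b1 : igg (fun y => g j (x + s * y) - g j x) by exact: igB.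
  have b2 : igg (fun y => g j (x + s * y) - g j x - g' j x * (s * y)).
    exact: igB.
  rewrite ExB// ExB// ExB// Ex_cst.
  have -> : Exg (fun y => g' j x * (s * y)) = 0.
    transitivity (Exg (fun y => (g' j x * s) * y)).
      by apply: eq_Ex => y; rewrite mulrA.
    by rewrite ExZ ?Ex_gam_id ?mulr0//; exact: subgauss_ig (subgauss_id R).
  have -> : Exg (fun y => g'' j x * (s * y) ^+ 2 / 2) = g'' j x * s ^+ 2 / 2.
    transitivity (Exg (fun y => (g'' j x * s ^+ 2 / 2) * y ^+ 2)).
      by apply: eq_Ex => y; ring.
    rewrite ExZ ?Ex_gam_sqr ?mulr1//.
    exact: subgauss_ig (subgaussX 2 (subgauss_id R)).
  by rewrite subr0 -[j.+1]add1n sem// sqrtr1 mul1r.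
rewrite /gam_abs3 -ExZ; last exact: ig_gam.
rewrite -ExZ; last by apply: igZ; exact: ig_gam.
apply: Ex_abs_le.
- apply: igB => //; apply: igB => //; apply: igB => //; exact: ig_cst.
- by apply: igZ; apply: igZ; exact: ig_gam.
move=> y; apply: le_trans (taylorg _ _ j0) _.
by rewrite normrM exprMn (gtr0_norm s0).
Qed.

Let second_diff j x e : (0 < j)%N -> 0 < e ->
  `|g j (x + e) + g j (x - e) - 2 * g j x - g'' j x * e ^+ 2| <=
  2 * Gam j * e ^+ 3.
Proof.
move=> j0 e0; have h1 := taylorg x e j0; have h2 := taylorg x (- e) j0.
have -> : g j (x + e) + g j (x - e) - 2 * g j x - g'' j x * e ^+ 2 =
   (g j (x + e) - g j x - g' j x * e - g'' j x * e ^+ 2 / 2) +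
   (g j (x - e) - g j x - g' j x * (- e) - g'' j x * (- e) ^+ 2 / 2) by field.
apply: le_trans (ler_normD _ _) _.
rewrite normrN (gtr0_norm e0) in h2; rewrite (gtr0_norm e0) in h1.
by have := lerD h1 h2; lra.
Qed.

(* [g (i + j)] is an average of translates of [g j], hence so are its second
   differences, which approximate [g'']. *)
Let g''_sup i j x : (0 < i)%N -> (0 < j)%N ->
  `|g'' (i + j) x - g'' j x| <= Gam j * (Num.sqrt i%:R * s * gam_abs1).
Proof.
move=> i0 j0; have ij0 : (0 < i + j)%N by rewrite addn_gt0 i0.
set t := Num.sqrt i%:R * s.
have t0 : 0 < t by rewrite mulr_gt0// sqrtr_gt0 ltr0n.
set B := Gam j * _.
(* Second differences of step [e] stand for [g''], since the convolution identity is known for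
   values of [g] only. Their error is O(e^3), so dividing by e^2 and letting [e] tend to 0 recovers
   [g'']. *)
have key e : 0 < e ->
    e ^+ 2 * `|g'' (i + j) x - g'' j x| <=
    e ^+ 2 * (B + (2 * Gam j + 2 * Gam (i + j)) * e).
  move=> e0.
  pose del f (z : R) : R := f (z + e) + f (z - e) - 2 * f z.
  have sd f z : subgauss f -> igg (fun y => del f (z + t * y)).
    move=> sf; apply: subgauss_ig; apply: subgaussB.
      apply: subgaussD.
        have := subgauss_affine (z + e) t sf; congr subgauss.
        by apply/funext => y; rewrite addrAC.
      have := subgauss_affine (z - e) t sf; congr subgauss.
      by apply/funext => y; rewrite addrAC.
    exact/subgaussZ/subgauss_affine.
  have dE : del (g (i + j)) x = Exg (fun y => del (g j) (x + t * y)).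
    have s1 z : igg (fun y => g j (z + t * y)).
      by apply/subgauss_ig/subgauss_affine; exact: sgg.
    have s2 z : igg (fun y => g j (x + t * y + z)).
      have := s1 (x + z); congr (igg _); apply/funext => y; by rewrite addrAC.
    rewrite /del ExB; [|apply: igD => //|apply: igZ => //].
    rewrite ExD// ExZ// !sem// /Q -/t.
    by congr (_ + _ - _); apply: eq_Ex => y; rewrite addrAC.
  have h1 := second_diff x ij0 e0; rewrite -/(del (g (i + j)) x) in h1.
  have h2 : `|del (g (i + j)) x - g'' j x * e ^+ 2| <=
      e ^+ 2 * B + 2 * Gam j * e ^+ 3.
    rewrite dE -[X in _ - X](Ex_cst gam) -ExB; [|exact/sd/sgg|exact: ig_cst].
    have -> : e ^+ 2 * B + 2 * Gam j * e ^+ 3 = Exg (fun y =>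
        e ^+ 2 * Gam j * t * `|y| + 2 * Gam j * e ^+ 3).
      have ia : igg (fun y => `|y|) by exact: (ig_gam _ 1).
      rewrite ExD ?Ex_cst ?ExZ//; [|exact: igZ|exact: ig_cst].
      by rewrite /B /gam_abs1; ring.
    have ia : igg (fun y => `|y|) by exact: (ig_gam _ 1).
    apply: Ex_abs_le; [apply: igB; [exact/sd/sgg|exact: ig_cst]| |].
      by apply: igD; [exact: igZ|exact: ig_cst].
    move=> y; have := second_diff (x + t * y) j0 e0.
    have := lip (x + t * y) x j0; rewrite [x + _]addrC addrK [_ + x]addrC.
    rewrite normrM (gtr0_norm t0) => l1 l2.
    have -> : del (g j) (x + t * y) - g'' j x * e ^+ 2 =
      e ^+ 2 * (g'' j (x + t * y) - g'' j x) +
      (del (g j) (x + t * y) - g'' j (x + t * y) * e ^+ 2) by ring.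
    apply: le_trans (ler_normD _ _) _; rewrite lerD// normrM.
    rewrite (ger0_norm (sqr_ge0 e)).
    have -> : e ^+ 2 * Gam j * t * `|y| = e ^+ 2 * (Gam j * (t * `|y|)) by ring.
    by rewrite ler_wpM2l ?sqr_ge0.
  have -> : e ^+ 2 * `|g'' (i + j) x - g'' j x| =
     `|(del (g (i + j)) x - g'' j x * e ^+ 2) -
       (del (g (i + j)) x - g'' (i + j) x * e ^+ 2)|.
    rewrite -[X in X * _]ger0_norm ?exprn_ge0 ?(ltW e0)// -normrM.
    by congr (`|_|); ring.
  apply: le_trans (ler_normB _ _) _.
  apply: le_trans (lerD h2 h1) _.
  by rewrite le_eqVlt; apply/orP; left; apply/eqP; ring.
apply/ler_addgt0Pl => e e0; rewrite [leRHS]addrC.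
set c := 2 * Gam j + 2 * Gam (i + j).
have c0 : 0 <= c by rewrite addr_ge0// mulr_ge0.
have e'0 : 0 < e / (c + 1) by rewrite divr_gt0// ltr_pwDr.
have := key _ e'0; rewrite ler_pM2l ?exprn_gt0// => /le_trans; apply.
rewrite lerD2l -/c mulrA ler_pdivrMr ?ltr_pwDr// mulrC ler_wpM2l ?(ltW e0)//.
by rewrite lerDl.
Qed.

(** Trading the increment [D k] for one Gaussian step: the first order term is killed by [Dorth],
    the third order one is paid with [Gam j], and the second order one is kept for [dyadic]. *)
Let lindeberg_step k j : (0 < j)%N ->
  `|Ex (fun w => g j (msum k.+1 w)) - Ex (fun w => g j.+1 (msum k w)) -
    Ex (fun w => g'' j (msum k w) * (D k w ^+ 2 - s ^+ 2)) / 2| <=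
  Gam j * (kappa ^+ 3 + s ^+ 3 * gam_abs3).
Proof.
move=> j0.
have i1 := gM_ig k.+1 j0.
have i2 := gM_ig k (ltn0Sn j).
have i3 := ig_MDU k (g''M_L3 k j0).
have i4 := g'MD_ig k j0.
have z4 : Ex (fun w => g' j (msum k w) * D k w) = 0.
  apply: (@orth_mul k (fun w => g' j (msum k w))) => //.
  apply: (Gm_comp (sF k)); last exact: msum_Gm.
  exact: continuous_measurable_fun (g'_cont j0).
rewrite -[X in `|X|]subr0 -z4 -ExZr// -!ExB//; last 3 first.
- by apply: igB; [exact: igB|exact: igZr].
- exact: igB.
- exact: igZr.
apply: (@le_trans _ _ (Ex (fun w => Gam j * `|D k w| ^+ 3 +
   Gam j * (s ^+ 3 * gam_abs3)))).
  apply: Ex_abs_le.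
  - by apply: igB => //; apply: igB; [exact: igB|exact: igZr].
  - by apply: igD; [apply: igZ; case: (D3 k)|exact: ig_cst].
  move=> w; rewrite msumS.
  have h1 := taylorg (msum k w) (D k w) j0.
  have h2 := semT (msum k w) j0.
  set x := msum k w in h1 h2 *; set y := D k w in h1 *.
  have -> : g j (x + y) - g j.+1 x - g'' j x * (y ^+ 2 - s ^+ 2) / 2 - g' j x * y =
    (g j (x + y) - g j x - g' j x * y - g'' j x * y ^+ 2 / 2) -
    (g j.+1 x - g j x - g'' j x * s ^+ 2 / 2) by field.
  by apply: le_trans (ler_normB _ _) _; exact: lerD.
rewrite ExD ?Ex_cst; last 2 first.
- by apply: igZ; case: (D3 k).
- exact: ig_cst.
rewrite ExZ; last by case: (D3 k).
rewrite -mulrDr ler_wpM2l// lerD2r -N3X lerXn2r ?nnegrE ?N3_ge0//.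
exact: kappa_ge0.
Qed.

Let H n k w := g'' (n - k) (msum k w).

Let C : R := 2 * kappa + s * gam_abs1.

Let C_ge0 : 0 <= C.
Proof.
by rewrite addr_ge0// mulr_ge0// ?kappa_ge0 ?gam_abs1_ge0// ltW.
Qed.

(** Two changes add up here, [i] martingale increments in the argument and [i] Gaussian steps in the
    smoothing level; both have size sqrt i. *)
Let H_incr m i j : (0 < i)%N -> (0 < j)%N ->
  N3 (fun w => g'' j (msum (m + i) w) - g'' (i + j) (msum m w)) <=
  Gam j * (C * Num.sqrt i%:R).
Proof.
move=> i0 j0; have ij0 : (0 < i + j)%N by rewrite addn_gt0 i0.
have LM := msum_incr_L3 m i.
set b := Gam j * (Num.sqrt i%:R * s * gam_abs1).
have b0 : 0 <= b by rewrite !mulr_ge0// ?gam_abs1_ge0// ltW.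
pose h w := Gam j * `|msum (m + i) w - msum m w| + b.
have Lh : L3 h by apply: L3D; [exact/L3Z/L3_abs|exact: L3_cst].
apply: le_trans (proj2 (@L3_le _ _ _ _ _ h _ _ Lh)) _.
- by apply: measurable_funB;
    [case: (g''M_L3 (m + i) j0)|case: (g''M_L3 m ij0)].
- move=> w; rewrite [leRHS]ger0_norm; last by rewrite addr_ge0// mulr_ge0.
  rewrite -[X in `|X|](subrKA (g'' j (msum m w))).
  rewrite (le_trans (ler_normD _ _))// lerD ?lip//.
  by rewrite distrC; exact: g''_sup.
apply: le_trans (N3D (L3Z _ (L3_abs LM)) (L3_cst P b)) _.
rewrite N3Z; last exact: L3_abs.
rewrite N3_cst !ger0_norm// (N3_abs P (fun w => msum (m + i) w - msum m w)).
apply: (@le_trans _ _ (Gam j * (2 * kappa * Num.sqrt i%:R) + b)).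
  by rewrite lerD2r ler_wpM2l// msum_incr.
by rewrite /b /C le_eqVlt; apply/orP; left; apply/eqP; ring.
Qed.

Let GG a N := \sum_(0 <= i < N) Gam (a + i).+1.

Let GG_ge0 a N : 0 <= GG a N.
Proof. by apply: sumr_ge0 => i _. Qed.

(* Blocks are counted backwards from [n], so that every block whose conditional
   mean is used is a complete one. *)
Let dyadic n L a : (0 < n)%N ->
  `|\sum_(n - (a + 2 ^ L) <= k < n - a)
      Ex (fun w => H n k w * (D k w ^+ 2 - s ^+ 2)) -
    Ex (fun w => H n (n - (a + 2 ^ L)) w *
      (qsum (n - a) w - qsum (n - (a + 2 ^ L)) w))| <=
  C * (\sum_(l < L) u l / Num.sqrt (2 ^ l)%:R) * GG a (2 ^ L).
Proof.
move=> n0.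
have HL m : (m < n)%N -> L3 (H n m).
  by move=> mn; apply: g''M_L3; rewrite subn_gt0.
elim: L a => [|L IH] a.
  rewrite big_ord0 mulr0 mul0r normr_le0; apply/eqP.
  (* With truncated subtraction the block is empty when [n <= a], and both terms are 0; otherwise it
     is a single index and the two terms agree. *)
  rewrite expn0 addn1; have [na|an] := leqP n a.
    have -> : (n - a = 0)%N by apply/eqP; rewrite subn_eq0.
    have -> : (n - a.+1 = 0)%N by apply/eqP; rewrite subn_eq0 leqW.
    rewrite big_geq// sub0r (eq_Ex (g := fun=> 0)) ?Ex_cst ?oppr0//.
    by move=> w; rewrite subrr mulr0.
  rewrite -(subnSK an) big_nat1.
  apply/eqP; rewrite subr_eq0; apply/eqP; apply: eq_Ex => w.
  by rewrite qsumS; ring.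
have e2 : (2 ^ L.+1 = 2 ^ L + 2 ^ L)%N by rewrite expnS mul2n addnn.
have twoL : (0 < 2 ^ L)%N by rewrite expn_gt0.
have GE : GG a (2 ^ L.+1) = GG a (2 ^ L) + GG (a + 2 ^ L) (2 ^ L).
  rewrite /GG e2 (big_cat_nat (n := 2 ^ L)) ?leq_addr//=; congr (_ + _).
  rewrite -{1}[(2 ^ L)%N]add0n big_addn addnK.
  by apply: eq_bigr => i _; rewrite -addnA (addnC i).
set e := (n - a)%N; set mid := (n - (a + 2 ^ L))%N.
have -> : (n - (a + 2 ^ L.+1) = n - (a + 2 ^ L + 2 ^ L))%N by rewrite e2 addnA.
set st := (n - (a + 2 ^ L + 2 ^ L))%N.
have IH1 := IH a; have IH2 := IH (a + 2 ^ L)%N.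
rewrite -/e -/mid -/st in IH1 IH2 *.
have sm : (st <= mid)%N by rewrite leq_sub2l// leq_addr.
have me : (mid <= e)%N by rewrite leq_sub2l// leq_addr.
have midn : (mid < n)%N.
  by rewrite -[ltnRHS]subn0 ltn_sub2l// addn_gt0 twoL orbT.
have stn : (st < n)%N by exact: leq_ltn_trans sm midn.
have iq k p r : (k < n)%N -> ig (fun w => H n k w * (qsum p w - qsum r w)).
  move=> kn; have := igB (ig_Mqsum p (HL k kn)) (ig_Mqsum r (HL k kn)).
  by congr ig; apply/funext => w; rewrite mulrBr.
rewrite (big_cat_nat (n := mid))//=.
set S1 := \sum_(st <= k < mid) _ in IH2 *.
set S2 := \sum_(mid <= k < e) _ in IH1 *.
set E1 := Ex _ in IH1; set E2 := Ex _ in IH2.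
(* [E3] is the price for freezing the weight of the later half at [st] instead of at its own start
   [mid]. *)
pose E3 := Ex (fun w => (H n mid w - H n st w) * (qsum e w - qsum mid w)).
have -> : Ex (fun w => H n st w * (qsum e w - qsum st w)) = E1 + E2 - E3.
  rewrite /E3 (eq_Ex (f := fun w => (H n mid w - H n st w) * _)
     (g := fun w => H n mid w * (qsum e w - qsum mid w) -
       H n st w * (qsum e w - qsum mid w))); last by move=> w; rewrite mulrBl.
  rewrite ExB; [|exact: iq|exact: iq].
  have -> : Ex (fun w => H n st w * (qsum e w - qsum st w)) =
     E2 + Ex (fun w => H n st w * (qsum e w - qsum mid w)).
    rewrite /E2 -ExD; [|exact: iq|exact: iq].
    by apply: eq_Ex => w; ring.
  by rewrite /E1; ring.
have B3 : `|E3| <= C * (u L / Num.sqrt (2 ^ L)%:R) * GG a (2 ^ L).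
  (* If [mid = 0] both weights coincide. Otherwise the later half, from [mid] to [e], has length
     exactly [2 ^ L], so [blocks] applies; only the earlier half can be cut short by 0. *)
  have [mid0|mid0] := posnP mid.
    have st0 : st = 0%N by apply/eqP; rewrite -leqn0 -mid0.
    rewrite /E3 (eq_Ex (g := fun=> 0)) ?Ex_cst ?normr0; last first.
      by move=> w; rewrite mid0 st0 subrr mul0r.
    by rewrite !mulr_ge0// invr_ge0.
  have an : (a + 2 ^ L < n)%N by rewrite -subn_gt0.
  have eE : e = (mid + 2 ^ L)%N.
    by rewrite /mid subnDA subnK// leq_subRL ?(leq_trans _ (ltnW an)) ?leq_addr// ltnW.
  have stm : (0 < mid - st)%N.
    by rewrite subn_gt0 /st subnDA -/mid -[ltnRHS]subn0 ltn_sub2l.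
  have mstL : (mid - st <= 2 ^ L)%N.
    by rewrite /st subnDA -/mid; lia.
  rewrite /E3 eE; apply: le_trans (blocks _ _ _) _.
  - apply: GmB => //.
      apply: (Gm_comp (sF mid)) (msum_Gm mid).
      by apply: continuous_measurable_fun; apply: g''_cont; rewrite subn_gt0.
    apply: Gm_le sm _; apply: (Gm_comp (sF st)) (msum_Gm st).
    by apply: continuous_measurable_fun; apply: g''_cont; rewrite subn_gt0.
  - by apply: L3B; exact: HL.
  have nm : (n - mid = a + 2 ^ L)%N by rewrite subKn// ltnW.
  have := @H_incr st (mid - st)%N (a + 2 ^ L)%N stm _.
  rewrite addn_gt0 twoL orbT => /(_ isT).
  have -> : (st + (mid - st) = mid)%N by rewrite subnKC.
  have -> : (mid - st + (a + 2 ^ L) = n - st)%N by lia.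
  rewrite -{1}nm => hN.
  apply: le_trans (ler_wpM2r (u_ge0 L) hN) _.
  have q0 : 0 < Num.sqrt ((2 ^ L)%:R : R) by rewrite sqrtr_gt0 ltr0n.
  apply: (@le_trans _ _ (Gam (a + 2 ^ L) * (C * Num.sqrt (2 ^ L)%:R) * u L)).
    rewrite ler_wpM2r// ler_wpM2l// ler_wpM2l// ler_wsqrtr// ler_nat//.
  (* [Gam] is nonincreasing, so its last value on the block, times the length, is at most the sum.
     Thus each level of the recursion costs at most one full sum of [Gam]. *)
  have hG : (2 ^ L)%:R * Gam (a + 2 ^ L) <= GG a (2 ^ L).
    rewrite /GG mulr_natl -[X in Gam _ *+ X]subn0 -sumr_const_nat.
    apply: ler_sum_nat => i /andP[_ iL]; apply: Gam_le.
    by rewrite ltn0Sn/= ltn_add2l.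
  have q2 : Num.sqrt ((2 ^ L)%:R : R) ^+ 2 = (2 ^ L)%:R by rewrite sqr_sqrtr.
  apply: le_trans (ler_wpM2l _ hG); last by rewrite !mulr_ge0// invr_ge0 ltW.
  move: q0 q2; set q := Num.sqrt _ => q0 q2.
  rewrite -q2 le_eqVlt; apply/orP; left; apply/eqP.
  by field; rewrite gt_eqF.
have -> : S1 + S2 - (E1 + E2 - E3) = (S2 - E1) + (S1 - E2) + E3 by ring.
apply: le_trans (ler_normD _ _) _.
apply: le_trans (lerD (ler_normD _ _) B3) _.
apply: le_trans (lerD (lerD IH1 IH2) (lexx _)) _.
rewrite GE big_ord_recr /=.
set w := \sum_(l < L) _; set v := u L / _; set G1 := GG a _; set G2 := GG _ _.
have v0 : 0 <= v by apply: divr_ge0 => //; exact: sqrtr_ge0.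
have : 0 <= C * v * G2 by apply: mulr_ge0; [exact: mulr_ge0|exact: GG_ge0].
lra.
Qed.

Theorem lindeberg n L : (0 < n <= 2 ^ L)%N ->
  `|Ex (fun w => g 1 (msum n w)) - g n.+1 0| <=
  (C * V + kappa ^+ 3 + s ^+ 3 * gam_abs3) * \sum_(0 <= i < 2 ^ L) Gam i.+1.
Proof.
move=> /andP[n0 nL].
(* The interpolation keeps one extra Gaussian step, [(n - k).+1], because [g 0] carries no smoothing
   and has no derivatives to use. *)
pose f k := Ex (fun w => g (n - k).+1 (msum k w)).
have f0 : f 0 = g n.+1 0.
  rewrite /f subn0 (eq_Ex (g := fun=> g n.+1 0)) ?Ex_cst//.
  by move=> w; rewrite msum0.
have fn : f n = Ex (fun w => g 1 (msum n w)) by rewrite /f subnn.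
rewrite -f0 -fn -telescope_sumr//.
pose e k := f k.+1 - f k - Ex (fun w => H n k w * (D k w ^+ 2 - s ^+ 2)) / 2.
have eB k : (k < n)%N -> `|e k| <= Gam (n - k) * (kappa ^+ 3 + s ^+ 3 * gam_abs3).
  move=> kn; rewrite /e /f subnSK//; apply: lindeberg_step.
  by rewrite subn_gt0.
have GE : \sum_(0 <= i < 2 ^ L) Gam i.+1 = GG 0 (2 ^ L) by [].
have main : `|\sum_(0 <= k < n) Ex (fun w => H n k w * (D k w ^+ 2 - s ^+ 2))| <=
    C * V * GG 0 (2 ^ L).
  have := dyadic L 0 n0; rewrite add0n subn0.
  have -> : (n - 2 ^ L = 0)%N by apply/eqP; rewrite subn_eq0.
  rewrite (eq_Ex (g := fun w => g'' n 0 * qsum n w)); last first.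
    by move=> w; rewrite /H subn0 msum0 /qsum big_ord0 subr0.
  rewrite ExZ; last exact: qsum_ig.
  rewrite Ex_qsum mulr0 subr0 => /le_trans; apply.
  by rewrite ler_wpM2r// ler_wpM2l.
have -> : \sum_(0 <= k < n) (f k.+1 - f k) =
    (\sum_(0 <= k < n) Ex (fun w => H n k w * (D k w ^+ 2 - s ^+ 2))) / 2 +
    \sum_(0 <= k < n) e k.
  rewrite mulr_suml -big_split/=; apply: eq_bigr => k _.
  by rewrite /e; ring.
apply: le_trans (ler_normD _ _) _.
have he : `|\sum_(0 <= k < n) e k| <=
    GG 0 (2 ^ L) * (kappa ^+ 3 + s ^+ 3 * gam_abs3).
  apply: le_trans (ler_norm_sum _ _ _) _.
  apply: (@le_trans _ _ (\sum_(0 <= k < n) Gam (n - k) *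
     (kappa ^+ 3 + s ^+ 3 * gam_abs3))).
    by apply: ler_sum_nat => k /andP[_ kn]; exact: eB.
  rewrite -mulr_suml ler_wpM2r//.
    by rewrite addr_ge0 ?exprn_ge0 ?kappa_ge0// mulr_ge0 ?gam_abs3_ge0//
      exprn_ge0 ?(ltW s0).
  rewrite big_nat_rev/= add0n /GG [leRHS](big_cat_nat (n := n))//=.
  rewrite (eq_big_nat _ _ (F2 := fun i => Gam (0 + i).+1)).
    by rewrite lerDl sumr_ge0.
  by move=> i /andP[_ i_n]; rewrite subKn.
rewrite GE; move: main he; rewrite normrM (ger0_norm (_ : 0 <= 2^-1))//.
set X := `|_|; set Y := `|_|; set G := GG _ _ => main he.
have X0 : 0 <= X by exact: normr_ge0.
lra.
Qed.

End MartingaleSums.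
(** * Dyadic sums *)

Section DyadicSums.
Context (R : realType).

(* Abel summation: with [G l] the inner sum, the potential
   [\sum_(l < L) rho ^ l G l + 2 rho ^ L G L] grows by at most
   [rho ^ L (G (L + 1) - G L)]. *)
Lemma dyadic_sum (rho : R) (e w : nat -> R) L :
  1 / 4 <= rho <= 1 / 2 -> (forall m, 0 <= e m) ->
  (forall l m, (0 < m <= 2 ^ l)%N -> rho ^+ l <= w m) ->
  \sum_(l < L) rho ^+ l * (\sum_(1 <= m < (2 ^ l).+1) e m) <=
  4 * \sum_(1 <= m < (2 ^ L).+1) e m * w m.
Proof.
move=> /andP[r4 r2] e0 rw.
have rL (l : nat) : 0 <= rho ^+ l by apply: exprn_ge0; lra.
pose G l := \sum_(1 <= m < (2 ^ l).+1) e m.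
have G0 l : 0 <= G l by apply: sumr_ge0.
suff : \sum_(l < L) rho ^+ l * G l + 2 * rho ^+ L * G L <=
    4 * \sum_(1 <= m < (2 ^ L).+1) e m * w m.
  by apply: le_trans; rewrite lerDl mulr_ge0// mulr_ge0.
elim: L => [|L IH].
  rewrite big_ord0 add0r expr0 mulr1 /G expn0 !big_nat1.
  have := rw 0 1%N isT; rewrite expr0 => h.
  have : e 1%N * 1 <= e 1%N * w 1%N by exact: ler_wpM2l.
  have := e0 1%N; lra.
have lt2 : ((2 ^ L).+1 <= (2 ^ L.+1).+1)%N by rewrite ltnS leq_exp2l.
have cut (f : nat -> R) : \sum_(1 <= m < (2 ^ L.+1).+1) f m =
    \sum_(1 <= m < (2 ^ L).+1) f m + \sum_((2 ^ L).+1 <= m < (2 ^ L.+1).+1) f m.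
  by rewrite (big_cat_nat _ lt2).
rewrite big_ord_recr/= (cut (fun m => e m * w m)) mulrDr.
set H := \sum_((2 ^ L).+1 <= m < (2 ^ L.+1).+1) e m.
have GS : G L.+1 = G L + H by rewrite /G cut.
have H0 : 0 <= H by apply: sumr_ge0.
(* [1 / 4 <= rho] is used here, to pass from [rho ^+ L] to [rho ^+ L.+1]; [rho <= 1 / 2] serves
   below, to absorb the potential of the next level. *)
have hH : rho ^+ L * H <= 4 * \sum_((2 ^ L).+1 <= m < (2 ^ L.+1).+1) e m * w m.
  rewrite /H !mulr_sumr; apply: ler_sum_nat => m /andP[m1 m2].
  have := rw L.+1 m; rewrite (leq_ltn_trans _ m1)//= -ltnS m2 => /(_ isT) h.
  have : e m * rho ^+ L.+1 <= e m * w m by exact: ler_wpM2l.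
  have : 0 <= e m * rho ^+ L * (rho - 1 / 4).
    by rewrite mulr_ge0 ?mulr_ge0// subr_ge0.
  rewrite exprS; lra.
have : 2 * rho ^+ L.+1 * G L.+1 <= rho ^+ L * G L.+1.
  apply: ler_wpM2r => //; rewrite exprS mulrA ler_piMl//; lra.
rewrite GS -/(G L); lra.
Qed.

Lemma sum_half (h : nat -> R) L : (forall l, 0 <= h l) ->
  \sum_(l < L) h l./2 <= 2 * \sum_(l < L) h l.
Proof.
move=> h0.
have E J : \sum_(l < J.*2) h l./2 = 2 * \sum_(l < J) h l.
  elim: J => [|J IH]; first by rewrite !big_ord0 mulr0.
  rewrite doubleS !big_ord_recr/= IH uphalf_double doubleK; ring.
rewrite -E -!(big_mkord xpredT (fun l => h l./2)).
have L2 : (L <= L.*2)%N by rewrite -addnn leq_addr.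
by rewrite (big_cat_nat _ L2)//= lerDl sumr_ge0.
Qed.

Lemma geometric_sum_le (theta : R) L : 0 <= theta < 1 ->
  \sum_(l < L) theta ^+ l <= (1 - theta)^-1.
Proof.
move=> /andP[t0 t1]; have t' : 0 < 1 - theta by lra.
rewrite -[leRHS]mul1r ler_pdivlMr// mulr_suml.
have : 0 <= theta ^+ L by exact: exprn_ge0.
suff -> : \sum_(l < L) theta ^+ l * (1 - theta) = 1 - theta ^+ L by lra.
elim: L => [|L IH]; first by rewrite big_ord0 expr0 subrr.
by rewrite big_ord_recr/= IH exprS; ring.
Qed.

Lemma le_average (X a : R) (f : nat -> R) n : (0 < n)%N ->
  (forall i, (0 < i <= n)%N -> X <= a + f i) ->
  X <= a + n%:R^-1 * \sum_(1 <= i < n.+1) f i.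
Proof.
move=> n0 h; have n0' : 0 < (n%:R : R) by rewrite ltr0n.
rewrite -lerBlDl -(ler_pM2l n0') mulrA divff ?mul1r ?gt_eqF//.
rewrite (_ : n%:R * _ = \sum_(1 <= i < n.+1) (X - a)).
  by apply: ler_sum_nat => i; rewrite ltnS => /h; rewrite -lerBlDl.
by rewrite sumr_const_nat subn1/= mulr_natl.
Qed.

Lemma sqrt2X l : Num.sqrt (2 ^ l)%:R = Num.sqrt (2 : R) ^+ l.
Proof.
elim: l => [|l IH]; first by rewrite sqrtr1.
by rewrite expnS natrM sqrtrM// IH exprS.
Qed.

(** With blocks of length 2^l and lags up to 2^(l/2), the three terms become a geometric series of
    ratio [theta] = 2^(-1/4), a dyadic sum of ratio 1/2 in the variable l/2, and one of ratio
    2^(-3/2), which matches the weight 1 / (m sqrt m). *)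
Lemma block_weights (K SE SW : R) (e w : nat -> R) L :
  0 <= K -> (forall m, 0 <= e m) -> (forall m, 0 <= w m) ->
  (forall N, \sum_(1 <= m < N) e m * m%:R^-1 <= SE) ->
  (forall N, \sum_(1 <= m < N) w m * (m%:R * Num.sqrt m%:R)^-1 <= SW) ->
  \sum_(l < L) (64 * K ^+ 2 * (1 + Num.sqrt (2 ^ l./2)%:R) +
     16 * K * Num.sqrt (2 ^ l)%:R * ((2 ^ l./2)%:R^-1 * \sum_(1 <= m < (2 ^ l./2).+1) e m) +
     2 * ((2 ^ l)%:R^-1 * \sum_(1 <= m < (2 ^ l).+1) w m)) / Num.sqrt (2 ^ l)%:R <=
  128 * K ^+ 2 * (1 - Num.sqrt (Num.sqrt 2)^-1)^-1 + 128 * K * SE + 8 * SW.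
Proof.
move=> K0 e0 w0 hE hW.
have q0 : 0 < Num.sqrt (2 : R) by rewrite sqrtr_gt0.
have qq : Num.sqrt (2 : R) * Num.sqrt 2 = 2 by rewrite -expr2 sqr_sqrtr.
have q1 : 1 < Num.sqrt (2 : R) by nra.
have q2 : Num.sqrt (2 : R) < 2 by nra.
set theta := Num.sqrt (Num.sqrt 2)^-1.
have th0 : 0 <= theta by exact: sqrtr_ge0.
have th2 : theta * theta = (Num.sqrt 2)^-1.
  by rewrite -expr2 sqr_sqrtr// invr_ge0 ltW.
have qi : (Num.sqrt (2 : R))^-1 < 1 by rewrite invf_lt1.
have th1 : theta < 1 by nra.
pose rho : R := (2 * Num.sqrt 2)^-1.
have hrho : 1 / 4 <= rho <= 1 / 2.
  have r0 : 0 < 2 * Num.sqrt (2 : R) by lra.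
  have rE : rho * (2 * Num.sqrt 2) = 1 by rewrite mulVf// gt_eqF.
  have : 0 < rho by rewrite invr_gt0.
  by move=> ?; apply/andP; split; nra.
apply: (@le_trans _ _ (\sum_(l < L) (128 * K ^+ 2 * theta ^+ l +
    16 * K * ((2 ^-1) ^+ l./2 * \sum_(1 <= m < (2 ^ l./2).+1) e m) +
    2 * (rho ^+ l * \sum_(1 <= m < (2 ^ l).+1) w m)))).
  apply: ler_sum => l _; rewrite (sqrt2X l); set q := Num.sqrt 2 ^+ l.
  have q_gt0 : 0 < q by exact: exprn_gt0.
  rewrite [leLHS]mulrDl [(_ + 16 * _ * _ * _) * _]mulrDl.
  apply: lerD; [apply: lerD|].
  - have h : Num.sqrt (2 ^ l./2)%:R / q <= theta ^+ l.
      rewrite ler_pdivrMr// /q -exprMn.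
      have tq : theta * Num.sqrt 2 = Num.sqrt (Num.sqrt 2).
        apply/eqP; rewrite -(@eqrXn2 _ 2)// ?sqrtr_ge0 ?mulr_ge0 ?sqrtr_ge0//.
        rewrite exprMn [theta ^+ 2]expr2 th2 !sqr_sqrtr ?ltW// -[X in _ * X == _]qq.
        by rewrite mulrA mulVf ?mul1r// gt_eqF.
      rewrite tq sqrt2X -[X in _ <= _ ^+ X](odd_double_half l) exprD -muln2 mulnC exprM.
      rewrite (sqr_sqrtr (ltW q0)); apply: ler_peMl; first by rewrite exprn_ge0// ltW.
      by apply: exprn_ege1; rewrite -[leLHS]sqrtr1; apply: ler_wsqrtr; exact: ltW.
    have h1 : 1 <= Num.sqrt (2 ^ l./2)%:R :> R.
      by rewrite -[leLHS]sqrtr1 ler_wsqrtr// ler1n expn_gt0.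
    have qi0 : 0 <= q^-1 by rewrite invr_ge0 ltW.
    have : q^-1 <= Num.sqrt (2 ^ l./2)%:R / q by rewrite ler_peMl.
    have K2 : 0 <= K ^+ 2 by exact: exprn_ge0.
    move=> h2; rewrite -mulrA mulrDl mul1r.
    have : K ^+ 2 * (q^-1 + Num.sqrt (2 ^ l./2)%:R / q) <= K ^+ 2 * (2 * theta ^+ l).
      apply: ler_wpM2l => //; lra.
    lra.
  - rewrite exprVn natrX [X in X <= _](_ : _ = 16 * K * ((2 ^+
    l./2)^-1 * \sum_(1 <= m < (2 ^ l./2).+1) e m) * (q / q)); last by ring.
    by rewrite divff ?gt_eqF// mulr1.
  - rewrite /rho exprVn exprMn natrX -/q invfM.
    by rewrite le_eqVlt; apply/orP; left; apply/eqP; ring.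
rewrite !big_split/= -!mulr_sumr; apply: lerD; [apply: lerD|].
- apply: ler_wpM2l; first by rewrite mulr_ge0// exprn_ge0.
  by apply: geometric_sum_le; rewrite th0.
- have := @sum_half (fun l => (2 ^-1) ^+ l * \sum_(1 <= m < (2 ^ l).+1) e m) L.
  move=> /(_ _)/wrap[l|h].
    by rewrite mulr_ge0 ?exprn_ge0 ?sumr_ge0.
  have h2 : \sum_(l < L) (2 ^-1 : R) ^+ l * (\sum_(1 <= m < (2 ^ l).+1) e m) <= 4 * SE.
    apply: (le_trans (@dyadic_sum _ e (fun m => m%:R^-1) L _ e0 _)).
    + by lra.
    + move=> l m /andP[m0 ml]; rewrite exprVn -natrX lef_pV2 ?posrE ?ltr0n ?expn_gt0//.
      by rewrite ler_nat.
    + by rewrite ler_pM2l.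
  have : 0 <= K by [].
  have : K * \sum_(l < L) (2 ^-1 : R) ^+ l./2 * (\sum_(1 <= m < (2 ^ l./2).+1) e m)
      <= K * (8 * SE) by apply: ler_wpM2l => //; lra.
  lra.
- have : \sum_(l < L) rho ^+ l * (\sum_(1 <= m < (2 ^ l).+1) w m) <= 4 * SW.
    apply: (le_trans (@dyadic_sum _ w (fun m => (m%:R * Num.sqrt m%:R)^-1) L hrho w0 _)).
    + move=> l m /andP[m0 ml]; rewrite /rho exprVn exprMn -natrX -sqrt2X.
      have m0' : 0 < (m%:R : R) by rewrite ltr0n.
      rewrite lef_pV2 ?posrE ?mulr_gt0 ?sqrtr_gt0 ?ltr0n ?expn_gt0//.
      by apply: ler_pM => //; [rewrite ler_nat|rewrite ler_wsqrtr// ler_nat].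
    + by rewrite ler_pM2l.
  lra.
Qed.

(* For nonnegative [u]: convergence to 0. *)
Definition null (u : nat -> R) :=
  forall e, 0 < e -> exists N, forall n, (N <= n)%N -> u n <= e.

Lemma null_half u : null u -> null (fun n => u n./2).
Proof.
move=> nu e /nu[N h]; exists N.*2 => n Nn; apply: h.
by rewrite -(doubleK N) half_leq.
Qed.

Lemma null_half_compl u : null u -> null (fun n => u (n - n./2).+1).
Proof.
move=> nu e /nu[N h]; exists N.*2 => n Nn; apply: h; rewrite leqW//.
by have := odd_double_half n; lia.
Qed.

Lemma nullD u v : null u -> null v -> null (fun n => u n + v n).
Proof.
move=> nu nv e e0.
have [N1 h1] := nu _ (divr_gt0 e0 (ltr0n _ 2)).
have [N2 h2] := nv _ (divr_gt0 e0 (ltr0n _ 2)).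
exists (maxn N1 N2) => n; rewrite geq_max => /andP[/h1 ? /h2 ?]; lra.
Qed.

Lemma nullMl u c : 0 <= c -> null u -> null (fun n => c * u n).
Proof.
move=> c0 nu e e0; have c1 : 0 < c + 1 by lra.
have [N h] := nu _ (divr_gt0 e0 c1); exists N => n /h {}h.
have : (c + 1) * (e / (c + 1)) = e by rewrite mulrC divfK// gt_eqF.
have : 0 < e / (c + 1) by rewrite divr_gt0.
nra.
Qed.

Lemma null_cvg (u v : nat -> R) : null v ->
  (exists N, forall n, (N <= n)%N -> `|u n| <= v n) -> u @ \oo --> 0.
Proof.
move=> nv [N0 h0]; apply/cvgrPdist_le => e /nv[N h]; near=> n.
rewrite sub0r normrN; apply: le_trans (h0 n _) (h n _); near: n; exact: nbhs_infty_ge.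
Unshelve. all: by end_near. Qed.

End DyadicSums.
(** * Test functions *)

Section TestFunctions.
Context (R : realType).
Implicit Types (r b : R) (f : R -> R).
Local Notation gam := (normal_prob (0 : R) 1).

(* Satisfied by the elements of the Zolotarev class of order [r], minus their
   Taylor polynomial at 0, and preserved by [f |-> c ^ r f (. / c)]. *)
Definition tame r f := (forall x y,
  `|f (x + y) - f x| <= `|y| * (`|x| + `|y|) `^ (r - 1)) /\ quad_approx r f.

(** Trades the power r - 1 for a quadratic at a free scale [b], so that third moments and Hoelder in
    L^3 suffice; only a constant factor is lost when [t] is of order [b]. *)
Lemma powR_le_quad r t b : 1 <= r <= 3 -> 0 <= t -> 0 < b ->
  t `^ (r - 1) <= b `^ (r - 1) * (1 + (t / b) ^+ 2).
Proof.
move=> /andP[r1 r3] t0 b0; rewrite -{1}(divfK (lt0r_neq0 b0) t) mulrC.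
have u0 : 0 <= t / b by rewrite divr_ge0// ltW.
rewrite powRM ?(ltW b0)//; apply: ler_wpM2l; first exact: powR_ge0.
have [u1|u1] := leP (t / b) 1.
  rewrite (@le_trans _ _ 1) ?lerDl ?exprn_ge0//.
  apply: le_trans (ge0_ler_powR _ _ _ u1) _; rewrite ?nnegrE ?powR1//; lra.
apply: (@le_trans _ _ ((t / b) `^ 2)); last by rewrite powR_mulrn// lerDr.
by apply: ler_powR; lra.
Qed.

Lemma tame_incr r f b x y : 1 <= r <= 3 -> tame r f -> 0 < b ->
  `|f (x + y) - f x| <= b `^ (r - 1) * (`|y| * (1 + ((`|x| + `|y|) / b) ^+ 2)).
Proof.
move=> r13 [ff _] b0; apply: le_trans (ff x y) _; rewrite mulrCA.
by apply: ler_wpM2l => //; apply: powR_le_quad => //; rewrite addr_ge0.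
Qed.

Lemma tame_continuous r f : 1 <= r <= 3 -> tame r f -> continuous f.
Proof.
move=> r13 tf x; apply/cvgrPdist_le => e e0.
set C := 1 + (`|x| + 1) ^+ 2.
have C0 : 0 < C by rewrite ltr_pwDl// sqr_ge0.
near=> z.
have zx : `|x - z| <= 1.
  by near: z; apply/nbhs_ballP; exists 1 => //= z; rewrite /ball/= => /ltW.
have zx2 : `|x - z| <= e / C.
  near: z; apply/nbhs_ballP; exists (e / C); first by rewrite /= divr_gt0.
  by move=> z; rewrite /ball/= => /ltW.
rewrite distrC in zx; rewrite distrC in zx2.
have := tame_incr x (z - x) r13 tf ltr01; rewrite powR1 mul1r divr1 [x + _]addrC subrK.
rewrite distrC => /le_trans; apply.
apply: (@le_trans _ _ (e / C * C)); last by rewrite divfK// gt_eqF.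
apply: ler_pM => //.
by rewrite lerD2l; apply: lerXn2r; rewrite ?nnegrE ?addr_ge0// lerD2l.
Unshelve. all: by end_near. Qed.

Lemma tame_le r f z : 1 <= r <= 3 -> tame r f ->
  `|f z| <= `|f 0| + (`|z| + `|z| ^+ 3).
Proof.
move=> r13 tf; have := tame_incr 0 z r13 tf ltr01.
rewrite add0r normr0 add0r divr1 powR1 mul1r => h.
have := ler_normD (f z - f 0) (f 0); rewrite subrK.
by move=> /le_trans; apply; rewrite addrC lerD2l (le_trans h)// exprS; lra.
Qed.

Lemma tame_subgauss r f : 1 <= r <= 3 -> tame r f -> subgauss f.
Proof.
move=> r13 tf; have a0 := @subgauss_norm R _ (subgauss_id R).
apply: (subgauss_le (g := fun z => `|f 0| + (`|z| + `|z| ^+ 3))).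
- exact: tame_continuous r13 tf.
- by move=> z; rewrite [leRHS]ger0_norm ?addr_ge0//; exact: tame_le tf.
- apply: subgaussD; first exact: subgauss_cst.
  by apply: subgaussD => //; exact: subgaussX.
Qed.

Lemma tame_scale r f c : 1 <= r <= 3 -> 0 < c -> tame r f ->
  tame r (fun x => c `^ r * f (x / c)).
Proof.
move=> r13 c0 [f1 f2].
have c0' : c != 0 by rewrite gt_eqF.
have cr0 := powR_ge0 c r.
have ci0 : 0 <= c^-1 by rewrite invr_ge0 ltW.
split=> [x y|x].
  rewrite mulrDl -mulrBr normrM (ger0_norm cr0).
  apply: le_trans (ler_wpM2l cr0 (f1 _ _)) _.
  rewrite !normrM normfV (gtr0_norm c0) -mulrDl powRM ?addr_ge0//.
  have -> : c `^ r = c * c `^ (r - 1).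
    by rewrite -{2}(powRr1 (ltW c0)) -powRD ?subrKC// c0' implybT.
  rewrite [leLHS](_ : _ = `|y| * (`|x| + `|y|) `^ (r - 1) * (c * c^-1) *
     (c `^ (r - 1) * c^-1 `^ (r - 1))); last by ring.
  rewrite -powRM ?(ltW c0)// divff// powR1 !mulr1//.
have [a [b [k h]]] := f2 (x / c).
exists (c `^ r * a), (c `^ r * b / c), (c `^ r * k / c ^+ 2) => z.
rewrite mulrDl (_ : _ - _ = c `^ r * (f (x / c + z / c) - (a + b * (z / c) +
  k * (z / c) ^+ 2))).
  rewrite normrM (ger0_norm cr0).
  apply: le_trans (ler_wpM2l cr0 (h _)) _.
  rewrite normrM normfV (gtr0_norm c0) powRM// mulrCA -powRM ?(ltW c0)//.
  by rewrite divff// powR1 mulr1.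
by field.
Qed.

End TestFunctions.

(** * Stability of tame functions under bounded corrections *)

Section Perturbation.
Context (d : measure_display) (T : measurableType d) (R : realType).
Variable P : probability T R.
Variables (r : R) (f : R -> R).
Hypothesis r13 : 1 <= r <= 3.
Hypothesis tf : tame r f.

Lemma tame_meas : measurable_fun setT f.
Proof. exact: continuous_measurable_fun (tame_continuous r13 tf). Qed.

Lemma ig_tame Y : L3 P Y -> ig P (fun w => f (Y w)).
Proof.
move=> LY; apply: (ig_le (g := fun w => `|f 0| + (`|Y w| + `|Y w| ^+ 3))).
- by apply: measurableT_comp; [exact: tame_meas|exact: L3_meas LY].
- by move=> w; exact: tame_le tf.
- apply: igD; first exact: ig_cst.
  by apply: igD; [exact/ig_abs/ig1|case: LY].
Qed.

(** For [Y] of size [b] and [Z] bounded in L^3 the cost is O(b^(r-1)). With b = sqrt n this becomes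
    n^(-1/2) after division by n^(r/2), so every bounded correction is affordable. *)
Lemma perturb b Y Z : L3 P Y -> L3 P Z -> 0 < b ->
  `|Ex P (fun w => f (Y w + Z w)) - Ex P (fun w => f (Y w))| <=
  b `^ (r - 1) * (N3 P Z * (1 + ((N3 P Y + N3 P Z) / b) ^+ 2)).
Proof.
move=> LY LZ b0.
have LaY := L3_abs LY; have LaZ := L3_abs LZ; have LV := L3D LaY LaZ.
have i1 : ig P (fun w => `|Z w|) by exact: ig1.
have i2 := ig3 LaZ LV LV.
rewrite -ExB; [|by apply: ig_tame; exact: L3D|exact: ig_tame].
apply: (@le_trans _ _ (Ex P (fun w => b `^ (r - 1) * (`|Z w| + b ^- 2 *
    (`|Z w| * (`|Y w| + `|Z w|) * (`|Y w| + `|Z w|)))))).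
  apply: Ex_abs_le.
  - by apply: igB; [apply: ig_tame; exact: L3D|exact: ig_tame].
  - by apply: igZ; apply: igD => //; exact: igZ.
  - move=> w; apply: le_trans (tame_incr _ _ r13 tf b0) _.
    apply: ler_wpM2l; first exact: powR_ge0.
    by rewrite le_eqVlt; apply/orP; left; apply/eqP; field; rewrite gt_eqF.
rewrite ExZ; last by apply: igD => //; exact: igZ.
apply: ler_wpM2l; first exact: powR_ge0.
rewrite ExD//; last exact: igZ.
rewrite ExZ//.
have h1 : Ex P (fun w => `|Z w|) <= N3 P Z by exact: Ex_abs_N3.
have h2 : Ex P (fun w => `|Z w| * (`|Y w| + `|Z w|) * (`|Y w| + `|Z w|)) <=
    N3 P Z * (N3 P Y + N3 P Z) ^+ 2.
  apply: le_trans (ler_norm _) _; apply: le_trans (Ex3_le LaZ LV LV) _.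
  have := N3D LaY LaZ; rewrite !N3_abs => h.
  rewrite -mulrA -expr2; apply: ler_wpM2l; first exact: N3_ge0.
  by rewrite lerXn2r ?nnegrE ?N3_ge0 ?addr_ge0 ?N3_ge0.
rewrite mulrDr mulr1; apply: lerD => //.
rewrite exprMn exprVn mulrA [leRHS]mulrC; apply: ler_wpM2l => //.
by rewrite invr_ge0 exprn_ge0// ltW.
Qed.

End Perturbation.

Section SmoothingTame.
Context (d : measure_display) (T : measurableType d) (R : realType).
Variable P : probability T R.
Variables (r : R) (f : R -> R).
Hypothesis r13 : 1 <= r <= 3.
Hypothesis tf : tame r f.
Local Notation gam := (normal_prob (0 : R) 1).

Lemma L3_gam_scale s : L3 gam (fun y : R => s * y).
Proof. by apply: L3Z; apply: subgauss_L3; exact: subgauss_id. Qed.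

Lemma N3_gam_scale s : N3 gam (fun y : R => s * y) = `|s| * N3 gam idfun.
Proof. by rewrite N3Z//; apply: subgauss_L3; exact: subgauss_id. Qed.

Lemma Ex_Q_tame b s Y : 0 < s -> L3 P Y -> 0 < b ->
  `|Ex P (fun w => Q s f (Y w)) - Ex P (fun w => f (Y w))| <=
  b `^ (r - 1) * (s * N3 gam idfun * (1 + ((N3 P Y + s * N3 gam idfun) / b) ^+ 2)).
Proof.
move=> s0 LY b0; set rho := s * _.
have rho0 : 0 <= rho by rewrite mulr_ge0 ?N3_ge0// ltW.
(* [perturb] on the Gaussian space, with the value [m] of [Y] frozen as a constant. *)
have pt m : `|Q s f m - f m| <= b `^ (r - 1) * (rho * (1 + ((`|m| + rho) / b) ^+ 2)).
  have := perturb r13 tf (L3_cst gam m) (L3_gam_scale s) b0.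
  by rewrite Ex_cst N3_cst N3_gam_scale (gtr0_norm s0).
have LaY := L3_abs LY; have LV := L3D LaY (L3_cst P rho).
have iV : ig P (fun w => (`|Y w| + rho) ^+ 2) by exact: ig_sqr.
have mQ : measurable_fun setT (fun w => Q s f (Y w)).
  apply: measurableT_comp; last exact: L3_meas LY.
  by apply: subgauss_meas; apply: subgauss_Q => //; exact: tame_subgauss r13 tf.
have iB : ig P (fun w => b `^ (r - 1) * (rho * (1 + b ^- 2 * (`|Y w| + rho) ^+ 2))).
  by do 2 apply: igZ; apply: igD; [exact: ig_cst|exact: igZ].
have ptw w : `|Q s f (Y w) - f (Y w)| <=
    b `^ (r - 1) * (rho * (1 + b ^- 2 * (`|Y w| + rho) ^+ 2)).
  apply: le_trans (pt (Y w)) _; rewrite exprMn exprVn.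
  by rewrite [_ * b ^- 2]mulrC.
have iD : ig P (fun w => Q s f (Y w) - f (Y w)).
  apply: ig_le ptw iB; apply: measurable_funB => //.
  by apply: measurableT_comp; [exact: tame_meas tf|exact: L3_meas LY].
have iF := ig_tame r13 tf LY.
have iQ : ig P (fun w => Q s f (Y w)).
  by have := igD iD iF; congr ig; apply/funext => w; rewrite subrK.
rewrite -ExB//; apply: le_trans (Ex_abs_le iD iB ptw) _.
rewrite ExZ; last by apply: igZ; apply: igD; [exact: ig_cst|exact: igZ].
apply: ler_wpM2l; first exact: powR_ge0.
rewrite ExZ; last by apply: igD; [exact: ig_cst|exact: igZ].
apply: ler_wpM2l => //.
rewrite ExD; [|exact: ig_cst|exact: igZ].
rewrite Ex_cst ExZ// lerD2l exprMn exprVn mulrC.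
apply: ler_wpM2r; first by rewrite invr_ge0 exprn_ge0// ltW.
apply: (@le_trans _ _ (N3 P (fun w => `|Y w| + rho) ^+ 2)).
  rewrite expr2; apply: le_trans (ler_norm _) _; exact: Ex2_le.
rewrite lerXn2r ?nnegrE ?N3_ge0 ?addr_ge0 ?N3_ge0//.
by apply: le_trans (N3D LaY (L3_cst P rho)) _; rewrite N3_abs N3_cst ger0_norm.
Qed.

End SmoothingTame.

(** * Growth of the summed smoothing weights *)

Section PowerSums.
Context (R : realType).
Variable r : R.
Hypothesis r13 : 1 <= r <= 3.

Local Notation sq n := (Num.sqrt (n%:R : R)).
Let Th := Num.sqrt (2 : R) `^ (r - 1).

Lemma le_powR_nonpos (x y : R) : 0 < x <= y -> y `^ (r - 3) <= x `^ (r - 3).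
Proof.
move=> /andP[x0 xy]; rewrite -[r - 3]opprB !powRN lef_pV2 ?posrE ?powR_gt0//; last first.
  exact: lt_le_trans xy.
by case/andP: r13 => *; apply: ge0_ler_powR; rewrite ?nnegrE; lra.
Qed.

Let ThX L : sq (2 ^ L) `^ (r - 1) = Th ^+ L.
Proof.
rewrite sqrt2X; elim: L => [|L IH]; first by rewrite !expr0 powR1.
by rewrite !exprS powRM ?exprn_ge0// IH.
Qed.

(** On [2 ^ L <= i < 2 ^ L.+1] there are 2^L terms of size at most sqrt(2^L)^(r-3), which makes
    [Th ^+ L] in total. *)
Lemma sum_smoothing_weights L :
  \sum_(0 <= i < 2 ^ L) sq i.+1 `^ (r - 3) <= 1 + \sum_(l < L) Th ^+ l.
Proof.
elim: L => [|L IH]; first by rewrite expn0 big_nat1 sqrtr1 powR1 big_ord0 addr0.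
have L2 : (2 ^ L <= 2 ^ L.+1)%N by rewrite leq_exp2l.
rewrite (big_cat_nat _ L2)//= big_ord_recr/= addrA; apply: lerD => //.
have q0 : 0 < sq (2 ^ L) by rewrite sqrtr_gt0 ltr0n expn_gt0.
apply: (@le_trans _ _ (\sum_(2 ^ L <= i < 2 ^ L.+1) sq (2 ^ L) `^ (r - 3))).
  apply: ler_sum_nat => i /andP[hi _]; apply: le_powR_nonpos.
  by rewrite q0 ler_wsqrtr// ler_nat leqW.
rewrite sumr_const_nat expnS mul2n -addnn addnK -ThX -[leLHS]mulr_natl.
rewrite -{1}[(2 ^ L)%:R](sqr_sqrtr (ler0n R _)) -powR_mulrn ?(ltW q0)// -powRD.
  by rewrite (_ : 2%:R + _ = r - 1)//; ring.
by apply/implyP => _; rewrite gt_eqF.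
Qed.

Let q2 : 1 < Num.sqrt (2 : R).
Proof.
have q0 : 0 < Num.sqrt (2 : R) by rewrite sqrtr_gt0.
have : Num.sqrt (2 : R) ^+ 2 = 2 by rewrite sqr_sqrtr.
nra.
Qed.

Lemma sum_weights_gt1 : 1 < r -> exists2 C, 0 <= C &
  forall n L, (0 < n)%N -> (2 ^ L <= 2 * n)%N ->
    \sum_(0 <= i < 2 ^ L) sq i.+1 `^ (r - 3) <= C * sq n `^ (r - 1).
Proof.
move=> r1; have Th1 : 1 < Th.
  apply: (@le_lt_trans _ _ (1 `^ (r - 1))); first by rewrite powR1.
  by apply: gt0_ltr_powR; rewrite ?nnegrE//; lra.
exists (1 + Th / (Th - 1)).
  by rewrite addr_ge0// divr_ge0//; lra.
move=> n L n0 Ln; apply: le_trans (sum_smoothing_weights L) _.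
have n1 : 1 <= sq n `^ (r - 1).
  apply: (@le_trans _ _ (1 `^ (r - 1))); first by rewrite powR1.
  apply: ge0_ler_powR; rewrite ?nnegrE//; first by lra.
  by rewrite -[leLHS]sqrtr1 ler_wsqrtr// ler1n.
rewrite mulrDl mul1r; apply: lerD => //.
have -> : \sum_(l < L) Th ^+ l = (Th ^+ L - 1) / (Th - 1).
  apply: (canRL (mulfK _)); first by rewrite subr_eq0 gt_eqF.
  by rewrite mulrC -subrX1.
rewrite mulrAC ler_wpM2r ?invr_ge0//; first by lra.
have : Th ^+ L <= Th * sq n `^ (r - 1).
  rewrite -ThX /Th -powRM//; apply: ge0_ler_powR; rewrite ?nnegrE ?mulr_ge0//; first by lra.
  by rewrite -sqrtrM// -natrM ler_wsqrtr// ler_nat.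
lra.
Qed.

(** At r = 1 the ratio [Th] is 1: every dyadic level has the same bound, and the number of levels is
    the source of the logarithm. *)
Lemma sum_weights_1 : r = 1 -> exists2 C, 0 <= C &
  forall n L, (0 < n)%N -> (2 ^ L <= 2 * n)%N ->
    \sum_(0 <= i < 2 ^ L) sq i.+1 `^ (r - 3) <= C * (1 + ln n%:R).
Proof.
move=> r1; have l2 : 0 < ln (2 : R) by apply: ln_gt0; lra.
exists (2 + (ln 2)^-1); first by rewrite addr_ge0// invr_ge0 ltW.
move=> n L n0 Ln; apply: le_trans (sum_smoothing_weights L) _.
have n0' : 0 < (n%:R : R) by rewrite ltr0n.
have ln0 : 0 <= ln (n%:R : R) by apply: ln_ge0; rewrite ler1n.
have -> : \sum_(l < L) Th ^+ l = L%:R.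
  by rewrite /Th r1 subrr powRr0; under eq_bigr do rewrite expr1n;
    rewrite sumr_const card_ord.
have : L%:R * ln 2 <= ln 2 + ln (n%:R : R).
  rewrite -lnM ?posrE// -natrM mulr_natl -lnXn//
    -natrX ler_ln ?posrE ?ltr0n ?expn_gt0 ?muln_gt0//.
  by rewrite ler_nat.
rewrite -ler_pdivlMr// mulrDl divff ?gt_eqF// => h.
have : 0 < (ln (2 : R))^-1 by rewrite invr_gt0.
nra.
Qed.

End PowerSums.

(** * Gaussian comparison for a martingale plus a bounded remainder *)

Section GaussianComparison.
Context (d : measure_display) (T : measurableType d) (R : realType).
Variable P : probability T R.
Variable F : nat -> set (set T).
Hypothesis sF : forall k, sigma_algebra setT (F k).
Hypothesis FT : forall k, F k `<=` measurable.
Hypothesis FS : forall k, F k `<=` F k.+1.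
Variables (D : nat -> T -> R) (kappa s : R).
Hypothesis DF : forall k, Gm (F k.+1) (D k).
Hypothesis D3 : forall k, L3 P (D k).
Hypothesis Dorth : forall k, orth P (F k) (D k).
Hypothesis Dkappa : forall k, N3 P (D k) <= kappa.
Hypothesis s0 : 0 <= s.
Hypothesis Dsqr : forall k, Ex P (fun w => D k w ^+ 2) = s ^+ 2.
Variables (u : nat -> R) (V : R).
Hypothesis u_ge0 : forall l, 0 <= u l.
Hypothesis blocks : forall m l Z, Gm (F m) Z -> L3 P Z ->
  `|Ex P (fun w => Z w * (qsum D s (m + 2 ^ l) w - qsum D s m w))| <= N3 P Z * u l.
Hypothesis uV : forall L, \sum_(l < L) u l / Num.sqrt (2 ^ l)%:R <= V.
Variables (S Rn : nat -> T -> R) (rho : R).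
Hypothesis S3 : forall n, L3 P (S n).
Hypothesis R3 : forall n, L3 P (Rn n).
Hypothesis Rrho : forall n, N3 P (Rn n) <= rho.
Hypothesis SE : forall n, {ae P, forall w, S n w = msum D n w + Rn n w}.

Local Notation gam := (normal_prob (0 : R) 1).
Local Notation M := (msum D).
Local Notation sq n := (Num.sqrt (n%:R : R)).
Local Notation nu := (s * N3 gam idfun).

Let nu0 : 0 <= nu. Proof. by rewrite mulr_ge0// N3_ge0. Qed.
Let rho0 : 0 <= rho. Proof. exact: le_trans (N3_ge0 _ _) (Rrho 0). Qed.
Let k0 : 0 <= kappa. Proof. exact: kappa_ge0 Dkappa. Qed.

(** The degenerate case, where smoothing by N(0, j s^2) does nothing: the increments then have zero
    second moment. *)
Lemma msum_ae0 n : s = 0 -> {ae P, forall w, M n w = 0}.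
Proof.
move=> sz; elim: n => [|n IH]; first by apply: aeW => w; rewrite msum0.
have D0 : {ae P, forall w, D n w ^+ 2 = 0}.
  apply: (Ex_abs_eq0 (ig_sqr (D3 n))).
  rewrite (eq_Ex (g := fun w => D n w ^+ 2)) ?Dsqr ?sz ?expr0n// => w.
  by rewrite ger0_norm// sqr_ge0.
apply: filterS2 IH D0 => w e1 /eqP; rewrite sqrf_eq0 => /eqP e2.
by rewrite msumS e1 e2 addr0.
Qed.

Section FixedOrder.
Variables (r : R).
Hypothesis r13 : 1 <= r <= 3.

Let perturb_scaled (d' : measure_display) (T' : measurableType d')
    (P' : probability T' R) (f : R -> R) (c a b : R) Y Z :
  tame r f -> 1 <= c -> L3 P' Y -> L3 P' Z -> 0 <= a -> 0 <= b ->
  N3 P' Y <= a * c -> N3 P' Z <= b ->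
  `|Ex P' (fun w => f (Y w + Z w)) - Ex P' (fun w => f (Y w))| <=
  c `^ (r - 1) * (b * (1 + (a + b) ^+ 2)).
Proof.
move=> tf c1 LY LZ a0 b0 hY hZ; have c0 : 0 < c by lra.
apply: le_trans (perturb r13 tf LY LZ c0) _.
apply: ler_wpM2l; first exact: powR_ge0.
apply: ler_pM => //; [exact: N3_ge0| |].
  by rewrite addr_ge0// sqr_ge0.
rewrite lerD2l; apply: lerXn2r; rewrite ?nnegrE ?divr_ge0 ?addr_ge0 ?N3_ge0//.
  by rewrite ltW.
rewrite ler_pdivrMr// mulrDl; apply: lerD => //.
by apply: le_trans hZ _; exact: ler_peMr.
Qed.

Let remove_rest f n : tame r f -> (0 < n)%N ->
  `|Ex P (fun w => f (S n w)) - Ex P (fun w => f (M n w))| <=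
  sq n `^ (r - 1) * (rho * (1 + (2 * kappa + rho) ^+ 2)).
Proof.
move=> tf n0; have c1 : 1 <= sq n by rewrite -[leLHS]sqrtr1 ler_wsqrtr// ler1n.
have LM := msum_L3 D3 n.
have -> : Ex P (fun w => f (S n w)) = Ex P (fun w => f (M n w + Rn n w)).
  apply: ae_Ex; first by apply: (@ig_meas _ _ _ P); exact: (ig_tame r13 tf).
    by apply: (@ig_meas _ _ _ P); apply: (ig_tame r13 tf); exact: L3D.
  by apply: filterS (SE n) => w ->.
by apply: perturb_scaled => //;
  [rewrite mulr_ge0|exact: (N3_msum sF FT FS DF D3 Dorth Dkappa)].
Qed.

(** The three summands pay for the remainder [Rn], for the smoothing put on f(M_n), and for the
    passage from variance (n + 1) s^2 to n s^2. *)
Let C1 := rho * (1 + (2 * kappa + rho) ^+ 2) + nu * (1 + (2 * kappa + nu) ^+ 2) +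
  nu * (1 + (nu + nu) ^+ 2).
Let C2 := ((2 * kappa + s * gam_abs1 R) * V + kappa ^+ 3 + s ^+ 3 * gam_abs3 R) *
  (gauss_const R * s `^ (r - 3)).

Let C1_ge0 : 0 <= C1.
Proof.
have h a b : 0 <= b -> 0 <= b * (1 + a ^+ 2) :> R.
  by move=> b0; rewrite mulr_ge0// addr_ge0// sqr_ge0.
by rewrite /C1 !addr_ge0// h.
Qed.

Let smooth f n L : 0 < s -> tame r f -> (0 < n <= 2 ^ L)%N ->
  `|Ex P (fun w => Q s f (M n w)) - Q (sq n.+1 * s) f 0| <=
  C2 * \sum_(0 <= i < 2 ^ L) sq i.+1 `^ (r - 3).
Proof.
move=> s_gt0 tf nL; have sf := tame_subgauss r13 tf.
have sj j : (0 < j)%N -> 0 < sq j * s by move=> j0; rewrite mulr_gt0// sqrtr_gt0 ltr0n.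
have r03 : 0 <= r <= 3 by case/andP: r13 => *; apply/andP; split; lra.
pose Gam j := gauss_const R * (sq j * s) `^ (r - 3).
(* The two derivatives are chosen for all [j] at once; the pair at [j = 0] is arbitrary. *)
have : forall j, exists g : (R -> R) * (R -> R), (0 < j)%N -> [/\
    forall x, is_derive x (1 : R) (Q (sq j * s) f) (g.1 x),
    forall x, is_derive x (1 : R) g.1 (g.2 x) &
    forall x y, `|g.2 x - g.2 y| <= Gam j * `|x - y|].
  move=> j; have [->|j0] := posnP j; first by exists (id, id).
  have [g1 [g2 [h1 h2 h3]]] := Q_smooth (sj j j0) r03 sf tf.2.
  by exists (g1, g2).
move=> /choice[G hG].
have := lindeberg sF FT FS DF D3 Dorth Dkappa s_gt0 Dsqr
  (g := fun j => Q (sq j * s) f) (g' := fun j => (G j).1) (g'' := fun j => (G j).2)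
  (Gam := Gam) (u := u) (V := V) _ _ _ _ _ _ _ u_ge0 blocks uV nL.
have -> : \sum_(0 <= i < 2 ^ L) Gam i.+1 =
    gauss_const R * s `^ (r - 3) * \sum_(0 <= i < 2 ^ L) sq i.+1 `^ (r - 3).
  by rewrite mulr_sumr; apply: eq_bigr => i _; rewrite /Gam powRM ?sqrtr_ge0//; ring.
rewrite mulrA -/C2 sqrtr1 mul1r; apply.
- by move=> j x /hG[].
- by move=> j x /hG[].
- by move=> j x y /hG[].
- by move=> j j0; apply: subgauss_Q => //; exact: sj.
- move=> i j x i0 j0; rewrite Q_semigroup ?sj//; congr (Q _ f x).
  rewrite !exprMn !sqr_sqrtr// -mulrDl -natrD sqrtrM// sqrtr_sqr.
  by rewrite gtr0_norm.
- by move=> j; rewrite mulr_ge0 ?powR_ge0// gauss_const_ge0.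
- move=> i j /andP[i0 ij]; apply: ler_wpM2l; first exact: gauss_const_ge0.
  apply: (le_powR_nonpos r13); rewrite sj//=; apply: ler_wpM2r => //.
  by rewrite ler_wsqrtr// ler_nat.
Qed.

(** The chain runs through f(S_n), f(M_n), Q_s f(M_n), the smoothing at 0 of scale sqrt(n + 1) s,
    and a normal variable of scale sqrt n s. The sums are left unnormalised, so that one Gaussian
    step has variance s^2 whatever n. *)
Let scaled f n L : tame r f -> (0 < n <= 2 ^ L)%N ->
  `|Ex P (fun w => f (S n w)) - Ex gam (fun y => f (sq n * (s * y)))| <=
  C1 * sq n `^ (r - 1) + `|C2| * \sum_(0 <= i < 2 ^ L) sq i.+1 `^ (r - 3).
Proof.
move=> tf nL; have /andP[n0 _] := nL.
have c1 : 1 <= sq n by rewrite -[leLHS]sqrtr1 ler_wsqrtr// ler1n.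
have c0 : 0 < sq n by lra.
have W0 : 0 <= \sum_(0 <= i < 2 ^ L) sq i.+1 `^ (r - 3).
  by apply: sumr_ge0 => i _; exact: powR_ge0.
have h1 := remove_rest tf n0.
have cr0 : 0 <= sq n `^ (r - 1) by exact: powR_ge0.
have [s_gt0|] := ltP 0 s; last first.
  move=> s_le0; have sz : s = 0 by apply/eqP; rewrite eq_le s_le0.
  have -> : Ex gam (fun y => f (sq n * (s * y))) = f 0.
    by rewrite (eq_Ex (g := fun=> f 0)) ?Ex_cst// => y; rewrite sz mul0r mulr0.
  have -> : f 0 = Ex P (fun w => f (M n w)).
    rewrite -(Ex_cst P (f 0)); apply: ae_Ex; first exact: measurable_cst.
      by apply: (@ig_meas _ _ _ P); apply: (ig_tame r13 tf); exact: msum_L3.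
    by apply: filterS (msum_ae0 n sz) => w ->.
  apply: le_trans h1 _; rewrite /C1 sz !mul0r !addr0 mulrC lerDl.
  by rewrite mulr_ge0.
have h3 := smooth s_gt0 tf nL.
have h2 := Ex_Q_tame r13 tf s_gt0 (msum_L3 D3 n) c0.
(* The extra initial step left the variance at (n + 1) s^2; since sqrt(n + 1) - sqrt n <= 1,
   removing it is one more bounded perturbation. *)
have h4 : `|Q (sq n.+1 * s) f 0 - Ex gam (fun y => f (sq n * (s * y)))| <=
    sq n `^ (r - 1) * (nu * (1 + (nu + nu) ^+ 2)).
  have -> : Q (sq n.+1 * s) f 0 =
     Ex gam (fun y => f (sq n * s * y + (sq n.+1 - sq n) * s * y)).
    by apply: eq_Ex => y; congr f; ring.
  rewrite (_ : Ex gam (fun y => f (sq n * (s * y))) = Ex gam (fun y => f (sq n * s * y))).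
    have dq : 0 <= sq n.+1 - sq n <= 1.
      have e1 : sq n.+1 ^+ 2 = n%:R + 1 by rewrite sqr_sqrtr// natr1.
      have e2 : sq n ^+ 2 = n%:R by rewrite sqr_sqrtr.
      have : 0 <= sq n.+1 by exact: sqrtr_ge0.
      by move=> ?; apply/andP; split; nra.
    case/andP: dq => dq0 dq1.
    apply: perturb_scaled => //; try exact: L3_gam_scale.
      rewrite N3_gam_scale ger0_norm ?mulr_ge0 ?(ltW c0)//.
      by rewrite le_eqVlt; apply/orP; left; apply/eqP; ring.
    rewrite N3_gam_scale ger0_norm ?mulr_ge0//.
    by rewrite -mulrA; apply: ler_piMl.
  by apply: eq_Ex => y; congr f; ring.
have {}h2 : `|Ex P (fun w => Q s f (M n w)) - Ex P (fun w => f (M n w))| <=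
    sq n `^ (r - 1) * (nu * (1 + (2 * kappa + nu) ^+ 2)).
  apply: le_trans h2 _; apply: ler_wpM2l => //; apply: ler_wpM2l => //.
  rewrite lerD2l; apply: lerXn2r; rewrite ?nnegrE ?divr_ge0 ?addr_ge0 ?N3_ge0 ?mulr_ge0//
    ?N3_ge0//.
  rewrite ler_pdivrMr// mulrDl; apply: lerD;
    first exact: (N3_msum sF FT FS DF D3 Dorth Dkappa).
  exact: ler_peMr.
have {}h3 := le_trans h3 (ler_wpM2r W0 (ler_norm C2)).
set a := Ex P _ in h1 *; set b := Ex P _ in h1 h2 *; set c := Ex P _ in h2 h3.
set e := Q _ f 0 in h3 h4; set g := Ex gam _ in h4 *.
have -> : a - g = (a - b) - (c - b) + (c - e) + (e - g) by ring.
apply: le_trans (ler_normD _ _) _.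
apply: le_trans (lerD (ler_normD _ _) (lexx _)) _.
apply: le_trans (lerD (lerD (ler_normB _ _) (lexx _)) (lexx _)) _.
rewrite /C1 !mulrDl ![_ * sq n `^ _]mulrC; lra.
Qed.

Lemma gaussian_comparison : exists2 C, 0 <= C &
  forall f n L, tame r f -> (0 < n <= 2 ^ L)%N ->
  `|Ex P (fun w => f (S n w / sq n)) - Ex gam (fun y => f (s * y))| <=
  C * ((sq n)^-1 + sq n `^ (- r) * \sum_(0 <= i < 2 ^ L) sq i.+1 `^ (r - 3)).
Proof.
exists (C1 + `|C2|) => [|f n L tf nL]; first by rewrite addr_ge0.
have /andP[n0 _] := nL.
have c0 : 0 < sq n by rewrite sqrtr_gt0 ltr0n.
have cr0 : 0 < sq n `^ r by exact: powR_gt0.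
set W := \sum_(0 <= i < _) _.
have W0 : 0 <= W by apply: sumr_ge0 => i _; exact: powR_ge0.
(* Normalisation by homogeneity: [scaled] is applied to c^r f(x / c) with c = sqrt n, and the factor
   c^r is divided out. *)
have := scaled (tame_scale r13 c0 tf) nL; rewrite -/W.
have iS : ig P (fun w => f (S n w / sq n)).
  have := ig_tame r13 tf (L3Z (sq n)^-1 (S3 n)); congr ig.
  by apply/funext => w; rewrite mulrC.
have iG : ig gam (fun y => f (s * y)) by apply: (ig_tame r13 tf); exact: L3_gam_scale.
rewrite ExZ//.
rewrite (_ : Ex gam (fun y => sq n `^ r * _) = sq n `^ r * Ex gam (fun y => f (s * y))).
  rewrite -mulrBr normrM gtr0_norm// -ler_pdivlMl// => /le_trans; apply.
  rewrite -powRN; set p := sq n `^ (- r); set q := sq n `^ (r - 1).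
  have pq : p * q = (sq n)^-1.
    rewrite -powRD; last by apply/implyP => _; rewrite gt_eqF.
    by rewrite (_ : - r + (r - 1) = -1) ?powR_inv1 ?(ltW c0)//; ring.
  rewrite [leLHS](_ : _ = C1 * (sq n)^-1 + `|C2| * (p * W)); last by rewrite -pq; ring.
  have : 0 <= C1 * (p * W) by rewrite !mulr_ge0// powR_ge0.
  have : 0 <= `|C2| * (sq n)^-1 by rewrite mulr_ge0// invr_ge0 ltW.
  lra.
transitivity (Ex gam (fun y => sq n `^ r * f (s * y))); last by rewrite ExZ.
by apply: eq_Ex => y; rewrite [_ * (s * y)]mulrC mulfK// gt_eqF.
Qed.

End FixedOrder.
End GaussianComparison.
(** * Martingale approximation *)

Section ConvergenceL3.
Context (d : measure_display) (T : measurableType d) (R : realType).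
Variable P : probability T R.

Lemma ae_L3 (f g : T -> R) : measurable_fun setT g ->
  {ae P, forall x, f x = g x} -> L3 P f -> L3 P g /\ N3 P g = N3 P f.
Proof.
move=> mg fg Lf; have [mf if3] := Lf.
have m3 (h : T -> R) : measurable_fun setT h -> measurable_fun setT (fun x => `|h x| ^+ 3).
  by move=> mh; apply: measurable_funX; exact: measurableT_comp.
have fg3 : {ae P, forall x, `|f x| ^+ 3 = `|g x| ^+ 3}.
  by apply: filterS fg => x ->.
split; first by split=> //; apply: (ae_ig _ _ fg3 if3); exact: m3.
by rewrite N3.unlock; congr (_ `^ _); apply/esym/ae_Ex => //; exact: m3.
Qed.

Definition cvg3 (V_ : nat -> T -> R) (V : T -> R) := [/\
  forall n, L3 P (V_ n), L3 P V &
  forall e : R, 0 < e -> exists N, forall n, (N <= n)%N ->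
    N3 P (fun x => V_ n x - V x) <= e].

Lemma cvg3_ext V_ V_' V V' : (forall n, V_ n =1 V_' n) -> V =1 V' ->
  cvg3 V_ V -> cvg3 V_' V'.
Proof.
by move=> /(_ _)/funext e1 /funext <-; rewrite (_ : V_' = V_)//; apply/funext => n;
  rewrite e1.
Qed.

Lemma cvg3_cst V : L3 P V -> cvg3 (fun=> V) V.
Proof.
move=> LV; split=> // e e0; exists 0%N => n _.
rewrite (eq_N3 (g := fun=> 0)) => [|x]; last by rewrite subrr.
by rewrite N3_cst normr0 ltW.
Qed.

Lemma cvg3D V_ V U_ U : cvg3 V_ V -> cvg3 U_ U ->
  cvg3 (fun n x => V_ n x + U_ n x) (fun x => V x + U x).
Proof.
move=> [LV_ LV cV] [LU_ LU cU]; split=> [n||e e0]; try exact: L3D.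
have [N1 h1] := cV _ (divr_gt0 e0 (ltr0n _ 2)).
have [N2 h2] := cU _ (divr_gt0 e0 (ltr0n _ 2)).
exists (maxn N1 N2) => n; rewrite geq_max => /andP[/h1 {}h1 /h2 {}h2].
rewrite (eq_N3 (g := fun x => (V_ n x - V x) + (U_ n x - U x))) => [|x].
  by rewrite (le_trans (N3D (L3B (LV_ n) LV) (L3B (LU_ n) LU)))//; lra.
by congr `|_|; ring.
Qed.

Lemma cvg3N V_ V : cvg3 V_ V -> cvg3 (fun n x => - V_ n x) (fun x => - V x).
Proof.
move=> [LV_ LV cV]; split=> [n||e e0]; try exact: L3N.
have [N h] := cV _ e0; exists N => n /h; apply: le_trans.
by rewrite (eq_N3 (g := fun x => V_ n x - V x))// => x; rewrite -opprD normrN.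
Qed.

Lemma cvg3B V_ V U_ U : cvg3 V_ V -> cvg3 U_ U ->
  cvg3 (fun n x => V_ n x - U_ n x) (fun x => V x - U x).
Proof. by move=> cV cU; exact: cvg3D cV (cvg3N cU). Qed.

Lemma cvg3_shift m V_ V : cvg3 V_ V -> cvg3 (fun n => V_ (n + m)%N) V.
Proof.
move=> [LV_ LV cV]; split=> // e e0.
have [N h] := cV _ e0; exists N => n Nn; apply: h.
by rewrite (leq_trans Nn)// leq_addr.
Qed.

Lemma cvg3_comp (phi : T -> T) V_ V : measurable_fun setT phi ->
  (forall A, measurable A -> P (phi @^-1` A) = P A) ->
  cvg3 V_ V -> cvg3 (fun n x => V_ n (phi x)) (fun x => V (phi x)).
Proof.
move=> mphi phiP [LV_ LV cV]; split=> [n||e e0]; try exact: L3_comp.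
have [N h] := cV _ e0; exists N => n /h.
by rewrite -(N3_comp mphi phiP)//; apply/L3_meas/L3B.
Qed.

Lemma cvg3_L1 V_ V e : cvg3 V_ V -> 0 < e ->
  exists n, Ex P (fun x => `|V_ n x - V x|) <= e.
Proof.
move=> [LV_ LV cV] e0; have [N h] := cV _ e0; exists N.
by rewrite (le_trans (Ex_abs_N3 (L3B (LV_ N) LV)))// h.
Qed.

Lemma orth_cvg3 (G : set (set T)) V_ V : G `<=` measurable ->
  (forall n, orth P G (V_ n)) -> cvg3 V_ V -> orth P G V.
Proof.
move=> GT oV cV; apply: (orth_lim GT oV) => [|e e0]; first by case: cV => _ /ig1.
exact: cvg3_L1.
Qed.

(** [G] need not contain the null sets, so the limit is only almost everywhere equal to a
    [G]-measurable function. *)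
Lemma Gm_cvg3 (G : set (set T)) V_ V :
  sigma_algebra setT G -> G `<=` measurable ->
  (forall n, Gm G (V_ n)) -> cvg3 V_ V ->
  exists V', [/\ Gm G V', L3 P V' & {ae P, forall x, V x = V' x}].
Proof.
move=> sG GT GV cV; have [LV_ LV _] := cV.
have [V' [GV' iV' aV']] := Gm_lim sG GT GV (fun n => ig1 (LV_ n)) (ig1 LV)
  (fun e => @cvg3_L1 _ _ e cV).
exists V'; split=> //; by have [] := ae_L3 (ig_meas iV') aV' LV.
Qed.

End ConvergenceL3.

Section Tails.
Context (d : measure_display) (T : measurableType d) (R : realType).
Variable P : probability T R.
Variables c A : nat -> T -> R.
Hypothesis tailA : forall n, (0 < n)%N -> cvg3 P (fun N x => \sum_(n <= k < N) c k x) (A n).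

(** The [A n] are tied together only as L^3 limits, so [A n] is written through three approximation
    errors, at a rank [N] large enough for the tail at [n]. *)
Lemma tail_cvg0 e : 0 < e -> exists N, forall n, (N <= n)%N -> N3 P (A n) <= e.
Proof.
move=> e0; have e3 : 0 < e / 3 by rewrite divr_gt0.
have [LV_ LA1 cA1] := tailA (ltn0Sn 0).
have [N1 h1] := cA1 _ e3; exists N1.+1 => n nN.
have n0 : (0 < n)%N by exact: leq_trans nN.
have [LU_ LAn cAn] := tailA n0.
have [N2 h2] := cAn _ e3; set N := maxn N2 n.
have {}h2 := h2 N (leq_maxl _ _).
have h3 := h1 N (leq_trans (ltnW nN) (leq_maxr _ _)).
have {}h1 := h1 n (ltnW nN).
pose p1 x := \sum_(n <= k < N) c k x - A n x.
pose p2 x := \sum_(1 <= k < N) c k x - A 1%N x.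
pose p3 x := \sum_(1 <= k < n) c k x - A 1%N x.
have L1 : L3 P p1 by exact: L3B.
have L2 : L3 P p2 by exact: L3B.
have L4 : L3 P p3 by exact: L3B.
rewrite (eq_N3 (g := fun x => (p2 x - p3 x) - p1 x)) => [|x].
  apply: le_trans (N3B (L3B L2 L4) L1) _.
  have := N3B L2 L4; lra.
congr `|_|; rewrite /p1 /p2 /p3 (big_cat_nat n0)/=; first by ring.
exact: leq_maxr.
Qed.

Lemma term_cvg0 e : 0 < e -> exists N, forall n, (N <= n)%N -> N3 P (c n) <= e.
Proof.
move=> e0; have [LV_ LA1 cA1] := tailA (ltn0Sn 0).
have [N h] := cA1 _ (divr_gt0 e0 (ltr0n _ 2)); exists N.+1 => n nN.
rewrite (eq_N3 (g := fun x => (\sum_(1 <= k < n.+1) c k x - A 1%N x) -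
    (\sum_(1 <= k < n) c k x - A 1%N x))) => [|x].
  apply: le_trans (N3B (L3B (LV_ _) LA1) (L3B (LV_ _) LA1)) _.
  by have := h n (ltnW nN); have := h n.+1 (leq_trans (ltnW nN) (leqnSn n)); lra.
congr `|_|; rewrite big_nat_recr/=; [ring|exact: leq_trans nN].
Qed.

Lemma tail_bounded : exists K, forall n, (0 < n)%N -> N3 P (A n) <= K.
Proof.
have [N hN] := tail_cvg0 ltr01.
exists (1 + \sum_(i < N) N3 P (A i)) => n n0.
have s0 : 0 <= \sum_(i < N) N3 P (A i) by apply: sumr_ge0 => i _; exact: N3_ge0.
have [/hN h|h] := leqP N n; first by lra.
rewrite (bigD1 (Ordinal h))//= addrCA lerDl addr_ge0//.
by apply: sumr_ge0 => i _; exact: N3_ge0.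
Qed.

End Tails.

Section MartingaleApproximation.
Context (d : measure_display) (T : measurableType d) (R : realType).
Variable P : probability T R.
Variables tau tauV : {mfun T >-> T}.
Hypothesis tauK : cancel tau tauV.
Hypothesis tauVK : cancel tauV tau.
Hypothesis tauP : forall A, measurable A -> P (tau @^-1` A) = P A.
Variable F0 : set (set T).
Hypothesis F0_sigma : sigma_algebra setT F0.
Hypothesis F0_measurable : F0 `<=` measurable.
Hypothesis F0_incl : F0 `<=` preimage_set_system setT tau F0.
Variable x : T -> R.
Hypothesis Lx : L3 P x.

Local Notation F := (filt tau F0).
Local Notation th k := (iter k tau).
Local Notation thV k := (iter k tauV).

Let sF k := filt_sigma tau F0_sigma k.
Let FT k := @filt_measurable _ _ tau F0 F0_measurable k.
Let mth k := iter_meas tau k.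
Let thP k A := @iter_P _ _ _ P tau tauP k A.
Let mthV k := iter_meas tauV k.
Let thVP k A := @iterV_P _ _ _ P tau tauV tauK tauP k A.

Definition past_term k := condexp P F0 (fun w => x (th k w)).
Definition future_term k w := x (thV k w) - condexp P F0 (fun w => x (thV k w)) w.

Let g k := condexp P F0 (fun w => x (thV k w)).

Let Lxk k : L3 P (fun w => x (th k w)).
Proof. exact: (L3_comp (mth k) (@thP k)). Qed.

Let LxV k : L3 P (fun w => x (thV k w)).
Proof. exact: (L3_comp (mthV k) (@thVP k)). Qed.

Let Lc k : L3 P (past_term k).
Proof. exact: (condexp_L3 F0_sigma F0_measurable). Qed.

Let Lg k : L3 P (g k).
Proof. exact: (condexp_L3 F0_sigma F0_measurable). Qed.

Let Gc k : Gm F0 (past_term k).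
Proof. by have [] := condexp_spec F0_sigma F0_measurable (ig1 (Lxk k)). Qed.

Let Gg k : Gm F0 (g k).
Proof. by have [] := condexp_spec F0_sigma F0_measurable (ig1 (LxV k)). Qed.

Let oc k : orth P F0 (fun w => x (th k w) - past_term k w).
Proof. by have [] := condexp_spec F0_sigma F0_measurable (ig1 (Lxk k)). Qed.

Let ob k : orth P F0 (future_term k).
Proof. by have [] := condexp_spec F0_sigma F0_measurable (ig1 (LxV k)). Qed.

Lemma filt_le m n : (m <= n)%N -> F m `<=` F n.
Proof. by apply: F_le => k; exact: filtS. Qed.

Lemma F0_filt n : F0 `<=` F n.
Proof. by rewrite -[X in X `<=` _](filt0 tau); exact: filt_le. Qed.

Lemma orth_sub (G H : set (set T)) Y : G `<=` H -> orth P H Y -> orth P G Y.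
Proof. by move=> GH [iY oY]; split=> // S /GH; exact: oY. Qed.

Lemma Gm_sub (G H : set (set T)) (Y : T -> R) : G `<=` H -> Gm G Y -> Gm H Y.
Proof. by move=> GH GY S mS; apply/GH/GY. Qed.

Lemma Gm_filt_comp m k Y : Gm (F m) Y -> Gm (F (k + m)) (fun w => Y (th k w) : R).
Proof. by move=> /(Gm_comp_preimage (iter k tau)); rewrite preimage_filt. Qed.

Lemma Gm_filt0_comp k Y : Gm F0 Y -> Gm (F k) (fun w => Y (th k w) : R).
Proof. exact: Gm_comp_preimage. Qed.

Lemma orth_filt0_comp k Y : orth P F0 Y -> orth P (F k) (fun w => Y (th k w)).
Proof. exact: (orth_comp (mth k) (@thP k) F0_measurable). Qed.

Variables A B : nat -> T -> R.
Hypothesis tailA : forall n, (0 < n)%N ->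
  cvg3 P (fun N w => \sum_(n <= k < N) past_term k w) (A n).
Hypothesis tailB : forall n, (0 < n)%N ->
  cvg3 P (fun N w => \sum_(n <= k < N) future_term k w) (B n).

(* [x \o tau = incr + corr - corr \o tau] is the martingale-coboundary
   decomposition. *)
Definition B0 w := future_term 0 w + B 1%N w.
Definition corr w := A 1%N w - B0 w.
Definition incr w := x (tau w) + corr (tau w) - corr w.

Lemma L3_A n : (0 < n)%N -> L3 P (A n).
Proof. by move=> /tailA[]. Qed.

Lemma L3_B n : (0 < n)%N -> L3 P (B n).
Proof. by move=> /tailB[]. Qed.

Lemma L3_B0 : L3 P B0.
Proof. by apply: L3D; [apply: L3B; [exact: LxV|exact: Lg]|exact: L3_B]. Qed.

Lemma L3_corr : L3 P corr.
Proof. by apply: L3B; [exact: L3_A|exact: L3_B0]. Qed.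

Let cvgB0 : cvg3 P (fun N w => \sum_(0 <= j < N.+1) future_term j w) B0.
Proof.
have := cvg3D (cvg3_cst (L3B (LxV 0) (Lg 0))) (cvg3_shift 1 (tailB (ltn0Sn 0))).
apply: cvg3_ext => // N w.
by rewrite addn1 [RHS]big_ltn.
Qed.

Let cvgB0m m : (0 < m)%N ->
  cvg3 P (fun N w => \sum_(0 <= j < N.+1) future_term (j + m) (th m w))
    (fun w => B m (th m w)).
Proof.
move=> m0; have := cvg3_comp (mth m) (@thP m) (cvg3_shift m.+1 (tailB m0)).
apply: cvg3_ext => // N w.
by rewrite -[X in \sum_(X <= _ < _) _]add0n big_addn addnS -addSn addnK.
Qed.

Let future_termE j m w : future_term (j + m) (th m w) = x (thV j w) - g (j + m) (th m w).
Proof. by rewrite /future_term iterD iterK. Qed.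

Lemma A_meas : exists A', [/\ Gm F0 A', L3 P A' & {ae P, forall w, A 1%N w = A' w}].
Proof.
apply: (Gm_cvg3 F0_sigma F0_measurable) (tailA (ltn0Sn 0)) => N.
exact: Gm_sum.
Qed.

Lemma B_meas m : (0 < m)%N -> exists G',
  [/\ Gm (F m) G', L3 P G' & {ae P, forall w, B0 w - B m (th m w) = G' w}].
Proof.
move=> m0; apply: (Gm_cvg3 (@sF m) (@FT m)) (cvg3B cvgB0 (cvgB0m m0)) => N.
rewrite (_ : (fun w => _) = (fun w => \sum_(0 <= j < N.+1) (g (j + m) (th m w) - g j w))).
  apply: (Gm_sum (@sF m)) => j; apply: (GmB (@sF m)); first exact: Gm_filt0_comp.
  exact: Gm_sub (@F0_filt m) _.
apply/funext => w; rewrite -sumrB; apply: eq_bigr => j _.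
by rewrite future_termE /future_term -/(g j w); ring.
Qed.

Lemma B0_orth : orth P F0 B0.
Proof. by apply: (orth_cvg3 F0_measurable _ cvgB0) => N; exact: orth_sum. Qed.

(** E (X_k | F_0) o T^m plays the role of E (X_(k+m) | F_m); by the tower property its projection on
    [F0] is E (X_(k+m) | F_0), whose sum over k >= 1 is [A m.+1]. *)
Lemma A_orth m : orth P F0 (fun w => A 1%N (th m w) - A m.+1 w).
Proof.
have := cvg3B (cvg3_comp (mth m) (@thP m) (tailA (ltn0Sn 0))) (cvg3_shift m (tailA (ltn0Sn m))).
apply: (orth_cvg3 F0_measurable) => N.
rewrite (_ : (fun w => _) = (fun w => \sum_(1 <= k < N)
   ((x (th (k + m) w) - past_term (k +
     m) w) - (x (th k (th m w)) - past_term k (th m w))))).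
  apply: (orth_sum F0_measurable) => k; apply: (orthB F0_measurable); first exact: oc.
  by apply: (orth_sub (@F0_filt m)); exact: (orth_filt0_comp m (oc k)).
apply/funext => w; rewrite -[m.+1]add1n big_addn addnK -sumrB; apply: eq_bigr => k _.
by rewrite iterD; ring.
Qed.

(** On the adapted side E (X_1 + A_1 o T | F_0) = A_1, because X_1 supplies the first term missing
    from the projected shifted series. [B0] and [B0 \o tau] are each orthogonal to [F0]. *)
Lemma incr_orth : orth P F0 incr.
Proof.
have o1 : orth P F0 (fun w => x (tau w) + A 1%N (tau w) - A 1%N w).
  have := cvg3B (cvg3D (cvg3_cst (Lxk 1)) (cvg3_comp (mth 1) (@thP 1) (tailA (ltn0Sn 0))))
    (cvg3_shift 1 (tailA (ltn0Sn 0))).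
  move=> /(cvg3_shift 1); apply: (orth_cvg3 F0_measurable) => N.
  rewrite (_ : (fun w => _) = (fun w => (x (th 1 w) - past_term 1 w) +
    \sum_(1 <= k < N.+1) ((x (th (k + 1) w) - past_term (k + 1) w) -
      (x (th k (th 1 w)) - past_term k (th 1 w))))).
    apply: (orthD F0_measurable); first exact: oc.
    apply: (orth_sum F0_measurable) => k; apply: (orthB F0_measurable); first exact: oc.
    by apply: (orth_sub (@F0_filt 1)); exact: (orth_filt0_comp 1 (oc k)).
  apply/funext => w.
  have -> : \sum_(1 <= k < N + 1 + 1) past_term k w =
      past_term 1 w + \sum_(1 <= k < N.+1) past_term (k + 1) w.
    rewrite !addn1 big_ltn// big_add1; congr (_ + _).
    by apply: eq_bigr => k _; rewrite addn1.
  rewrite addn1 -[LHS]addrA opprD [X in _ + X]addrCA [LHS]addrA; congr (_ + _).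
  rewrite -sumrB; apply: eq_bigr => k _.
  by rewrite iterD; ring.
have o2 : orth P F0 (fun w => B0 (tau w)).
  by apply: (orth_sub (@F0_filt 1)); exact: (orth_filt0_comp 1 B0_orth).
have := orthB F0_measurable (orthD F0_measurable o1 B0_orth) o2.
by congr orth; apply/funext => w; rewrite /incr /corr; ring.
Qed.

(** In [B0 - B0 \o tau] the unconditioned variables cancel in pairs, and the one left over, - x(T
    w), cancels the x(T w) of [incr]. *)
Lemma incr_meas : exists D, [/\ Gm (F 1) D, L3 P D & {ae P, forall w, incr w = D w}].
Proof.
have cA := cvg3_comp (mth 1) (@thP 1) (tailA (ltn0Sn 0)).
(* The shifted series is taken one term longer, so that the pairing is exact at every finite
   rank. *)
have cB := cvg3_shift 1 (cvg3_comp (mth 1) (@thP 1) cvgB0).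
have := cvg3B (cvg3D (cvg3_cst (Lxk 1)) (cvg3B cA cB)) (cvg3B (tailA (ltn0Sn 0)) cvgB0).
apply: (Gm_cvg3 (@sF 1) (@FT 1)) => N.
rewrite (_ : (fun w => _) = (fun w =>
   (g 0 (th 1 w) + \sum_(0 <= j < N.+1) (g j.+1 (th 1 w) - g j w)) +
   (\sum_(1 <= k < N) past_term k (th 1 w) - \sum_(1 <= k < N) past_term k w))).
  have s1 := @sF 1; apply: (GmD s1).
    apply: (GmD s1); first exact: Gm_filt0_comp.
    apply: (Gm_sum s1) => j; apply: (GmB s1); first exact: Gm_filt0_comp.
    exact: Gm_sub (@F0_filt 1) _.
  apply: (GmB s1); apply: (Gm_sum s1) => j; first exact: Gm_filt0_comp.
  exact: Gm_sub (@F0_filt 1) _.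
apply/funext => w; rewrite addn1 (@big_nat_recl _ _ _ N.+1)//.
have -> : \sum_(0 <= j < N.+1) (g j.+1 (th 1 w) - g j w) =
    \sum_(0 <= j < N.+1) future_term j w -
    \sum_(0 <= j < N.+1) future_term j.+1 (th 1 w).
  rewrite -sumrB; apply: eq_bigr => j _.
  by rewrite -addn1 future_termE /future_term -/(g j w); ring.
by rewrite /future_term -/(g 0 _) /=; ring.
Qed.

Lemma ae_orth (G : set (set T)) (f h : T -> R) : G `<=` measurable ->
  measurable_fun setT h -> {ae P, forall w, f w = h w} -> orth P G f -> orth P G h.
Proof.
move=> GT mh fh [fi fo]; have mf := ig_meas fi.
split=> [|S GS]; first exact: ae_ig fh fi.
rewrite -(fo S GS); apply: ae_Ex.
- by apply: measurable_funM => //; exact/measurable_indic/GT.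
- by apply: measurable_funM => //; exact/measurable_indic/GT.
- by apply: filterS fh => w ->.
Qed.

Variable E1 : T -> R.
Hypothesis E1F : Gm (F 1) E1.
Hypothesis E1L : L3 P E1.
Hypothesis E1ae : {ae P, forall w, incr w = E1 w}.

Definition mdiff k w := E1 (th k w).
Definition xsum n w := \sum_(k < n) x (th k.+1 w).
Let s := Num.sqrt (Ex P (fun w => E1 w ^+ 2)).
Local Notation M := (msum mdiff).

Lemma mdiff_Gm k : Gm (F k.+1) (mdiff k).
Proof. by have := Gm_filt_comp k E1F; rewrite addn1. Qed.

Lemma mdiff_L3 k : L3 P (mdiff k).
Proof. exact: (L3_comp (mth k) (@thP k)). Qed.

Lemma E1_orth : orth P F0 E1.
Proof. exact: (ae_orth F0_measurable (L3_meas E1L) E1ae incr_orth). Qed.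

Lemma mdiff_orth k : orth P (F k) (mdiff k).
Proof. exact: (orth_filt0_comp k E1_orth). Qed.

Lemma N3_mdiff k : N3 P (mdiff k) = N3 P E1.
Proof. exact: (N3_comp (mth k) (@thP k) (L3_meas E1L)). Qed.

Lemma Ex_mdiff_sqr k : Ex P (fun w => mdiff k w ^+ 2) = s ^+ 2.
Proof.
rewrite sqr_sqrtr; last by apply: Ex_ge0 => w; exact: sqr_ge0.
apply: (Ex_comp (mth k) (@thP k) (f := fun w => E1 w ^+ 2)).
by apply: measurable_funX; exact: L3_meas E1L.
Qed.

Let FS k := @filtS _ _ tau F0 F0_incl k.
Let M_L3 n := msum_L3 mdiff_L3 n.

Lemma xsumE n : {ae P, forall w, xsum n w = M n w + corr w - corr (th n w)}.
Proof.
elim: n => [|n IH].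
  by apply: aeW => w; rewrite /xsum big_ord0 msum0 add0r subrr.
have := ae_comp (mth n) (@thP n) E1ae.
apply: filterS2 IH => w IH e.
rewrite /xsum big_ord_recr/= -/(xsum n w) IH msumS /mdiff -e /incr /=; ring.
Qed.

Lemma xsum_L3 n : L3 P (xsum n).
Proof. have H (k : 'I_n) : true -> L3 P (fun w => x (th k.+1 w)) by move=> _;
  exact: (Lxk k.+1).
exact: L3_sum H. Qed.

Let orth_tail m n : (m <= n)%N -> orth P (F m) (fun w => M n w - M m w).
Proof.
move=> mn.
have -> : (fun w => M n w - M m w) = (fun w => \sum_(0 <= k < n - m) mdiff (k + m) w).
  apply/funext => w; rewrite /msum -!(big_mkord xpredT (fun k => mdiff k w)).
  rewrite (big_cat_nat (leq0n m) mn)/= addrAC subrr add0r.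
  by rewrite -{1}[m]add0n big_addn.
apply: (orth_sum (@FT m)) => k.
by apply: (orth_sub _ (mdiff_orth (k + m))); apply: filt_le; exact: leq_addl.
Qed.

Let orthM0 (G : set (set T)) Y Z : sigma_algebra setT G -> G `<=` measurable ->
  orth P G Y -> Gm G Z -> ig P (fun w => Z w * Y w) -> Ex P (fun w => Z w * Y w) = 0.
Proof.
move=> sG GT oY GZ iZ; rewrite (eq_Ex (g := fun w => Y w * Z w)) => [|w]; last exact: mulrC.
by apply: (orthM sG GT oY GZ); move: iZ; congr ig; apply/funext => w; exact: mulrC.
Qed.

Variable K : R.
Hypothesis KA : forall n, (0 < n)%N -> N3 P (A n) <= K.
Hypothesis KB : forall n, (0 < n)%N -> N3 P (B n) <= K.
Hypothesis KB0 : N3 P B0 <= K.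
Hypothesis KE : N3 P E1 <= K.

Let K0 : 0 <= K. Proof. exact: le_trans (N3_ge0 _ _) KB0. Qed.

Let L3th k (f : T -> R) : L3 P f -> L3 P (fun w => f (th k w)).
Proof. exact: (L3_comp (mth k) (@thP k)). Qed.

Let N3th k (f : T -> R) : L3 P f -> N3 P (fun w => f (th k w)) = N3 P f.
Proof. by move=> Lf; exact: (N3_comp (mth k) (@thP k) (L3_meas Lf)). Qed.

Let N3M n : N3 P (M n) <= 2 * K * Num.sqrt n%:R.
Proof.
have Dk k : N3 P (mdiff k) <= K by rewrite N3_mdiff.
exact: (N3_msum sF FT FS mdiff_Gm mdiff_L3 mdiff_orth Dk).
Qed.

Let rest n w := corr w - corr (th n w).

Let rest_L3 n : L3 P (rest n).
Proof. by apply: L3B; [exact: L3_corr|apply: L3th; exact: L3_corr]. Qed.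

Let rest_le n : N3 P (rest n) <= 4 * K.
Proof.
have NW : N3 P corr <= 2 * K.
  apply: le_trans (N3B (L3_A (ltn0Sn 0)) L3_B0) _.
  by have := KA (ltn0Sn 0); have := KB0; lra.
apply: le_trans (N3B L3_corr (L3th n L3_corr)) _.
by rewrite N3th; [lra|exact: L3_corr].
Qed.

Let sqrt0 (n : nat) : 0 <= Num.sqrt (n%:R : R). Proof. exact: sqrtr_ge0. Qed.

(** * Cross terms between the martingale and the coboundary *)

Section Cross.
Variables (Z : T -> R) (n : nat).
Hypothesis GZ : Gm F0 Z.
Hypothesis LZ : L3 P Z.

Let NZ0 : 0 <= N3 P Z. Proof. exact: N3_ge0. Qed.

Let cross_A : Ex P (fun w => Z w * M n w * A 1%N w) = 0.
Proof.
have [A' [GA' LA' aA']] := A_meas.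
have LA1 : L3 P (A 1%N) by exact: L3_A.
rewrite (_ : Ex P _ = Ex P (fun w => Z w * A' w * M n w)).
  apply: (orthM0 F0_sigma F0_measurable) (ig3 LZ LA' (M_L3 n)); last exact: (GmM F0_sigma).
  have := orth_tail (leq0n n); rewrite filt0; congr orth.
  by apply/funext => w; rewrite msum0 subr0.
apply: ae_Ex; [by apply: (@ig_meas _ _ _ P); exact: ig3|by apply: (@ig_meas _ _ _ P);
  exact: ig3|].
by apply: filterS aA' => w ->; ring.
Qed.

Let cross_Bn : Ex P (fun w => Z w * M n w * B0 (th n w)) = 0.
Proof.
apply: (orthM0 (sF n) (@FT n) (orth_filt0_comp n B0_orth)).
  apply: (GmM (sF n)); first exact: Gm_sub (@F0_filt n) GZ.
  exact: (msum_Gm sF FS mdiff_Gm).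
by apply: ig3 => //; apply: L3th; exact: L3_B0.
Qed.

(** [B0] splits into an [F m]-measurable part, correlated with [M m] only and hence costing sqrt m,
    and the tail [B m] shifted by m, which costs sqrt n times its norm. *)
Let cross_B m : (0 < m <= n)%N -> `|Ex P (fun w => Z w * M n w * B0 w)| <=
  N3 P Z * (4 * K ^+ 2 * Num.sqrt m%:R + 2 * K * Num.sqrt n%:R * N3 P (B m)).
Proof.
move=> /andP[m0 mn].
have [G' [GG' LG' aG']] := B_meas m0.
have LB0 := L3_B0; have LBm := L3th m (L3_B m0).
have LMn := M_L3 n; have LMm := M_L3 m.
have LMB := L3B LMn LMm.
have hN : N3 P G' <= 2 * K.
  have [_ ->] := ae_L3 (L3_meas LG') aG' (L3B LB0 LBm).
  apply: le_trans (N3B LB0 LBm) _; rewrite N3th; last exact: L3_B.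
  by have := KB m0; have := KB0; lra.
rewrite (_ : Ex P _ = Ex P (fun w => Z w * M m w * G' w) +
   Ex P (fun w => Z w * G' w * (M n w - M m w)) +
   Ex P (fun w => Z w * M n w * B m (th m w))); last first.
  rewrite -ExD; [|exact: ig3|exact: ig3].
  rewrite -ExD; [|by apply: igD; exact: ig3|exact: ig3].
  apply: ae_Ex; first by apply: (@ig_meas _ _ _ P); exact: ig3.
    by apply: (@ig_meas _ _ _ P); apply: igD; [apply: igD|]; exact: ig3.
  by apply: filterS aG' => w <-; ring.
rewrite [X in _ + X + _](orthM0 (sF m) (@FT m) (orth_tail mn)); last exact: ig3.
  rewrite addr0 mulrDr; apply: le_trans (ler_normD _ _) _; apply: lerD.
    apply: le_trans (Ex3_le LZ LMm LG') _; rewrite -mulrA; apply: ler_wpM2l => //.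
    have h := N3M m.
    apply: (@le_trans _ _ (2 * K * Num.sqrt m%:R * (2 * K))); last by lra.
    by apply: ler_pM => //; exact: N3_ge0.
  apply: le_trans (Ex3_le LZ LMn LBm) _; rewrite -mulrA; apply: ler_wpM2l => //.
  rewrite N3th; last exact: L3_B.
  by apply: ler_wpM2r (N3M n); exact: N3_ge0.
by apply: (GmM (sF m)) GG'; exact: Gm_sub (@F0_filt m) GZ.
Qed.

(** The last [m] increments cost sqrt m. The earlier ones see A_1 o T^n only through its projection
    on F_(n-m), which by [A_orth] is the tail [A m.+1] shifted by n - m. *)
Let cross_An m : (0 < m <= n)%N -> `|Ex P (fun w => Z w * M n w * A 1%N (th n w))| <=
  N3 P Z * (2 * K ^+ 2 * Num.sqrt m%:R + 2 * K * Num.sqrt n%:R * N3 P (A m.+1)).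
Proof.
move=> /andP[m0 mn]; set k := (n - m)%N.
have kn : (k + m)%N = n by rewrite subnK.
have LA1 := L3th n (L3_A (ltn0Sn 0)); have LAm := L3th k (L3_A (ltn0Sn m)).
have LMn := M_L3 n; have LMk := M_L3 k.
have LMB := L3B LMn LMk.
have LD := L3B LA1 LAm.
have oA : orth P (F k) (fun w => A 1%N (th n w) - A m.+1 (th k w)).
  have := orth_filt0_comp k (A_orth m).
  by congr orth; apply/funext => w; rewrite -iterD addnC kn.
rewrite (_ : Ex P _ = Ex P (fun w => Z w * (M n w - M k w) * A 1%N (th n w)) +
   Ex P (fun w => Z w * M k w * (A 1%N (th n w) - A m.+1 (th k w))) +
   Ex P (fun w => Z w * M k w * A m.+1 (th k w))); last first.
  rewrite -ExD; [|exact: ig3|exact: ig3].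
  rewrite -ExD; [|by apply: igD; exact: ig3|exact: ig3].
  by apply: eq_Ex => w; ring.
rewrite [X in _ + X + _](orthM0 (sF k) (@FT k) oA); last exact: ig3.
  rewrite addr0 mulrDr; apply: le_trans (ler_normD _ _) _; apply: lerD.
    apply: le_trans (Ex3_le LZ LMB LA1) _; rewrite -mulrA; apply: ler_wpM2l => //.
    have := msum_incr sF FT FS mdiff_Gm mdiff_L3 mdiff_orth (kappa := K) _ k m.
    rewrite kn => /(_ _)/wrap[i|h]; first by rewrite N3_mdiff.
    apply: (@le_trans _ _ (2 * K * Num.sqrt m%:R * K)); last by lra.
    apply: ler_pM => //; try exact: N3_ge0.
    by rewrite N3th; [exact: KA|exact: L3_A].
  apply: le_trans (Ex3_le LZ LMk LAm) _; rewrite -mulrA; apply: ler_wpM2l => //.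
  rewrite N3th; last exact: L3_A.
  apply: ler_wpM2r; first exact: N3_ge0.
  apply: le_trans (N3M k) _; apply: ler_wpM2l; first by rewrite mulr_ge0.
  by rewrite ler_wsqrtr// ler_nat leq_subr.
apply: (GmM (sF k)); first exact: Gm_sub (@F0_filt k) GZ.
exact: (msum_Gm sF FS mdiff_Gm).
Qed.

(** What is left of the two corrections beyond lag [m]; the index [m.+1] comes from [A_orth]. *)
Definition tail_size m := N3 P (B m) + N3 P (A m.+1).

(* The Cauchy--Schwarz bound would be of order [sqrt n]; splitting the
   correction at lag [m] replaces it by [sqrt m], up to the tails. *)
Lemma transfer m : (0 < m)%N ->
  `|Ex P (fun w => Z w * (xsum n w ^+ 2 - M n w ^+ 2))| <=
  N3 P Z * (16 * K ^+ 2 * (1 + Num.sqrt m%:R) + 4 * K * Num.sqrt n%:R * tail_size m).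
Proof.
move=> m0.
have LR := rest_L3 n; have NR := rest_le n; rewrite /rest in LR NR.
have LMn := M_L3 n; have LA1 := L3_A (ltn0Sn 0); have LB0 := L3_B0.
have LAn := L3th n LA1; have LBn := L3th n LB0.
have e0 : 0 <= tail_size m by rewrite addr_ge0 ?N3_ge0.
pose X1 := Ex P (fun w => Z w * M n w * (corr w - corr (th n w))).
pose X2 := Ex P (fun w => Z w * (corr w - corr (th n w)) * (corr w - corr (th n w))).
rewrite (_ : Ex P _ = 2 * X1 + X2); last first.
  rewrite -ExZ; last exact: ig3.
  rewrite -ExD; [|by apply: igZ; exact: ig3|exact: ig3].
  apply: ae_Ex.
  - apply: measurable_funM; first exact: L3_meas LZ.
    by apply: measurable_funB; apply: measurable_funX; apply: L3_meas => //; exact: xsum_L3.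
  - by apply: (@ig_meas _ _ _ P); apply: igD; [apply: igZ|]; exact: ig3.
  - by apply: filterS (xsumE n) => w ->; ring.
have hX2 : `|X2| <= N3 P Z * (16 * K ^+ 2).
  apply: le_trans (Ex3_le LZ LR LR) _; rewrite -mulrA; apply: ler_wpM2l => //.
  apply: (@le_trans _ _ (4 * K * (4 * K))); last by lra.
  by apply: ler_pM => //; exact: N3_ge0.
suff hX1 : `|X1| <= N3 P Z * (8 * K ^+ 2 * Num.sqrt m%:R +
  2 * K * Num.sqrt n%:R * tail_size m).
  apply: le_trans (ler_normD _ _) _; rewrite normrM [`|2|]ger0_norm//.
  set t1 := Num.sqrt _ in hX1 *; set t2 := Num.sqrt _ in hX1 *.
  rewrite (_ : _ * (_ + _) = 2 * (N3 P Z * (8 * K ^+ 2 * t1 +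
    2 * K * t2 * tail_size m)) + N3 P Z * (16 * K ^+ 2)).
    lra.
  by ring.
have [mn|nm] := leqP m n.
  have h : (0 < m <= n)%N by rewrite m0.
  rewrite /X1 (_ : Ex P _ = Ex P (fun w => Z w * M n w * A 1%N w)
     - Ex P (fun w => Z w * M n w * B0 w) - Ex P (fun w => Z w * M n w * A 1%N (th n w))
     + Ex P (fun w => Z w * M n w * B0 (th n w))); last first.
    rewrite -ExB; [|exact: ig3|exact: ig3].
    rewrite -ExB; [|by apply: igB; exact: ig3|exact: ig3].
    rewrite -ExD; [|by apply: igB; [apply: igB|]; exact: ig3|exact: ig3].
    by apply: eq_Ex => w; rewrite /corr; ring.
  rewrite cross_A cross_Bn addr0 sub0r.
  apply: le_trans (ler_normB _ _) _; rewrite normrN.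
  have := cross_B h; have := cross_An h; rewrite /tail_size.
  set t1 := Num.sqrt _; set t2 := Num.sqrt _ => h1 h2.
  apply: le_trans (lerD h2 h1) _; rewrite -mulrDr; apply: ler_wpM2l => //.
  have : 0 <= K ^+ 2 * t1 by rewrite mulr_ge0 ?exprn_ge0// sqrt0.
  lra.
(* For [n < m] the direct Hoelder bound already has order sqrt n <= sqrt m. *)
apply: le_trans (Ex3_le LZ LMn LR) _; rewrite -mulrA; apply: ler_wpM2l => //.
apply: (@le_trans _ _ (2 * K * Num.sqrt n%:R * (4 * K))).
  by apply: ler_pM => //; exact: N3_ge0.
have : K ^+ 2 * Num.sqrt n%:R <= K ^+ 2 * Num.sqrt m%:R.
  by apply: ler_wpM2l; [exact: exprn_ge0|rewrite ler_wsqrtr// ler_nat ltnW].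
have : 0 <= 2 * K * Num.sqrt n%:R * tail_size m by rewrite !mulr_ge0.
lra.
Qed.

End Cross.

(** M_n^2 is the sum of the D_k^2 plus twice the sum of the M_k D_k, and the latter is invisible to
    an [F0]-measurable [Z]. *)
Lemma Ex_mul_qsum Z n : Gm F0 Z -> L3 P Z ->
  Ex P (fun w => Z w * qsum mdiff s n w) =
  Ex P (fun w => Z w * M n w ^+ 2) - n%:R * s ^+ 2 * Ex P Z.
Proof.
move=> GZ LZ; elim: n => [|n IH].
  rewrite (eq_Ex (g := fun=> 0)) => [|w]; last by rewrite /qsum big_ord0 mulr0.
  rewrite (eq_Ex (f := fun w => Z w * _) (g := fun=> 0)) => [|w].
    by rewrite !Ex_cst mul0r mul0r subrr.
  by rewrite msum0 expr0n mulr0.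
have LM := M_L3 n; have LD := mdiff_L3 n.
have i1 : ig P (fun w => Z w * M n w ^+ 2).
  by have := ig3 LZ LM LM; congr ig; apply/funext => w; ring.
have i2 := ig3 LZ LM LD; have i3 := ig3 LZ LD LD.
have i4 : ig P (fun w => Z w * mdiff n w * mdiff n w - s ^+ 2 * Z w).
  by apply: igB => //; apply: igZ; exact: ig1.
have i5 := ig_Mqsum s mdiff_L3 n LZ.
rewrite (eq_Ex (g := fun w => Z w * qsum mdiff s n w +
    (Z w * mdiff n w * mdiff n w - s ^+ 2 * Z w))) => [|w]; last first.
  by rewrite qsumS; ring.
rewrite ExD// IH ExB//; last by apply: igZ; exact: ig1.
rewrite (eq_Ex (f := fun w => Z w * M n.+1 w ^+ 2) (g := fun w => Z w * M n w ^+ 2 +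
    2 * (Z w * M n w * mdiff n w) + Z w * mdiff n w * mdiff n w)) => [|w]; last first.
  by rewrite msumS; ring.
have i6 : ig P (fun w => Z w * M n w ^+ 2 + 2 * (Z w * M n w * mdiff n w)).
  by apply: igD => //; exact: igZ.
rewrite ExD// ExD//; last exact: igZ.
rewrite !ExZ//; last exact: ig1.
rewrite [Ex P (fun w => Z w * M n w * mdiff n w)](orthM0 (sF n) (@FT n) (mdiff_orth n))//.
  by rewrite -[n.+1]addn1 natrD; ring.
apply: (GmM (sF n)); first exact: Gm_sub (@F0_filt n) GZ.
exact: (msum_Gm sF FS mdiff_Gm).
Qed.

Lemma Ex_msum_sqr n : Ex P (fun w => M n w ^+ 2) = n%:R * s ^+ 2.
Proof.
have := Ex_mul_qsum n (Gm_cst F0_sigma 1) (L3_cst P 1).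
rewrite (eq_Ex (g := qsum mdiff s n)) => [|w]; last by rewrite mul1r.
rewrite (Ex_qsum mdiff_L3 Ex_mdiff_sqr) Ex_cst mulr1.
rewrite (eq_Ex (g := fun w => M n w ^+ 2)) => [|w]; last by rewrite mul1r.
lra.
Qed.

Variable wv : nat -> R.
Hypothesis wv_ge0 : forall n, 0 <= wv n.
Hypothesis wv0 : wv 0 = 0.
(** The condition on E (S_n^2 | F_0) in dual form: [wv n] will be n times the L^(3/2) norm appearing
    in it. *)
Hypothesis wvar : forall n Z, Gm F0 Z -> L3 P Z ->
  `|Ex P (fun w => Z w * (xsum n w ^+ 2 - Ex P (fun w => xsum n w ^+ 2)))| <=
  N3 P Z * wv n.

Let tr n m := 16 * K ^+ 2 * (1 + Num.sqrt m%:R) + 4 * K * Num.sqrt n%:R * tail_size m.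

(** The transfer to M_n is paid twice: once with [Z], and once with the constant 1, to replace the
    centring E (S_n^2) by n s^2. *)
Let qsum_bound n m Z : (0 < m)%N -> Gm F0 Z -> L3 P Z ->
  `|Ex P (fun w => Z w * qsum mdiff s n w)| <= N3 P Z * (2 * tr n m + wv n).
Proof.
move=> m0 GZ LZ; have LM := M_L3 n; have LX := xsum_L3 n.
have iX : ig P (fun w => Z w * xsum n w ^+ 2).
  by have := ig3 LZ LX LX; congr ig; apply/funext => w; ring.
have iM : ig P (fun w => Z w * M n w ^+ 2).
  by have := ig3 LZ LM LM; congr ig; apply/funext => w; ring.
have h1 := transfer n GZ LZ m0.
have h2 := transfer n (Gm_cst F0_sigma 1) (L3_cst P 1) m0.
have h3 := wvar n GZ LZ.
rewrite -/(tr n m) in h1 h2.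
move: h2; rewrite N3_cst normr1 mul1r.
rewrite (eq_Ex (g := fun w => xsum n w ^+ 2 - M n w ^+ 2)) => [|w]; last exact: mul1r.
rewrite ExB ?Ex_msum_sqr => [h2||]; [|exact: ig_sqr|exact: ig_sqr].
move: h1; rewrite (eq_Ex (g := fun w => Z w * xsum n w ^+ 2 - Z w * M n w ^+ 2)) => [|w].
  rewrite ExB// => h1.
  move: h3; set a := Ex P (fun w => xsum n w ^+ 2) in h2 *.
  rewrite (eq_Ex (g := fun w => Z w * xsum n w ^+ 2 - a * Z w)) => [|w].
    rewrite ExB//; last by apply: igZ; exact: ig1.
    rewrite ExZ; last exact: ig1.
    rewrite Ex_mul_qsum//.
    move: h1; set b := Ex P _; set c := Ex P _ => h1 h3.
    have h4 : `|Ex P Z * (a - n%:R * s ^+ 2)| <= N3 P Z * tr n m.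
      by rewrite normrM; apply: ler_pM => //; exact: Ex1_le.
    have -> : c - n%:R * s ^+ 2 * Ex P Z = - (b - c) + (b - a * Ex P Z) +
      Ex P Z * (a - n%:R * s ^+ 2).
      by ring.
    apply: le_trans (ler_normD _ _) _; rewrite (_ : N3 P Z * _ =
       (N3 P Z * tr n m + N3 P Z * wv n) + N3 P Z * tr n m); last by ring.
    apply: lerD => //; apply: le_trans (ler_normD _ _) _; rewrite normrN.
    exact: lerD.
  by ring.
by ring.
Qed.

Let qsum_shift n k w : qsum mdiff s n (th k w) = qsum mdiff s (k + n) w - qsum mdiff s k w.
Proof.
elim: n => [|n IH]; first by rewrite addn0 subrr /qsum big_ord0.
rewrite addnS !qsumS IH /mdiff -iterD addnC; ring.
Qed.

(** Stationarity: composing with the k-th iterate of [tauV] moves the block to time 0 and the test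
    function from [F k] to [F0]. *)
Let block1 k n m Z : (0 < m)%N -> Gm (F k) Z -> L3 P Z ->
  `|Ex P (fun w => Z w * (qsum mdiff s (k + n) w - qsum mdiff s k w))| <=
  N3 P Z * (2 * tr n m + wv n).
Proof.
move=> m0 GZ LZ; have GZ' := Gm_filtV tauVK GZ.
have LZ' : L3 P (fun w => Z (thV k w)) by exact: (L3_comp (mthV k) (@thVP k)).
have := qsum_bound n m0 GZ' LZ'.
rewrite (N3_comp (mthV k) (@thVP k) (L3_meas LZ)).
rewrite -(Ex_comp (mth k) (@thP k)); last exact: ig_meas (ig_Mqsum s mdiff_L3 n LZ').
rewrite (eq_Ex (g := fun w => Z w * (qsum mdiff s (k + n) w - qsum mdiff s k w)))//.
by move=> w; rewrite (iterK tauK) qsum_shift.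
Qed.

(* Splitting the block at each [j <= n] and averaging over [j] and over the lags
   [m <= N] replaces bounds at single times by Cesaro means. *)
Lemma block_bound k n N Z : (0 < N)%N -> (0 < n)%N -> Gm (F k) Z -> L3 P Z ->
  `|Ex P (fun w => Z w * (qsum mdiff s (k + n) w - qsum mdiff s k w))| <=
  N3 P Z * (64 * K ^+ 2 * (1 + Num.sqrt N%:R) +
    16 * K * Num.sqrt n%:R * (N%:R^-1 * \sum_(1 <= m < N.+1) tail_size m) +
    2 * (n%:R^-1 * \sum_(1 <= j < n.+1) wv j)).
Proof.
move=> N0 n0 GZ LZ; set X := `|_|; set NZ := N3 P Z.
have NZ0 : 0 <= NZ by exact: N3_ge0.
have e0 m : 0 <= tail_size m by rewrite addr_ge0 ?N3_ge0.
(* The block is cut at [j]; the second piece starts at [k + j], where [Z] is still a valid test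
   function. Both pieces use the same lag [m]. *)
have step j m : (0 < m <= N)%N -> (j <= n)%N ->
    X <= NZ * (64 * K ^+ 2 * (1 + Num.sqrt N%:R)) + NZ * (wv j + wv (n - j)) +
         NZ * (16 * K * Num.sqrt n%:R * tail_size m).
  move=> /andP[m0 mN] jn.
  have GZ' : Gm (F (k + j)) Z by apply: Gm_sub GZ; apply: filt_le; exact: leq_addr.
  have h1 := block1 j m0 GZ LZ.
  have h2 := block1 (n - j) m0 GZ' LZ.
  have iq i : ig P (fun w => Z w * qsum mdiff s i w) by exact: (ig_Mqsum s mdiff_L3 i LZ).
  have iqB i1 i2 : ig P (fun w => Z w * (qsum mdiff s i1 w - qsum mdiff s i2 w)).
    by have := igB (iq i1) (iq i2); congr ig; apply/funext => w; ring.
  rewrite -addnA subnKC// in h2.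
  have trm i : (i <= n)%N -> tr i m <= 16 * K ^+ 2 * (1 + Num.sqrt N%:R) +
    4 * K * Num.sqrt n%:R * tail_size m.
    move=> i_n; apply: lerD.
      by apply: ler_wpM2l; [rewrite mulr_ge0// exprn_ge0|rewrite lerD2l ler_wsqrtr//
        ler_nat].
    apply: ler_wpM2r => //; apply: ler_wpM2l; first by rewrite mulr_ge0.
    by rewrite ler_wsqrtr// ler_nat.
  apply: (@le_trans _ _ (NZ * (2 * tr j m + wv j) + NZ * (2 * tr (n - j) m + wv (n - j)))).
    apply: le_trans (lerD h1 h2); rewrite /X.
    apply: le_trans (ler_normD _ _); rewrite -ExD//.
    by rewrite le_eqVlt; apply/orP; left; apply/eqP; congr `|_|; apply: eq_Ex => w; ring.
  rewrite -!mulrDr; apply: ler_wpM2l => //.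
  have := trm j jn; have := trm (n - j)%N (leq_subr _ _); lra.
have h1 j : (0 < j <= n)%N -> X <= (NZ * (64 * K ^+ 2 * (1 + Num.sqrt N%:R)) +
   N%:R^-1 * \sum_(1 <= m < N.+1) (NZ * (16 * K * Num.sqrt n%:R * tail_size m))) +
   NZ * (wv j + wv (n - j)).
  move=> /andP[j0 jn]; rewrite addrAC; apply: le_average => // m hm; exact: step.
have := le_average n0 h1; rewrite -!mulr_sumr => /le_trans; apply.
rewrite [leRHS]mulrDr [X in _ <= X + _]mulrDr; apply: lerD; first apply: lerD => //.
  by rewrite le_eqVlt; apply/orP; left; apply/eqP; ring.
rewrite mulrCA; apply: ler_wpM2l => //; rewrite mulrCA; apply: ler_wpM2l;
  first by rewrite invr_ge0.
rewrite big_split/= mulr2n mulrDl !mul1r; apply: lerD => //.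
(* Reflecting j into n - j gives the sum of [wv] over 0, ..., n - 1; as [wv 0 = 0], it is at most
   the unreflected sum. *)
rewrite big_nat_rev/= big_add1/=.
rewrite (eq_big_nat _ _ (F2 := wv)) => [|i /andP[_ hi]]; last first.
  congr wv; lia.
rewrite [leRHS]big_add1/=.
have -> : \sum_(0 <= i < n) wv i = \sum_(0 <= i < n.-1) wv i.+1.
  by case: (n) n0 => // n' _; rewrite big_nat_recl// wv0 add0r.
rewrite (big_cat_nat (leq0n n.-1) (leq_pred n))/= lerDl.
by apply: sumr_ge0.
Qed.

(** * Covariance series and limiting variance *)

Let ae_incr : {ae P, forall w, x (tau w) = E1 w + corr w - corr (tau w)}.
Proof. by apply: filterS E1ae => w <-; rewrite /incr; ring. Qed.

Let mP (f : T -> R) : ig P f -> measurable_fun setT f.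
Proof. exact: ig_meas. Qed.

Let ExT f : ig P f -> Ex P (fun w => f (tau w)) = Ex P f.
Proof. by move=> fi; exact: (Ex_comp (mth 1) (@thP 1) (ig_meas fi)). Qed.

(** The left side is the sum of E (X_0 X_k) over 1 <= k <= n; on the right only two terms depend on
    [n], and both will tend to 0. *)
Lemma Ex_x_xsum n : Ex P (fun w => x w * xsum n w) =
  Ex P (fun w => corr w * mdiff n w) - Ex P (fun w => corr w * E1 w) +
  Ex P (fun w => x w * corr w) - Ex P (fun w => x w * corr (th n w)).
Proof.
have LW := L3_corr; have LWn := L3th n LW; have LW1 := L3th 1 LW.
have LM := M_L3 n; have LMS := M_L3 n.+1; have LX := xsum_L3 n.
have LMt := L3th 1 LM; have LD := mdiff_L3 n; have Lxt := L3th 1 Lx.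
transitivity (Ex P (fun w => x w * M n w) + Ex P (fun w => x w * corr w) -
    Ex P (fun w => x w * corr (th n w))).
  rewrite -ExD; [|exact: ig2|exact: ig2].
  rewrite -ExB; [|by apply: igD; exact: ig2|exact: ig2].
  apply: ae_Ex; [by apply: mP; exact: ig2| |].
    by apply: mP; apply: igB; [apply: igD|]; exact: ig2.
  by apply: filterS (xsumE n) => w ->; ring.
congr (_ + _ - _).
have MT w : M n (tau w) = M n.+1 w - E1 w.
  elim: (n) => [|k IH]; first by rewrite msumS !msum0 add0r subrr.
  by rewrite msumS IH [in RHS]msumS /mdiff -iterSr; ring.
(* Moving time by one step turns x into x o tau, which the decomposition rewrites with [E1] and
   [corr]. *)
rewrite -(ExT (ig2 Lx LM)).
transitivity (Ex P (fun w => E1 w * (M n.+1 w - E1 w)) +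
   Ex P (fun w => corr w * (M n.+1 w - E1 w)) - Ex P (fun w => corr (tau w) * M n (tau w))).
  rewrite -ExD; [|by apply: ig2 => //; exact: L3B|by apply: ig2 => //; exact: L3B].
  rewrite -ExB; [|by apply: igD; apply: ig2 => //; exact: L3B|exact: ig2].
  apply: ae_Ex; [by apply: mP; exact: (ig2 Lxt LMt)| |].
    by apply: mP; apply: igB; [apply: igD; apply: ig2 => //;
      exact: L3B|exact: (ig2 LW1 LMt)].
  by apply: filterS ae_incr => w ->; rewrite MT; ring.
rewrite (orthM0 (sF 1) (@FT 1)) => [||//|]; last first.
- by apply: ig2 => //; exact: L3B.
- have := orth_tail (ltn0Sn n); congr orth; apply/funext => w.
  by rewrite [X in _ - X]msumS msum0 add0r.
rewrite add0r (ExT (ig2 LW LM)).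
rewrite -ExB; [|by apply: ig2 => //; exact: L3B|exact: ig2].
rewrite -ExB; [|exact: ig2|exact: ig2].
by apply: eq_Ex => w; rewrite msumS; ring.
Qed.

(** Apart from the shifted tail [B n], [corr] is [F n]-measurable up to null sets, and [mdiff n] is
    orthogonal to that part. *)
Let corr_mdiff_le n : (0 < n)%N -> `|Ex P (fun w => corr w * mdiff n w)| <= K * N3 P (B n).
Proof.
move=> n0; have [A' [GA' LA' aA']] := A_meas; have [G' [GG' LG' aG']] := B_meas n0.
have LD := mdiff_L3 n; have LW := L3_corr; have LBn := L3th n (L3_B n0).
have -> : Ex P (fun w => corr w * mdiff n w) = Ex P (fun w => (A' w - G' w) * mdiff n w) -
    Ex P (fun w => mdiff n w * B n (th n w)).
  rewrite -ExB; [|by apply: ig2 => //; exact: L3B|exact: ig2].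
  apply: ae_Ex; [by apply: mP; exact: ig2| |].
    by apply: mP; apply: igB; apply: ig2 => //; exact: L3B.
  by apply: filterS2 aA' aG' => w e1 e2; rewrite -e1 -e2 /corr; ring.
rewrite (orthM0 (sF n) (@FT n) (mdiff_orth n)).
- rewrite sub0r normrN; apply: le_trans (Ex2_le LD LBn) _.
  rewrite N3_mdiff N3th; last exact: L3_B.
  by apply: ler_wpM2r => //; exact: N3_ge0.
- by apply: (GmB (sF n)) => //; exact: Gm_sub (@F0_filt n) GA'.
- by apply: ig2 => //; exact: L3B.
Qed.

Let Lft k : L3 P (future_term k). Proof. exact: (L3B (LxV k) (Lg k)). Qed.

(* [x] is within [N3 P (future_term m)] of the [F m]-measurable function
   [g m \o th m]. *)
Let x_split m w : x w = g m (th m w) + future_term m (th m w).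
Proof. by rewrite /future_term -/(g m _) iterK// addrC subrK. Qed.

Let x_B0_le n : `|Ex P (fun w => x w * B0 (th n w))| <= K * N3 P (future_term n).
Proof.
have LB := L3th n L3_B0; have Lf := L3th n (Lft n); have LG := L3th n (Lg n).
rewrite (eq_Ex (g := fun w => g n (th n w) * B0 (th n w) +
  B0 (th n w) * future_term n (th n w))) => [|w].
  rewrite ExD; [|exact: ig2|exact: ig2].
  rewrite (orthM0 (sF n) (@FT n) (orth_filt0_comp n B0_orth)); last exact: ig2.
    rewrite add0r; apply: le_trans (Ex2_le LB Lf) _; rewrite !N3th//; last exact: L3_B0.
    by apply: ler_wpM2r => //; exact: N3_ge0.
  exact: Gm_filt0_comp.
by rewrite (x_split n); ring.
Qed.

(** After [x] is replaced by its [F m]-measurable approximation, A_1 o T^n may be projected on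
    [F m], leaving the tail of index n - m + 1. The choice m = n/2 will make both errors small. *)
Let x_A_le n m : (m <= n)%N -> `|Ex P (fun w => x w * A 1%N (th n w))| <=
  (N3 P x + N3 P (future_term m)) * N3 P (A (n - m).+1) + K * N3 P (future_term m).
Proof.
move=> mn; set k := (n - m)%N.
have nE w : th n w = th k (th m w) by rewrite -iterD subnK.
have LA1 := L3th n (L3_A (ltn0Sn 0)); have LAk := L3th m (L3_A (ltn0Sn k)).
have Lf := L3th m (Lft m); have LG := L3th m (Lg m).
rewrite (eq_Ex (g := fun w => g m (th m w) * (A 1%N (th n w) - A k.+1 (th m w)) +
   g m (th m w) * A k.+1 (th m w) + A 1%N (th n w) * future_term m (th m w))) => [|w].
  rewrite ExD; [|by apply: igD; apply: ig2 => //; exact: L3B|exact: ig2].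
  rewrite ExD; [|by apply: ig2 => //; exact: L3B|exact: ig2].
  rewrite (orthM0 (sF m) (@FT m)); last first.
  - by apply: ig2 => //; exact: L3B.
  - exact: Gm_filt0_comp.
  - have := orth_filt0_comp m (A_orth k).
    by congr orth; apply/funext => w; rewrite nE.
  rewrite add0r; apply: le_trans (ler_normD _ _) _; apply: lerD.
    apply: le_trans (Ex2_le LG LAk) _; rewrite [X in _ * X]N3th; last exact: L3_A.
    apply: ler_wpM2r; first exact: N3_ge0.
    rewrite -[X in _ <= _ + X](N3th m)//; apply: le_trans (N3B Lx Lf).
    rewrite le_eqVlt; apply/orP; left; apply/eqP; apply: eq_N3 => w.
    by rewrite (x_split m); congr `|_|; ring.
  apply: le_trans (Ex2_le LA1 Lf) _; rewrite !N3th//; last exact: L3_A.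
  by apply: ler_wpM2r; [exact: N3_ge0|exact: KA].
by rewrite (x_split m); ring.
Qed.

Lemma Ex_x_xsum_cvg : Ex P (fun w => x w * xsum n w) @[n --> \oo] -->
  Ex P (fun w => x w * corr w) - Ex P (fun w => corr w * E1 w).
Proof.
have nA : null (fun n => N3 P (A n)) by move=> e; exact: (tail_cvg0 tailA).
have nB : null (fun n => N3 P (B n)) by move=> e; exact: (tail_cvg0 tailB).
have nf : null (fun n => N3 P (future_term n)) by move=> e; exact: (term_cvg0 tailB).
have c1 : Ex P (fun w => corr w * mdiff n w) @[n --> \oo] --> 0.
  apply: (null_cvg (nullMl K0 nB)); exists 1%N => n n0; exact: corr_mdiff_le.
have [Kf [Kf0 hKf]] : exists Kf, 0 <= Kf /\ forall n, N3 P (future_term n) <= Kf.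
  have [Kg hKg] : exists K, forall n, N3 P (future_term n) <= K.
    have [N hN] := nf _ ltr01.
    exists (1 + \sum_(i < N) N3 P (future_term i)) => n.
    have s0 : 0 <= \sum_(i < N) N3 P (future_term i) by apply: sumr_ge0 => i _;
      exact: N3_ge0.
    have [/hN h|h] := leqP N n; first by lra.
    rewrite (bigD1 (Ordinal h))//= addrCA lerDl addr_ge0//.
    by apply: sumr_ge0 => i _; exact: N3_ge0.
  by exists Kg; split=> //; exact: le_trans (N3_ge0 _ _) (hKg 0%N).
have c2 : Ex P (fun w => x w * corr (th n w)) @[n --> \oo] --> 0.
  have NK0 : 0 <= N3 P x + Kf by rewrite addr_ge0 ?N3_ge0.
  apply: (null_cvg (nullD (nullD (nullMl NK0 (null_half_compl nA))
    (nullMl K0 (null_half nf))) (nullMl K0 nf))); exists 0%N => n _.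
  have LA := L3th n (L3_A (ltn0Sn 0)); have LB := L3th n L3_B0.
  rewrite (eq_Ex (g := fun w => x w * A 1%N (th n w) - x w * B0 (th n w))) => [|w].
    rewrite ExB; [|exact: ig2|exact: ig2].
    apply: le_trans (ler_normB _ _) _; apply: lerD; last exact: x_B0_le.
    apply: le_trans (x_A_le (_ : n./2 <= n)%N) _; first by lia.
    rewrite lerD2r; apply: ler_wpM2r; first exact: N3_ge0.
    by rewrite lerD2l.
  by rewrite /corr; ring.
under eq_fun do rewrite Ex_x_xsum.
rewrite (_ : Ex P (fun w => x w * corr w) - Ex P (fun w => corr w * E1 w) =
  0 - Ex P (fun w => corr w * E1 w) + Ex P (fun w => x w * corr w) - 0); last by ring.
exact: (cvgB (cvgD (cvgB c1 (cvg_cst _)) (cvg_cst _)) c2).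
Qed.

(** Squaring corr o tau = E1 + corr - x o tau, the second moments of [corr] cancel by stationarity.
    The bracket is the limit found in [Ex_x_xsum_cvg], so the variance of the increments is the sum
    of the covariance series. *)
Lemma mdiff_varE : s ^+ 2 = Ex P (fun w => x w ^+ 2) +
  2 * (Ex P (fun w => x w * corr w) - Ex P (fun w => corr w * E1 w)).
Proof.
have LW := L3_corr; have LW1 := L3th 1 LW; have Lxt := L3th 1 Lx.
have q0 : Ex P (fun w => E1 w ^+ 2) = s ^+ 2 by exact: (Ex_mdiff_sqr 0).
have aW : {ae P, forall w, corr (tau w) = E1 w + corr w - x (tau w)}.
  by apply: filterS ae_incr => w ->; ring.
have h1 : Ex P (fun w => x w * corr w) = Ex P (fun w => x (tau w) * E1 w) +
   Ex P (fun w => x (tau w) * corr w) - Ex P (fun w => x w ^+ 2).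
  rewrite -(ExT (ig2 Lx LW)) -(ExT (ig_sqr Lx)).
  rewrite -ExD; [|exact: ig2|exact: ig2].
  rewrite -ExB; [|by apply: igD; exact: ig2|exact: ig_sqr].
  apply: ae_Ex; first by apply: mP; exact: ig2.
    by apply: mP; apply: igB; [apply: igD; exact: ig2|exact: ig_sqr].
  by apply: filterS aW => w ->; ring.
have h2 : Ex P (fun w => corr w ^+ 2) = Ex P (fun w => E1 w ^+ 2) + Ex P (fun w =>
  corr w ^+ 2)
   + Ex P (fun w => x w ^+ 2) + 2 * (Ex P (fun w => corr w * E1 w) -
   Ex P (fun w => x (tau w) * E1 w) - Ex P (fun w => x (tau w) * corr w)).
  rewrite -[LHS](ExT (ig_sqr LW)) -(ExT (ig_sqr Lx)).
  have i1 : ig P (fun w => E1 w ^+ 2 + corr w ^+ 2) by apply: igD; exact: ig_sqr.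
  have i2 : ig P (fun w => E1 w ^+ 2 + corr w ^+ 2 + x (tau w) ^+ 2).
    by apply: igD => //; exact: ig_sqr.
  have i3 : ig P (fun w => corr w * E1 w - x (tau w) * E1 w) by apply: igB; exact: ig2.
  have i4 : ig P (fun w => corr w * E1 w - x (tau w) * E1 w - x (tau w) * corr w).
    by apply: igB => //; exact: ig2.
  rewrite -ExD; [|exact: ig_sqr|exact: ig_sqr].
  rewrite -ExD; [|by []|exact: ig_sqr].
  rewrite -ExB; [|exact: ig2|exact: ig2].
  rewrite -ExB; [|by []|exact: ig2].
  rewrite -ExZ// -ExD//; last exact: igZ.
  apply: ae_Ex; first by apply: mP; exact: ig_sqr.
    by apply: mP; apply: igD => //; exact: igZ.
  by apply: filterS aW => w ->; ring.
by rewrite q0 in h2; lra.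
Qed.
Variables SE SW : R.
Hypothesis hE : forall n, \sum_(1 <= m < n) tail_size m * m%:R^-1 <= SE.
Hypothesis hW : forall n, \sum_(1 <= m < n) wv m * (m%:R * Num.sqrt m%:R)^-1 <= SW.

Local Notation gam := (normal_prob (0 : R) 1).
Local Notation sq n := (Num.sqrt (n%:R : R)).

Let xsum_rest n : {ae P, forall w, xsum n w = M n w + rest n w}.
Proof. by apply: filterS (xsumE n) => w e; rewrite e /rest; ring. Qed.

Lemma xsum_gaussian r : 1 <= r <= 3 -> exists2 C, 0 <= C &
  forall f n L, tame r f -> (0 < n <= 2 ^ L)%N ->
  `|Ex P (fun w => f (xsum n w / sq n)) - Ex gam (fun y => f (s * y))| <=
  C * ((sq n)^-1 + sq n `^ (- r) * \sum_(0 <= i < 2 ^ L) sq i.+1 `^ (r - 3)).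
Proof.
have e0 m : 0 <= tail_size m by rewrite addr_ge0 ?N3_ge0.
have Dk k : N3 P (mdiff k) <= K by rewrite N3_mdiff.
(* Lags go up to [2 ^ l./2], about the square root of the block length: sqrt(lag / length) is then
   geometric in [l], while the tails are still averaged over growing ranges. *)
have b k l Z (GZ : Gm (F k) Z) (LZ : L3 P Z) :=
  @block_bound k (2 ^ l) (2 ^ l./2) Z (expn_gt0 _ _) (expn_gt0 _ _) GZ LZ.
apply: (gaussian_comparison sF FT FS mdiff_Gm mdiff_L3 mdiff_orth Dk (sqrtr_ge0 _)
  Ex_mdiff_sqr _ b _ xsum_L3 rest_L3 rest_le xsum_rest) => [l|L].
  by rewrite !addr_ge0// ?mulr_ge0// ?addr_ge0// ?mulr_ge0// ?invr_ge0// ?sumr_ge0//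
    exprn_ge0.
exact: block_weights K0 e0 wv_ge0 hE hW.
Qed.

(** Standard deviations are compared, since the normal laws will be coupled as s Y and sigma_n Y
    with the same Y. If s > 0 the bound on variances is divided by s; if s = 0, S_n is just the
    bounded coboundary. *)
Lemma xsum_std : exists2 C, 0 <= C & forall n, (0 < n)%N ->
  `|Num.sqrt (n%:R^-1 * Ex P (fun w => xsum n w ^+ 2)) - s| <= C / sq n.
Proof.
have s_ge0 : 0 <= s by exact: sqrtr_ge0.
have [s_gt0|s_le0] := ltP 0 s.
  (* [transfer] at [m = 1] gives 32 K^2 + 8 K^2 sqrt n, at most 40 K^2 sqrt n. *)
  exists (40 * K ^+ 2 / s) => [|n n0]; first by rewrite divr_ge0// mulr_ge0// exprn_ge0.
  have c1 : 1 <= sq n by rewrite -[leLHS]sqrtr1 ler_wsqrtr// ler1n.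
  have := transfer n (Gm_cst F0_sigma 1) (L3_cst P 1) (ltn0Sn 0).
  rewrite N3_cst normr1 mul1r sqrtr1.
  rewrite (eq_Ex (g := fun w => xsum n w ^+ 2 - M n w ^+ 2)) => [|w]; last exact: mul1r.
  have LX := xsum_L3 n.
  rewrite ExB ?Ex_msum_sqr => [h||]; [|exact: ig_sqr|exact: ig_sqr].
  set m2 := Ex P _ in h *; set v := n%:R^-1 * m2.
  have m20 : 0 <= m2 by apply: Ex_ge0 => w; exact: sqr_ge0.
  have v0 : 0 <= v by rewrite mulr_ge0// invr_ge0.
  have sqn : sq n ^+ 2 = n%:R by rewrite sqr_sqrtr.
  have c0 : 0 < sq n by lra.
  have m2E : m2 = sq n ^+ 2 * v by rewrite /v mulrA sqn divff ?mul1r// pnatr_eq0 -lt0n.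
  have K2 : 0 <= K ^+ 2 by exact: exprn_ge0.
  have t1 : tail_size 1 <= 2 * K by have := KA (ltn0Sn 1); have := KB (ltn0Sn 0);
    rewrite /tail_size; lra.
  have {}h : `|v - s ^+ 2| <= 40 * K ^+ 2 / sq n.
    rewrite ler_pdivlMr// -(ler_pM2r c0) -mulrA -expr2 -[X in _ * X](ger0_norm (sqr_ge0 _)).
    rewrite -normrM mulrBl -[v * _]mulrC -m2E [s ^+ 2 * _]mulrC sqn.
    apply: le_trans h _.
    have : 4 * K * sq n * tail_size 1 <= 4 * K * sq n * (2 * K).
      by apply: ler_wpM2l => //; rewrite !mulr_ge0.
    have : K ^+ 2 * 1 <= K ^+ 2 * sq n by exact: ler_wpM2l.
    lra.
  rewrite mulrAC ler_pdivlMr//; apply: le_trans h.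
  have q0 := sqrtr_ge0 v.
  have -> : v - s ^+ 2 = (Num.sqrt v - s) * (Num.sqrt v + s).
    by rewrite -{1}(sqr_sqrtr v0); ring.
  rewrite normrM; apply: ler_wpM2l => //.
  by rewrite ger0_norm ?addr_ge0// lerDr.
have sz : s = 0 by apply/eqP; rewrite eq_le s_le0.
exists (4 * K) => [|n n0]; first by rewrite mulr_ge0.
have c0 : 0 < sq n by rewrite sqrtr_gt0 ltr0n.
have sqn : sq n ^+ 2 = n%:R by rewrite sqr_sqrtr.
rewrite sz subr0 ger0_norm ?sqrtr_ge0//.
have LR := rest_L3 n.
have -> : Ex P (fun w => xsum n w ^+ 2) = Ex P (fun w => rest n w ^+ 2).
  apply: ae_Ex; try by apply: (@ig_meas _ _ _ P); apply: ig_sqr => //; exact: xsum_L3.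
  have M0 := @msum_ae0 _ _ _ P _ _ mdiff_L3 Ex_mdiff_sqr n sz.
  by apply: filterS2 (xsum_rest n) M0 => w -> ->; rewrite add0r.
have r16 : Ex P (fun w => rest n w ^+ 2) <= (4 * K) ^+ 2.
  apply: (@le_trans _ _ (N3 P (rest n) ^+ 2)).
    by rewrite expr2; apply: le_trans (ler_norm _) _; exact: Ex2_le.
  by rewrite lerXn2r ?nnegrE ?N3_ge0 ?mulr_ge0.
rewrite -[leRHS]ger0_norm ?divr_ge0 ?mulr_ge0 ?(ltW c0)// -sqrtr_sqr.
rewrite ler_wsqrtr// exprMn exprVn sqn mulrC ler_wpM2r// invr_ge0//.
Qed.

End MartingaleApproximation.
(** * Zolotarev classes and rates *)

Section ZolotarevClass.
Context (R : realType).
Local Notation gam := (normal_prob (0 : R) 1).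

Lemma is_derive_derive1 (f : R -> R) x : derivable f x 1 ->
  is_derive x (1 : R) f (f^`()%classic x).
Proof. by move=> df; rewrite derive1E; exact: derivableP. Qed.

Let norm_shift (x c y : R) : `|c| <= `|y| -> `|x + c| <= `|x| + `|y|.
Proof. by move=> cy; apply: le_trans (ler_normD _ _) _; rewrite lerD2l. Qed.

(** The Taylor polynomial at 0 is subtracted, up to its constant, because f'(0) and f''(0) are
    unbounded over the class. The remainder then obeys the same estimates whatever the integer order
    of smoothness. *)
Lemma zolotarev_class_tame (r : R) (f : R -> R) : 1 <= r <= 3 -> zolotarev_class r f ->
  exists a b : R, (r <= 2 -> b = 0) /\ tame r (fun x => f x - (a * x + b * x ^+ 2)).
Proof.
move=> /andP[r1 r3] [l [/andP[l1 l2] [df cf] lf]].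
case: l => [|[|[|l]]] in l1 l2 df cf lf *.
- have rE : r = 1 by apply/eqP; rewrite eq_le r1 l2.
  exists 0, 0; split=> //; subst r.
  have lf' x y : `|f (x + y) - f x| <= `|y|.
    by have := lf (x + y) x; rewrite subr0 addrAC subrr add0r powRr1.
  split=> [x y|x]; first by rewrite subrr powRr0 mulr1 !mul0r !addr0 !subr0.
  by exists (f x), 0, 0 => h; rewrite powRr1// !mul0r !addr0 !subr0.
- pose f1 := f^`()%classic; rewrite derive1n1 -/f1 in lf.
  have d1 x : is_derive x (1 : R) f (f1 x).
    by apply: is_derive_derive1; exact: (df 0%N isT).
  have lf1 x y : `|f1 x - f1 y| <= `|x - y| `^ (r - 1) by exact: lf.
  have s0 : 0 <= r - 1 by lra.
  exists (f1 0), 0; split=> //; split=> [x y|x].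
    have [c /(norm_shift x) hxi e] := mean_value x y d1; set xi := x + c in hxi e.
    rewrite !mul0r !addr0 [X in `|X|](_ : _ = (f1 xi - f1 0) * y); last first.
      by rewrite mulrBl -e; ring.
    rewrite normrM mulrC; apply: ler_wpM2l => //; apply: le_trans (lf1 _ _) _.
    by rewrite subr0 ge0_ler_powR ?nnegrE// addr_ge0.
  have tay := taylor1 s0 ler01 d1 (x := x).
  exists (f x - f1 0 * x), (f1 x - f1 0), 0 => h.
  have := tay _ h; rewrite mul1r subrK => hh.
  rewrite [X in `|X|](_ : _ = f (x + h) - f x - f1 x * h); last by ring.
  apply: hh => y; rewrite mul1r; have := lf1 (x + y) x.
  by have -> : x + y - x = y by ring.
- pose f1 := f^`()%classic; pose f2 := f1^`()%classic.
  rewrite derive1nS derive1n1 -/f1 -/f2 in lf.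
  have d1 x : is_derive x (1 : R) f (f1 x).
    by apply: is_derive_derive1; exact: (df 0%N isT).
  have d2 x : is_derive x (1 : R) f1 (f2 x).
    by apply: is_derive_derive1; exact: (df 1%N isT).
  have lf2 x y : `|f2 (x + y) - f2 x| <= 1 * `|y| `^ (r - 2).
    have := lf (x + y) x; have -> : x + y - x = y by ring.
    by rewrite mul1r.
  have s0 : 0 <= r - 2 by lra.
  have s1 : 0 <= r - 1 by lra.
  have rE : r - 2 + 1 = r - 1 by ring.
  exists (f1 0), (f2 0 / 2); split; first by move=> h; exfalso; lra.
  split=> [x y|x].
    pose p := f1 0 *: 'X + (f2 0 / 2) *: ('X * 'X).
    have dg z : is_derive z (1 : R) (fun x => f x - p.[x]) (f1 z - f1 0 - f2 0 * z).
      have := is_derive_poly p z.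
      rewrite /p derivD !derivZ derivM derivX !hornerE/= => dp.
      have := @is_deriveB R R^o R^o f (horner p) z 1 _ _ (d1 z) dp.
      by move=> /is_derive_eq; apply; field.
    have pE z : f1 0 * z + f2 0 / 2 * z ^+ 2 = p.[z] by rewrite /p !hornerE; ring.
    rewrite !pE; have [c /(norm_shift x) hxi ->] := mean_value x y dg.
    set xi := x + c in hxi *.
    rewrite normrM mulrC; apply: ler_wpM2l => //.
    have := taylor1 s0 ler01 d2 (lf2 0) xi; rewrite add0r mul1r rE => /le_trans; apply.
    by apply: (ge0_ler_powR s1 _ _ hxi); rewrite nnegrE ?addr_ge0.
  have tay := taylor2 s0 ler01 d1 d2 (lf2 x).
  exists (f x - f1 0 * x - f2 0 / 2 * x ^+ 2), (f1 x - f1 0 - f2 0 * x),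
    ((f2 x - f2 0) / 2) => h.
  have := tay h; rewrite mul1r subrK.
  move: (f (x + h)) (f x) (f1 x) (f1 0) (f2 x) (f2 0) => u0 u1 u2 u3 u4 u5 tayh.
  by rewrite [X in `|X|](_ : _ = u0 - u1 - u2 * h - u4 * h ^+ 2 / 2)//; field.
- by exfalso; rewrite -!natr1 in l1 l2; have : 0 <= (l%:R : R) by []; lra.
Qed.

Lemma zolotarev_class_continuous (r : R) (f : R -> R) : zolotarev_class r f -> continuous f.
Proof.
move=> [[|l] [_ [df cf] _]]; first exact: cf.
move=> x; apply/differentiable_continuous/derivable1_diffP.
exact: (df 0%N isT).
Qed.

Lemma zolotarev_class_cst0 (r : R) : 0 < r <= 3 -> zolotarev_class r (fun=> 0 : R).
Proof.
move=> /andP[r0 r3].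
have d0 l : derive1n l (fun=> 0 : R) = fun=> 0.
  elim: l => // l IH; rewrite derive1nS IH; apply/funext => x; exact: derive1_cst.
have [l hl] : exists l : nat, l%:R < r <= l.+1%:R.
  have [r1|r1] := leP r 1; first by exists 0%N; rewrite r0.
  have [r2|r2] := leP r 2; first by exists 1%N; rewrite r1.
  by exists 2%N; rewrite r2.
exists l; split=> //; last by move=> x y; rewrite d0 subrr normr0 powR_ge0.
split; first by move=> k _ x; rewrite d0; exact: derivable_cst.
by rewrite d0 => x; exact: cvg_cst.
Qed.

(** The zero function belongs to the class, so the supremum is nonnegative and the absolute value
    costs nothing. *)
Lemma zolotarev_bound (r : R) (mu nu : probability (R : measurableType _) R) (C : R) :
  0 < r <= 3 ->
  (forall f, zolotarev_class r f ->
     (\int[mu]_x (f x)%:E - \int[nu]_x (f x)%:E <= C%:E)%E) ->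
  (`|zolotarev r mu nu| <= C%:E)%E.
Proof.
move=> r03 h; rewrite gee0_abs.
  by apply: ge_ereal_sup => _ [f ff <-]; exact: h.
apply: ereal_sup_ubound; exists (fun=> 0); first exact: zolotarev_class_cst0.
by rewrite !integral0 subee.
Qed.

(** One formula for both branches of [normal0]: for [v <= 0] the square root is 0 and the right side
    is [f 0], as for the Dirac mass. *)
Lemma integral_normal0 (v : R) (f : R -> R) : continuous f ->
  (\int[normal0 v]_x (f x)%:E = \int[gam]_y (f (Num.sqrt v * y))%:E)%E.
Proof.
move=> cf; have mf : measurable_fun setT f by exact: continuous_measurable_fun.
rewrite /normal0; case: ifPn => [v0|]; last first.
  rewrite -leNgt => v0; rewrite integral_dirac//; last exact/measurable_EFinP.
  rewrite diracT mul1e (_ : Num.sqrt v = 0); last exact: ler0_sqrtr.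
  under eq_integral do rewrite mul0r.
  by rewrite (ge0_ExE (ig_cst gam (f 0))) Ex_cst.
have s0 : 0 < Num.sqrt v by rewrite sqrtr_gt0.
have key (h : R -> R) : continuous h -> (forall z, 0 <= h z) ->
    (\int[distribution (normal_prob 0 (Num.sqrt v)) (@Rid R)]_x (h x)%:E =
     \int[gam]_y (h (Num.sqrt v * y))%:E)%E.
  move=> ch h0; have mh : measurable_fun setT (EFin \o h).
    by apply/measurable_EFinP; exact: continuous_measurable_fun.
  have h0' z : (0 <= (EFin \o h) z)%E by rewrite lee_fin.
  have E := @ge0_integral_distribution _ _ _ _ _ (normal_prob 0 (Num.sqrt v)) (@Rid R) _ mh h0'.
  apply: (etrans E) => {E}.
  apply: (etrans (@ge0_integral_normal R 0 (Num.sqrt v) (EFin \o h) mh h0')).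
  apply: (etrans (esym (@ge0_integral_shift R h 0 _ s0 ch h0))).
  by apply: eq_integral => y _; rewrite add0r.
have cmax (h : R -> R) : continuous h -> continuous (fun x => Num.max (h x) 0).
  by move=> ch x; apply: continuous_max; [exact: ch|exact: cvg_cst].
rewrite integralE [RHS]integralE; congr (_ - _)%E.
  transitivity (\int[distribution (normal_prob 0 (Num.sqrt v)) (@Rid R)]_x (Num.max (f x) 0)%:E)%E.
    by apply: eq_integral => x _; rewrite funeposE -EFin_max.
  rewrite key; [|exact: cmax|by move=> z; rewrite le_max lexx orbT].
  by apply: eq_integral => x _; rewrite funeposE -EFin_max.
transitivity (\int[distribution (normal_prob 0 (Num.sqrt v)) (@Rid R)]_x (Num.max (- f x) 0)%:E)%E.
  by apply: eq_integral => x _; rewrite funenegE -EFin_max.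
rewrite (key (fun x => Num.max (- f x) 0)); last first.
- by move=> z; rewrite le_max lexx orbT.
- by apply: cmax => x; apply: cvgN; exact: cf.
by apply: eq_integral => x _; rewrite funenegE -EFin_max.
Qed.

End ZolotarevClass.

Section SummableNorms.
Context (R : realType).

Lemma nneseries_bounded (u : nat -> \bar R) : (forall n, 0 <= u n)%E ->
  (\sum_(1 <= n <oo) u n < +oo)%E ->
  (forall n, (0 < n)%N -> u n \is a fin_num) /\
  exists C, forall N, \sum_(1 <= m < N) fine (u m) <= C.
Proof.
move=> u0 hu; set S := (\sum_(1 <= n <oo) u n)%E in hu.
have S0 : (0 <= S)%E by apply: nneseries_ge0.
have part N : (\sum_(1 <= m < N) u m <= S)%E.
  by apply: nneseries_lim_ge => n _ _; exact: u0.
have uf n : (0 < n)%N -> u n \is a fin_num.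
  move=> n0; rewrite ge0_fin_numE//; apply: le_lt_trans hu.
  apply: le_trans (part n.+1); rewrite big_nat_recr//= leeDr//.
  by apply: sume_ge0.
split=> //; exists (fine S) => N.
rewrite -lee_fin -sumEFin fineK ?ge0_fin_numE//.
apply: le_trans (part N); rewrite big_nat [leRHS]big_nat.
by apply: lee_sum => i /andP[i1 _]; rewrite fineK// uf.
Qed.

End SummableNorms.

Section SummableTails.
Context (d : measure_display) (T : measurableType d) (R : realType).
Variable P : probability T R.

Lemma tails_of_summable (Z : nat -> T -> R) : (forall n, L3 P (Z n)) ->
  tail_norm_summable P 3%:E Z ->
  exists2 A, (forall n, (0 < n)%N -> cvg3 P (fun N w => \sum_(n <= k < N) Z k w) (A n))
  & exists C, forall N, \sum_(1 <= m < N) N3 P (A m) * m%:R^-1 <= C.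
Proof.
move=> LZ [Y hY hS].
have LY n : (0 < n)%N -> L3 P (Y n) by move=> /hY[/L3P].
exists Y => [n n0|].
  have Ls N : L3 P (fun w => \sum_(n <= k < N) Z k w) by exact: L3_sum.
  split=> [//||e e0]; first exact: LY.
  have [_] := hY n n0.
  have -> : (fun N => 'N[P]_3%:E[(fun w => (\sum_(n <= k < N) Z k w - Y n w)%:E)])%E =
      (fun N => (N3 P (fun w => \sum_(n <= k < N) Z k w - Y n w))%:E).
    by apply/funext => N; rewrite -LnormE//; apply: L3B => //; exact: LY.
  move=> /fine_cvg /cvgrPdist_le /(_ e e0)[N _ hN]; exists N => k /hN.
  by rewrite /= sub0r normrN ger0_norm// N3_ge0.
have [] := nneseries_bounded _ hS.
  by move=> n; rewrite mule_ge0 ?Lnorm_ge0// lee_fin invr_ge0.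
move=> _ [C hC]; exists C => N; apply: le_trans (hC N).
rewrite big_nat [leRHS]big_nat; apply: ler_sum => i /andP[i0 _].
by rewrite LnormE; [rewrite -EFinM/= mulrC|exact: LY].
Qed.

End SummableTails.

(** * From tame functions to the Zolotarev distance *)

Section LawBound.
Context (d : measure_display) (T : measurableType d) (R : realType).
Variables (P : probability T R) (X : int -> {mfun T >-> R}).
Local Notation gam := (normal_prob (0 : R) 1).

(** The subtracted polynomial integrates alike under both laws: both have mean 0, and a quadratic
    term can occur only for r > 2, where [hv] makes the variances equal. Hence sigma_n^2 in the
    third regime. *)
Lemma zolotarev_law_bound (r v C : R) n : (0 < n)%N -> 1 <= r <= 3 -> 0 <= v ->
  L3 P (psum X n) -> Ex P (psum X n) = 0 ->
  (2 < r -> v = n%:R^-1 * Ex P (fun w => psum X n w ^+ 2)) ->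
  (forall f, tame r f -> `|Ex P (fun w => f (psum X n w / Num.sqrt n%:R)) -
     Ex gam (fun y => f (Num.sqrt v * y))| <= C) ->
  (`|zolotarev r (psum_law P X n) (normal0 v)| <= C%:E)%E.
Proof.
move=> n0 r13 v0 LS S0 hv hC.
have r03 : 0 < r <= 3 by case/andP: r13 => *; apply/andP; split; lra.
apply: zolotarev_bound => // f ff.
have cf := zolotarev_class_continuous ff.
have mf : measurable_fun setT f by exact: continuous_measurable_fun.
have [a [b [b0 tf]]] := zolotarev_class_tame r13 ff.
set f0 := fun x => f x - (a * x + b * x ^+ 2) in tf.
have fE z : f z = f0 z + (a * z + b * z ^+ 2) by rewrite /f0 subrK.
have split_Ex (d' : measure_display) (T' : measurableType d') (P' : probability T' R)
    (Y : T' -> R) : L3 P' Y -> ig P' (fun w => f (Y w)) /\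
    Ex P' (fun w => f (Y w)) = Ex P' (fun w => f0 (Y w)) +
      (a * Ex P' Y + b * Ex P' (fun w => Y w ^+ 2)).
  move=> LY.
  have i0 := ig_tame r13 tf LY; have i1 := ig1 LY; have i2 := ig_sqr LY.
  have i3 : ig P' (fun w => a * Y w + b * Y w ^+ 2) by apply: igD; exact: igZ.
  have fY : (fun w => f (Y w)) = (fun w => f0 (Y w) + (a * Y w + b * Y w ^+ 2)).
    by apply/funext => w; exact: fE.
  rewrite fY; split; first exact: igD.
  by rewrite (ExD i0 i3) (ExD (igZ a i1) (igZ b i2)) !ExZ.
pose S := psum X n; have c0 : 0 < Num.sqrt (n%:R : R) by rewrite sqrtr_gt0 ltr0n.
have LSn : L3 P (fun w => S w / Num.sqrt n%:R).
  by have := L3Z (Num.sqrt n%:R)^-1 LS; congr L3; apply/funext => w; rewrite mulrC.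
have [i1 e1] := split_Ex _ _ P _ LSn.
have [i2 e2] := split_Ex _ _ gam _ (L3_gam_scale (Num.sqrt v)).
have lawE : (\int[psum_law P X n]_x (f x)%:E = (Ex P (fun w =>
  f (S w / Num.sqrt n%:R)))%:E)%E.
  rewrite -(ge0_ExE i1) /psum_law integral_distribution.
  - apply: eq_integral => w _ /=; congr (f _)%:E.
    by rewrite powRN powR12_sqrt// mulrC.
  - exact/measurable_EFinP.
  - move: i1; congr (integrable _ _ _); apply/funext => w /=; congr (f _)%:E.
    by rewrite powRN powR12_sqrt// mulrC.
have normE : (\int[normal0 v]_x (f x)%:E = (Ex gam (fun y => f (Num.sqrt v * y)))%:E)%E.
  by rewrite (integral_normal0 v cf) -(ge0_ExE i2).
rewrite lawE normE -EFinB lee_fin e1 e2.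
have -> : Ex P (fun w => S w / Num.sqrt n%:R) = 0.
  rewrite (eq_Ex (g := fun w => (Num.sqrt n%:R)^-1 * S w)) => [|w]; last exact: mulrC.
  by rewrite ExZ ?S0 ?mulr0//; exact: ig1.
have -> : Ex P (fun w => (S w / Num.sqrt n%:R) ^+ 2) = n%:R^-1 * Ex P (fun w => S w ^+ 2).
  rewrite (eq_Ex (g := fun w => n%:R^-1 * S w ^+ 2)) => [|w].
    by rewrite ExZ//; exact: ig_sqr.
  by rewrite exprMn exprVn sqr_sqrtr// mulrC.
have -> : Ex gam (fun y => Num.sqrt v * y) = 0.
  by rewrite ExZ ?Ex_gam_id ?mulr0//; apply/subgauss_ig/subgauss_id.
have -> : Ex gam (fun y => (Num.sqrt v * y) ^+ 2) = v.
  transitivity (Ex gam (fun y => v * y ^+ 2)).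
    by apply: eq_Ex => y; rewrite exprMn sqr_sqrtr.
  by rewrite ExZ ?Ex_gam_sqr ?mulr1//; apply/subgauss_ig/subgaussX/subgauss_id.
have bE : b * (n%:R^-1 * Ex P (fun w => S w ^+ 2)) = b * v.
  by have [/b0 ->|/hv ->//] := leP r 2; rewrite !mul0r.
rewrite bE !mulr0 !add0r opprD addrACA subrr addr0.
exact: le_trans (ler_norm _) (hC _ tf).
Qed.

End LawBound.

(** * From the hypotheses on the stationary sequence to the rates *)

Section Rates.
Context (d : measure_display) (T : measurableType d) (R : realType).
Variable P : probability T R.
Variables tau tauV : {mfun T >-> T}.
Hypothesis tauK : cancel tau tauV.
Hypothesis tauVK : cancel tauV tau.
Hypothesis tauP : forall A, measurable A -> P (tau @^-1` A) = P A.
Variable F0 : set (set T).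
Hypothesis F0_sigma : sigma_algebra setT F0.
Hypothesis F0_measurable : F0 `<=` measurable.
Hypothesis F0_incl : F0 `<=` preimage_set_system setT tau F0.
Variable X : int -> {mfun T >-> R}.
Hypothesis X_stat : forall i w, X i w = X 0 (iterz tau tauV i w).
Hypothesis X_L3 : (X 0 : T -> R) \in Lfun P 3%:E.
Hypothesis X_centered : ('E_P[X 0%R] = 0)%E.
Hypothesis past : tail_norm_summable P 3%:E (fun k => condexp P F0 (X k%:Z)).
Hypothesis future : tail_norm_summable P 3%:E
  (fun k w => X (- k%:Z) w - condexp P F0 (X (- k%:Z)) w).
Hypothesis var : (\sum_(1 <= n <oo) (n%:R `^ (- 2^-1))%:E *
  'N[P]_(3 / 2)%:E[(fun w =>
    (n%:R^-1 * condexp P F0 (fun w' => psum X n w' ^+ 2) w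
       - mean_var P X n)%:E)] < +oo)%E.

Let x : T -> R := X 0.

Let Lx : L3 P x. Proof. exact/L3P. Qed.

Let XpE k : (X k%:Z : T -> R) = fun w => x (iter k tau w).
Proof. by apply/funext => w; rewrite X_stat. Qed.

Let XnE k : (X (- k%:Z) : T -> R) = fun w => x (iter k tauV w).
Proof. by apply/funext => w; rewrite X_stat; case: k. Qed.

Let psumE n : (psum X n : T -> R) = xsum tau x n.
Proof.
apply/funext => w; rewrite /xsum; elim: n => [|n IH].
  by rewrite /psum big_geq// big_ord0.
by rewrite big_ord_recr/= -IH /psum big_nat_recr//= XpE.
Qed.

Let LS n : L3 P (psum X n). Proof. by rewrite psumE; exact: xsum_L3. Qed.

Let Ex_X0 : Ex P x = 0.
Proof.
have h : ((Ex P x)%:E = 'E_P[X 0])%E by rewrite expectation.unlock -(ge0_ExE (ig1 Lx)).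
by apply/EFin_inj; rewrite h X_centered.
Qed.

Let Ex_thk k (f : T -> R) : ig P f -> Ex P (fun w => f (iter k tau w)) = Ex P f.
Proof. by move=> fi; apply: (Ex_comp (iter_meas tau k) (iter_P tauP k));
  exact: ig_meas fi. Qed.

Let Lth k : L3 P (fun w => x (iter k tau w)).
Proof. exact: (L3_comp (iter_meas tau k) (iter_P tauP k)). Qed.

Let LthV k : L3 P (fun w => x (iter k tauV w)).
Proof. exact: (L3_comp (iter_meas tauV k) (iterV_P tauK tauP k)). Qed.

Let Ex_psum n : Ex P (psum X n) = 0.
Proof.
rewrite psumE /xsum Ex_sum => [|i _]; last exact: (ig1 (Lth i.+1)).
by rewrite big1// => i _; rewrite (Ex_thk i.+1 (ig1 Lx)) Ex_X0.
Qed.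

Let mean_varE n : mean_var P X n = n%:R^-1 * Ex P (fun w => psum X n w ^+ 2).
Proof. by rewrite /mean_var Ex.unlock /Rintegral unlock. Qed.

Let covE (Y : {mfun T >-> R}) : L3 P Y -> Ex P Y = 0 ->
  fine (covariance P (X 0) Y) = Ex P (fun w => x w * Y w).
Proof.
move=> LY Y0; have E0 : 'E_P[Y]%E = 0 by rewrite unlock (ge0_ExE (ig1 LY)) Y0.
rewrite covariance.unlock X_centered E0 /= unlock Ex.unlock /Rintegral.
congr fine; apply: eq_integral => w _.
by rewrite -[LHS]/((x w - 0) * (Y w - 0))%:E !subr0.
Qed.

Let cov_p k : fine (covariance P (X 0) (X k%:Z)) = Ex P (fun w => x w * x (iter k tau w)).
Proof.
rewrite covE; first by rewrite XpE.
  by rewrite XpE.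
by rewrite XpE (Ex_thk k (ig1 Lx)) Ex_X0.
Qed.

Let cov_n k : fine (covariance P (X 0) (X (- k%:Z))) = Ex P (fun w =>
  x w * x (iter k tau w)).
Proof.
rewrite covE; last 2 first.
- by rewrite XnE.
- by rewrite XnE (Ex_comp (iter_meas tauV k) (iterV_P tauK tauP k) (L3_meas Lx)) Ex_X0.
rewrite XnE -(Ex_thk k); last exact: ig2.
by apply: eq_Ex => w; rewrite (iterK tauK) mulrC.
Qed.

Let cov_sum (c : R) : Ex P (fun w => x w * xsum tau x n w) @[n --> \oo] --> c ->
  is_sum_int (fun k => fine (covariance P (X 0) (X k))) (Ex P (fun w => x w ^+ 2) + 2 * c).
Proof.
move=> hc.
have E n : \sum_(1 <= k < n.+1) Ex P (fun w => x w * x (iter k tau w)) =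
    Ex P (fun w => x w * xsum tau x n w).
  rewrite big_add1 big_mkord -Ex_sum => [|i _]; last exact: (ig2 Lx (Lth i.+1)).
  by apply: eq_Ex => w; rewrite mulr_sumr.
exists (Ex P (fun w => x w ^+ 2) + c), c; split; last by ring.
- rewrite -cvg_shiftS.
  under eq_fun => n.
    rewrite big_ltn//; under eq_big_nat => k _ do rewrite cov_p; rewrite E cov_p; over.
  exact: (cvgD (cvg_cst _) hc).
- rewrite -cvg_shiftS.
  under eq_fun => n do (under eq_big_nat => k _ do rewrite cov_n; rewrite E).
  exact: hc.
Qed.

Lemma main_rates : exists s : R, [/\ 0 <= s,
    is_sum_int (fun k => fine (covariance P (X 0) (X k))) (s ^+ 2),
    forall n, L3 P (psum X n) /\ Ex P (psum X n) = 0,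
    forall r, 1 <= r <= 3 -> exists2 C, 0 <= C &
      forall f n L, tame r f -> (0 < n <= 2 ^ L)%N ->
      `|Ex P (fun w => f (psum X n w / Num.sqrt n%:R)) -
        Ex (normal_prob (0 : R) 1) (fun y => f (s * y))| <=
      C * ((Num.sqrt n%:R)^-1 + Num.sqrt n%:R `^ (- r) *
        \sum_(0 <= i < 2 ^ L) Num.sqrt i.+1%:R `^ (r - 3)) &
    exists2 C, 0 <= C & forall n, (0 < n)%N ->
      `|Num.sqrt (mean_var P X n) - s| <= C / Num.sqrt n%:R].
Proof.
have Lc n : L3 P (past_term P tau F0 x n) by exact: condexp_L3.
have Lf n : L3 P (future_term P tauV F0 x n).
  by apply: L3B => //; exact: condexp_L3.
have [|A tailA [SA hSA]] := tails_of_summable Lc.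
  by move: past; congr tail_norm_summable; apply/funext => k; rewrite /past_term -XpE.
have [|B tailB [SB hSB]] := tails_of_summable Lf.
  move: future; congr tail_norm_summable; apply/funext => k; apply/funext => w.
  by rewrite /future_term XnE.
have [E1 [E1F E1L E1ae]] :=
  incr_meas tauK tauP F0_sigma F0_measurable F0_incl Lx tailA tailB.
have [KA hKA] := tail_bounded tailA; have [KB hKB] := tail_bounded tailB.
have KA0 := le_trans (N3_ge0 _ _) (hKA 1%N isT).
have KB0 := le_trans (N3_ge0 _ _) (hKB 1%N isT).
have N0 := N3_ge0 P (B0 P tauV F0 x B); have N1 := N3_ge0 P E1.
pose K := KA + KB + N3 P (B0 P tauV F0 x B) + N3 P E1.
have kA n : (0 < n)%N -> N3 P (A n) <= K by move=> /hKA; rewrite /K; lra.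
have kB n : (0 < n)%N -> N3 P (B n) <= K by move=> /hKB; rewrite /K; lra.
have kB0 : N3 P (B0 P tauV F0 x B) <= K by rewrite /K; lra.
have kE : N3 P E1 <= K by rewrite /K; lra.
pose H n w := n%:R^-1 * condexp P F0 (fun w' => psum X n w' ^+ 2) w - mean_var P X n.
pose v n := ('N[P]_(3 / 2)%:E[EFin \o H n])%E.
have [|vfin [SW hSW]] := nneseries_bounded _ var.
  by move=> n; rewrite mule_ge0 ?Lnorm_ge0// lee_fin powR_ge0.
have vf n : (0 < n)%N -> v n \is a fin_num.
  move=> n0; have := vfin n n0; have : 0 < (n%:R `^ (- 2^-1) : R) by apply: powR_gt0;
    rewrite ltr0n.
  move=> p0; rewrite !ge0_fin_numE ?mule_ge0 ?Lnorm_ge0 ?lee_fin ?powR_ge0//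
    -/(H n) -/(v n).
  by case: (v n) => [y|h|]; rewrite ?ltry ?ltNyr//; move: h; rewrite gt0_muley// lte_fin.
(* The factor n undoes the normalisation of S_n^2 by 1/n, so that wv m / (m sqrt m) is the summand
   of the hypothesis [var]. *)
pose wv n := n%:R * fine (v n).
have wv_ge0 n : 0 <= wv n by rewrite mulr_ge0// fine_ge0// Lnorm_ge0.
have wv0 : wv 0 = 0 by rewrite /wv mul0r.
have hW N : \sum_(1 <= m < N) wv m * (m%:R * Num.sqrt m%:R)^-1 <= SW.
  apply: le_trans (hSW N); rewrite big_nat [leRHS]big_nat.
  apply: ler_sum => m /andP[m0 _]; rewrite -/(H m) -/(v m) fineM ?vf//=.
  rewrite powRN powR12_sqrt// /wv invfM.
  have m0' : (m%:R : R) != 0 by rewrite pnatr_eq0 -lt0n.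
  by rewrite mulrACA divff// mul1r mulrC.
(* [tail_size] contains [A m.+1]; since 1/m <= 2/(m + 1), that part is at most twice a shifted copy
   of the series for [A]. *)
have hE N : \sum_(1 <= m < N) tail_size P A B m * m%:R^-1 <= SB + 2 * SA.
  apply: (@le_trans _ _ (\sum_(1 <= m < N) (N3 P (B m) * m%:R^-1) +
      2 * \sum_(1 <= m < N) N3 P (A m.+1) * m.+1%:R^-1)).
    rewrite mulr_sumr -big_split/= big_nat [leRHS]big_nat; apply: ler_sum => m /andP[m0 _].
    rewrite /tail_size mulrDl lerD2l mulrCA; apply: ler_wpM2l; first exact: N3_ge0.
    rewrite -[leLHS]mul1r ler_pdivrMr ?ltr0n// mulrAC ler_pdivlMr ?ltr0n// mul1r.
    by rewrite -natrM ler_nat; lia.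
  apply: lerD => //; rewrite ler_pM2l//; apply: le_trans (hSA N.+1).
  rewrite [leRHS]big_add1/=; case: N => [|N]; first by rewrite !big_geq.
  rewrite [leRHS]big_ltn// lerDr mulr_ge0 ?N3_ge0// invr_ge0//.
have wvar n Z : Gm F0 Z -> L3 P Z ->
    `|Ex P (fun w => Z w * (xsum tau x n w ^+ 2 - Ex P (fun w => xsum tau x n w ^+ 2)))| <=
    N3 P Z * wv n.
  move=> GZ LZ; rewrite -psumE.
  have [->|n0] := posnP n.
    rewrite wv0 mulr0 (eq_Ex (g := fun=> 0)) ?Ex_cst ?normr0// => w.
    rewrite psumE /xsum big_ord0 (eq_Ex (g := fun=> 0)) ?Ex_cst ?expr0n ?subr0 ?mulr0//.
    by move=> ?; rewrite big_ord0 expr0n.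
  have n0' : (n%:R : R) != 0 by rewrite pnatr_eq0 -lt0n.
  have iS := ig_sqr (LS n).
  have [GY iY oY] := condexp_spec F0_sigma F0_measurable iS.
  have mH : measurable_fun setT (H n).
    by apply: measurable_funB => //; apply: measurable_funM => //; exact: ig_meas iY.
  have mZ := L3_meas LZ.
  (* Hoelder with exponents 3 and 3/2 turns the norm of [H n] into a bound on its pairings with
     [Z]. *)
  have hol : (\int[P]_w `|(Z w * H n w)%:E| <= (N3 P Z * fine (v n))%:E)%E.
    have c3 : 3^-1 + (3 / 2)^-1 = 1 :> R by field.
    have := hoelder P mZ mH (ltr0n _ 3) (divr_gt0 (ltr0n _ 3) (ltr0n _ 2)) c3.
    by rewrite Lnorm1 -/(v n) (LnormE LZ) EFinM fineK ?vf.
  have iZH : ig P (fun w => Z w * H n w).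
    apply/integrableP; split; first by apply/measurable_EFinP; exact: measurable_funM.
    by apply: le_lt_trans hol _; exact: ltry.
  have hZH : `|Ex P (fun w => Z w * H n w)| <= N3 P Z * fine (v n).
    apply: le_trans (ler_abs_Ex iZH) _.
    by rewrite -lee_fin -(ge0_ExE (ig_abs iZH)).
  have e : Ex P (fun w => psum X n w ^+ 2) = n%:R * mean_var P X n.
    by rewrite mean_varE mulrA divff// mul1r.
  have iZ := ig1 LZ.
  have iZS : ig P (fun w => Z w * psum X n w ^+ 2).
    by have := ig3 LZ (LS n) (LS n); congr ig; apply/funext => w; ring.
  have YE w : condexp P F0 (fun w' => psum X n w' ^+ 2) w = n%:R * H n w +
    n%:R * mean_var P X n.
    by rewrite /H; field.
  have iZSY : ig P (fun w => (psum X n w ^+ 2 - condexp P F0 (fun w' => psum X n w' ^+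
    2) w) * Z w).
    have := igB iZS (igD (igZ n%:R iZH) (igZ (n%:R * mean_var P X n) iZ)).
    by congr ig; apply/funext => w; rewrite YE; ring.
  rewrite (eq_Ex (g := fun w => (psum X n w ^+ 2 - condexp P F0 (fun w' => psum X n w' ^+
    2) w) * Z w
     + n%:R * (Z w * H n w))) => [|w]; last by rewrite e YE; ring.
  rewrite ExD//; last exact: igZ.
  rewrite (orthM F0_sigma F0_measurable oY GZ iZSY) add0r ExZ// normrM ger0_norm//.
  by rewrite /wv mulrCA ler_wpM2l.
exists (Num.sqrt (Ex P (fun w => E1 w ^+ 2))); split.
- exact: sqrtr_ge0.
- have hc := Ex_x_xsum_cvg tauK tauP F0_sigma F0_measurable F0_incl Lx tailA tailB E1F E1L E1ae kA kB0 kE.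
  rewrite (mdiff_varE tauK tauP F0_sigma F0_measurable Lx tailA tailB E1L E1ae).
  exact: cov_sum hc.
- by [].
- move=> r r13.
  have := xsum_gaussian tauK tauVK tauP F0_sigma F0_measurable F0_incl Lx tailA tailB
    E1F E1L E1ae kA kB kB0 kE wv_ge0 wv0 wvar hE hW r13.
  move=> [C C0 hC]; exists C => // f n L tf nL; rewrite psumE; exact: hC.
- have [C C0 hC] := xsum_std tauK tauP F0_sigma F0_measurable F0_incl Lx tailA tailB
    E1F E1L E1ae kA kB kB0 kE.
  by exists C => // n n0; rewrite mean_varE psumE; exact: hC.
Qed.

End Rates.

Theorem theorem3p2 (R : realType) (d : measure_display) (T : measurableType d)
    (P : probability T R)
    (tau tauV : {mfun T >-> T})
    (tauK : cancel tau tauV) (tauVK : cancel tauV tau)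
    (tauP : forall A, measurable A -> P (tau @^-1` A) = P A)
    (F0 : set (set T))
    (F0_sigma : sigma_algebra setT F0)
    (F0_measurable : F0 `<=` measurable)
    (F0_incl : F0 `<=` preimage_set_system setT tau F0)
    (X : int -> {mfun T >-> R})
    (X_stat : forall i w, X i w = X 0 (iterz tau tauV i w))
    (X_L3 : (X 0 : T -> R) \in Lfun P 3%:E)
    (X_centered : ('E_P[X 0%R] = 0)%E)
    (past : tail_norm_summable P 3%:E (fun k => condexp P F0 (X k%:Z)))
    (future : tail_norm_summable P 3%:E
       (fun k w => X (- k%:Z) w - condexp P F0 (X (- k%:Z)) w))
    (var : (\sum_(1 <= n <oo) (n%:R `^ (- 2^-1))%:E *
       'N[P]_(3 / 2)%:E[(fun w =>
         (n%:R^-1 * condexp P F0 (fun w' => psum X n w' ^+ 2) w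
            - mean_var P X n)%:E)] < +oo)%E) :
  exists sigma2 : R,
    [/\ 0 <= sigma2,
        is_sum_int (fun k => fine (covariance P (X 0) (X k))) sigma2,
        ereal_bigO
          (fun n => zolotarev 1 (psum_law P X n) (normal0 sigma2))
          (fun n => n%:R `^ (- 2^-1) * ln n%:R),
        (forall r : R, 1 < r <= 2 -> ereal_bigO
          (fun n => zolotarev r (psum_law P X n) (normal0 sigma2))
          (fun n => n%:R `^ (- 2^-1)))
      & (forall r : R, 2 < r <= 3 -> ereal_bigO
          (fun n => zolotarev r (psum_law P X n) (normal0 (mean_var P X n)))
          (fun n => n%:R `^ (- 2^-1)))].
Proof.
have [s [s0 cov psumP main [Cs Cs0 std]]] := main_rates tauK tauVK tauP F0_sigma
  F0_measurable F0_incl X_stat X_L3 X_centered past future var.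
pose sq n : R := Num.sqrt n%:R.
have sq_gt0 n : (0 < n)%N -> 0 < sq n by move=> n0; rewrite sqrtr_gt0 ltr0n.
have sqV n : n%:R `^ (- 2^-1) = (sq n)^-1 by rewrite powRN powR12_sqrt.
have ss : Num.sqrt (s ^+ 2) = s by rewrite sqrtr_sqr ger0_norm.
(* The first power of 2 above [n], so that sums up to [2 ^ L] remain comparable to sums up to
   [n]. *)
have dyadic n : (0 < n)%N -> exists2 L, (0 < n <= 2 ^ L)%N & (2 ^ L <= 2 * n)%N.
  move=> n0; exists (trunc_log 2 n).+1; last by rewrite expnS leq_mul2l trunc_logP.
  by rewrite n0 ltnW// trunc_log_ltn.
pose Er f n := `|Ex P (fun w => f (psum X n w / sq n)) -
  Ex (normal_prob (0 : R) 1) (fun y => f (s * y))|.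
have rate_gt1 r : 1 < r <= 3 -> exists2 C, 0 <= C &
    forall f n, (0 < n)%N -> tame r f -> Er f n <= C / sq n.
  move=> /andP[r1 r3]; have r13 : 1 <= r <= 3 by rewrite ltW.
  have [C C0 hC] := main r r13; have [D D0 hD] := sum_weights_gt1 r13 r1.
  exists (C * (1 + D)) => [|f n n0 tf]; first by rewrite mulr_ge0// addr_ge0.
  have [L nL Ln] := dyadic n n0; apply: le_trans (hC f n L tf nL) _.
  rewrite -mulrA; apply: ler_wpM2l => //; rewrite mulrDl mul1r lerD2l.
  apply: le_trans (ler_wpM2l (powR_ge0 _ _) (hD n L n0 Ln)) _.
  rewrite mulrCA -powRD; last by apply/implyP => _; rewrite gt_eqF// sq_gt0.
  by rewrite (_ : - r + (r - 1) = -1) ?powR_inv1 ?sqrtr_ge0//; ring.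
have [C1 C10 rate_1] : exists2 C, 0 <= C &
    forall f n, (0 < n)%N -> tame 1 f -> Er f n <= C * ((sq n)^-1 * (1 + ln n%:R)).
  have r13 : 1 <= (1 : R) <= 3 by rewrite lexx ler1n.
  have [C C0 hC] := main 1 r13; have [D D0 hD] := sum_weights_1 r13 erefl.
  exists (C * (1 + D)) => [|f n n0 tf]; first by rewrite mulr_ge0// addr_ge0.
  have [L nL Ln] := dyadic n n0; apply: le_trans (hC f n L tf nL) _.
  have ln0 : 0 <= ln (n%:R : R) by apply: ln_ge0; rewrite ler1n.
  have i0 : 0 <= (sq n)^-1 by rewrite invr_ge0 sqrtr_ge0.
  rewrite -mulrA; apply: ler_wpM2l => //; rewrite powR_inv1 ?sqrtr_ge0//.
  have := ler_wpM2l i0 (hD n L n0 Ln).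
  have : 0 <= (sq n)^-1 * ln n%:R by rewrite mulr_ge0.
  rewrite -/(sq n); lra.
exists (s ^+ 2); split => //.
- by rewrite exprn_ge0.
(* For n >= e one has 1 + ln n <= 2 ln n, whence the factor 2. *)
- exists (2 * C1); near=> n.
  have n0 : (0 < n)%N by near: n; exact: nbhs_infty_gt.
  have [LS ES] := psumP n.
  apply: zolotarev_law_bound => //;
    [by rewrite lexx ler1n|by rewrite exprn_ge0|by rewrite ltNge ler1n|].
  move=> f tf; rewrite ss sqV; apply: le_trans (rate_1 f n n0 tf) _.
  rewrite [leRHS](_ : _ = C1 * ((sq n)^-1 * (ln n%:R + ln n%:R))); last by ring.
  apply: ler_wpM2l => //; apply: ler_wpM2l; first by rewrite invr_ge0 sqrtr_ge0.
  rewrite lerD2r -[leLHS](expRK 1) ler_ln ?posrE ?expR_gt0 ?ltr0n//.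
  by near: n; exact: nbhs_infty_ger.
- move=> r /andP[r1 r2]; have r13 : 1 <= r <= 3 by apply/andP; split; lra.
  have [|C C0 hC] := rate_gt1 r; first by rewrite r1/=; lra.
  exists C; near=> n.
  have n0 : (0 < n)%N by near: n; exact: nbhs_infty_gt.
  have [LS ES] := psumP n.
  apply: zolotarev_law_bound => //; [by rewrite exprn_ge0|by rewrite ltNge r2|].
  by move=> f tf; rewrite ss sqV; exact: hC.
- move=> r /andP[r2 r3]; have r13 : 1 <= r <= 3 by apply/andP; split; lra.
  have [|C C0 hC] := rate_gt1 r; first by rewrite r3 andbT; lra.
  set nu := N3 (normal_prob (0 : R) 1) idfun.
  have nu0 : 0 <= nu by exact: N3_ge0.
  exists (C + Cs * nu * (1 + (s * nu + Cs * nu) ^+ 2)); near=> n.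
  have n0 : (0 < n)%N by near: n; exact: nbhs_infty_gt.
  have [LS ES] := psumP n.
  have mvE : mean_var P X n = n%:R^-1 * Ex P (fun w => psum X n w ^+ 2).
    by rewrite /mean_var Ex.unlock /Rintegral unlock.
  apply: zolotarev_law_bound => //.
    by rewrite mvE mulr_ge0 ?invr_ge0// Ex_ge0// => w; exact: sqr_ge0.
  move=> f tf; rewrite sqV; set v := Num.sqrt (mean_var P X n).
  have h1 := hC f n n0 tf.
  have dv : `|v - s| <= Cs / sq n by exact: std.
  have c1 : 1 <= sq n by rewrite -[leLHS]sqrtr1 ler_wsqrtr// ler1n.
  have i0 : 0 <= (sq n)^-1 by rewrite invr_ge0 sqrtr_ge0.
  have i1 : (sq n)^-1 <= 1 by rewrite invf_le1// sq_gt0.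
  (* So far the comparison is with s Y. Writing sigma_n Y = s Y + (v - s) Y, the change of variance
     is a perturbation at scale 1, of size O(n^(-1/2)) by [std]. *)
  have h2 := perturb r13 tf (L3_gam_scale s) (L3_gam_scale (v - s)) ltr01.
  rewrite powR1 mul1r divr1 !N3_gam_scale -/nu (ger0_norm s0) in h2.
  have e : Ex (normal_prob (0 : R) 1) (fun y => f (v * y)) =
      Ex (normal_prob (0 : R) 1) (fun y => f (s * y + (v - s) * y)).
    by apply: eq_Ex => y; congr f; ring.
  rewrite e.
  have h3 : `|v - s| * nu * (1 + (s * nu + `|v - s| * nu) ^+ 2) <=
      Cs * nu * (1 + (s * nu + Cs * nu) ^+ 2) / sq n.
    rewrite [leRHS]mulrAC; apply: ler_pM.
    - by rewrite mulr_ge0.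
    - by rewrite addr_ge0// sqr_ge0.
    - by rewrite mulrAC; apply: ler_wpM2r.
    - rewrite lerD2l lerXn2r ?nnegrE ?addr_ge0 ?mulr_ge0// lerD2l.
      apply: ler_wpM2r => //; apply: le_trans dv _; exact: ler_piMr.
  rewrite mulrDl; apply: le_trans (lerD h1 (le_trans h2 h3)).
  rewrite /Er [X in _ <= _ + X]distrC -/(sq n).
  by apply: le_trans (ler_normD _ _); rewrite subrKA.
Unshelve. all: by end_near. Qed.
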